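(* There is an algorithm which, given a matrix $B$ representing a basis of $M_{s,\ell}$ with $BW_\ell$ in weak Popov form, computes a matrix $B'$ representing a basis of $M_{s+1,\ell+1}$ with $B'W_{\ell+1}$ in weak Popov form, using $O(\ell^4 n\log^2 n\log\log n)$ operations in $\mathbb F_q$.
   Context: Let $\mathbb F_q$ be a finite field, $1\le k<n<q$, $\alpha_0,\dots,\alpha_{n-1}$ distinct nonzero elements of $\mathbb F_q$, $w_0,\dots,w_{n-1}$ nonzero elements of $\mathbb F_q$, $r\in\mathbb F_q^n$, $r_i'=r_i/w_i$. For positive integers $s\le\ell$ (standing assumption: $s,\ell\in O(n^2)$), $M_{s,\ell}$ is the $\mathbb F_q[X]$-module of all $Q\in\mathbb F_q[X,Y]$ of $Y$-degree at most $\ell$ such that for each $i$, $Q(X+\alpha_i,Y+r_i')$ has no monomials of total degree less than $s$. A polynomial $\sum_tQ_t(X)Y^t$ has coefficient vector $(Q_0,Q_1,\dots)$; a matrix represents a basis if its rows are the coefficient vectors of the basis elements. $W_\ell=\mathrm{diag}(1,X^{k-1},\dots,X^{\ell(k-1)})$. For $v\in\mathbb F_q[X]^m$, $\deg v=\max_i\deg v_i$ and $\mathrm{LP}(v)=\max\{i:\deg v_i=\deg v\}$; a matrix is in weak Popov form if its rows have pairwise different leading positions. *)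

(* Defs.v *)
From HB Require Import structures.
From mathcomp Require Import all_boot all_order all_algebra.
Set Implicit Arguments. Unset Strict Implicit. Unset Printing Implicit Defensive.
Import Order.TTheory GRing.Theory Num.Theory.
Local Open Scope ring_scope.

(* ---------- Algebraic model of computation ----------
   A computation over an abstract carrier F: field values can only be
   combined through the counted primitive operations below.  Control flow
   and data movement (Coq functions, naturals, lists) are free, as in the
   usual "number of operations in F_q" cost measure. *)
Inductive comp (F A : Type) : Type :=
| Ret of A
| OpAdd of F & F & (F -> comp F A)
| OpMul of F & F & (F -> comp F A)
| OpOpp of F & (F -> comp F A)
| OpInv of F & (F -> comp F A)
| OpIsZero of F & (bool -> comp F A).

Fixpoint run (F : fieldType) (A : Type) (c : comp F A) : A * nat :=
  match c with
  | Ret a => (a, 0%N)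
  | OpAdd x y k => let: (a, n) := run (k (x + y)) in (a, n.+1)
  | OpMul x y k => let: (a, n) := run (k (x * y)) in (a, n.+1)
  | OpOpp x k => let: (a, n) := run (k (- x)) in (a, n.+1)
  | OpInv x k => let: (a, n) := run (k (x^-1)) in (a, n.+1)
  | OpIsZero x k => let: (a, n) := run (k (x == 0)) in (a, n.+1)
  end.

(* Input of the algorithm: n, k, s, l, the alphas, the ws, the received
   word r, and the matrix B (rows of entries, each entry a coefficient list,
   lowest degree first). *)
Record alg_input (F : Type) := AlgInput {
  in_n : nat; in_k : nat; in_s : nat; in_l : nat;
  in_alpha : seq F; in_w : seq F; in_r : seq F;
  in_B : seq (seq (seq F)) }.

(* An algorithm: uniform in the (abstract) field carrier, given the
   constants 0 and 1; outputs a matrix of coefficient lists. *)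
Definition algorithm :=
  forall F : Type, F -> F -> alg_input F -> comp F (seq (seq (seq F))).

Definition encode_mx (F : fieldType) m (B : 'M[{poly F}]_m) : seq (seq (seq F)) :=
  [seq [seq polyseq (B i j) | j <- enum 'I_m] | i <- enum 'I_m].

Definition well_shaped (F : Type) m (out : seq (seq (seq F))) : bool :=
  (size out == m) && all (fun row => size row == m) out.

Definition decode_mx (F : fieldType) m (out : seq (seq (seq F))) : 'M[{poly F}]_m :=
  \matrix_(i < m, j < m) Poly (nth [::] (nth [::] out i) j).

(* The bivariate polynomial sum_t v_t(X) Y^t (outer variable = Y). *)
Definition bivar (F : fieldType) m (v : 'rV[{poly F}]_m) : {poly {poly F}} :=
  \sum_(t < m) (v ord0 t)%:P * 'X^t.

Definition shiftXY (F : fieldType) (a b : F) (Q : {poly {poly F}}) :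
  {poly {poly F}} :=
  (map_poly (fun p : {poly F} => p \Po ('X + a%:P)) Q) \Po ('X + (b%:P)%:P).

Definition no_low_monomials (F : fieldType) (s : nat) (Q : {poly {poly F}}) :=
  forall i j : nat, (i + j < s)%N -> (Q`_j)`_i = 0.

Definition in_M (F : fieldType) (n s l : nat) (alpha w r : 'I_n -> F)
  (v : 'rV[{poly F}]_l.+1) : Prop :=
  forall i : 'I_n, no_low_monomials s (shiftXY (alpha i) (r i / w i) (bivar v)).

Definition is_basis (F : fieldType) (n s l : nat) (alpha w r : 'I_n -> F)
  (B : 'M[{poly F}]_l.+1) : Prop :=
  [/\ forall i, in_M s alpha w r (row i B),
      forall v, in_M s alpha w r v -> exists u : 'rV[{poly F}]_l.+1, v = u *m B
    & forall u : 'rV[{poly F}]_l.+1, u *m B = 0 -> u = 0].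

Definition Wmx (F : fieldType) (k l : nat) : 'M[{poly F}]_l.+1 :=
  diag_mx (\row_(t < l.+1) 'X^(t * k.-1)).

(* Degree (encoded via size = deg + 1) and leading position of a row. *)
Definition rdeg (F : fieldType) m (v : 'rV[{poly F}]_m) : nat :=
  \max_(i < m) size (v ord0 i).

Definition LP (F : fieldType) m (v : 'rV[{poly F}]_m) : nat :=
  \max_(i < m | size (v ord0 i) == rdeg v) (i : nat).

Definition weak_popov (F : fieldType) m p (A : 'M[{poly F}]_(m, p)) : Prop :=
  forall i j : 'I_m, i != j -> LP (row i A) != LP (row j A).

Definition lg (n : nat) : nat := trunc_log 2 n.

(* Main.v *)
Require Import Defs.
From HB Require Import structures.
From mathcomp Require Import all_boot all_order all_fingroup all_algebra.
From mathcomp Require Import zify ring.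
Set Implicit Arguments. Unset Strict Implicit. Unset Printing Implicit Defensive.
Import Order.TTheory GRing.Theory Num.Theory.
Local Open Scope ring_scope.

(** The classical basis of M_(s+1,l+1) obtained from a basis B of M_(s,l) is
    G^(s+1) together with (Y - R) B, where G = prod (X - alpha_i) and R
    interpolates the points (alpha_i, r_i / w_i).  If B W is in weak Popov form,
    the row degrees of this basis exceed the degree of its determinant by only
    O(l n), so O(l n) elementary passes bring it to weak Popov form.

    Reversing the coefficients turns a pass into an elimination on constant
    coefficients in x = 1/X, hence a sequence of passes depends only on a
    truncation of the matrix and can be computed by divide and conquer, as in
    the approximant basis algorithm of Giorgi, Jeannerod and Villard.  A pass
    in which every row is a pivot certifies weak Popov form; any other pass
    lowers the sum of the row degrees, which is bounded below by the degree of
    the determinant.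

    The same reduction, on a 2 x 2 matrix, inverts G' modulo G, so that R is
    found without any fast division.  Products are computed with the algorithm
    of Schonhage and Strassen, in radix 2, or in radix 3 in characteristic 2. *)

(** The budget shapes the proof. On matrices of size l + 2 the divide and conquer costs l^3 times
    log(l n) times a product of polynomials of length l n, provided that both the number of passes
    and the input degrees are O(l n). For the passes: R has degree at most 2n, so (Y - R) raises the
    weighted degree of each of the l + 1 rows of B by at most 2n, while G^(s+1) contributes equally
    to the row degrees and to the determinant. For the degrees: the determinant controls only the
    sum of the row degrees of B W; that each of them is O(l n) comes from exchanging a row with some
    G^s Y^t.

    The carrier of a program is abstract: it offers no roots of unity, and its characteristic is
    seen only through the test 1 + 1 = 0. Roots of unity are therefore powers of X in a quotient of
    F[X], and the radix must be invertible because the inverse transform divides by the number of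
    points. Lengths of lists and comparisons of degrees are free, so choosing pivots by degree costs
    nothing. *)

Notation prog := Defs.comp.

(** * Programs, their cost, and specifications with cost bounds *)

Section Programs.
Variable F : Type.

Fixpoint cbind A B (c : prog F A) (f : A -> prog F B) : prog F B :=
  match c with
  | Ret a => f a
  | OpAdd x y k => OpAdd x y (fun z => cbind (k z) f)
  | OpMul x y k => OpMul x y (fun z => cbind (k z) f)
  | OpOpp x k => OpOpp x (fun z => cbind (k z) f)
  | OpInv x k => OpInv x (fun z => cbind (k z) f)
  | OpIsZero x k => OpIsZero x (fun z => cbind (k z) f)
  end.

Fixpoint cmap X A (f : X -> prog F A) (s : seq X) : prog F (seq A) :=
  if s is x :: s' then
    cbind (f x) (fun a => cbind (cmap f s') (fun t => Ret F (a :: t)))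
  else Ret F [::].

Definition tab A n (f : nat -> prog F A) := cmap f (iota 0 n).

Fixpoint crepeat A n (f : nat -> A -> prog F A) (a : A) : prog F A :=
  if n is n'.+1 then cbind (crepeat n' f a) (f n') else Ret F a.

Definition pad (z : F) n (s : seq F) := take n (s ++ nseq n z).

End Programs.

Notation "x <-- c ; d" := (cbind c (fun x => d))
  (at level 100, c at next level, d at level 200, right associativity).

Section Triples.
Variable F : fieldType.
Implicit Types A B : Type.

(** A Hoare triple with a cost bound. Programs live over an arbitrary carrier type; the field
    structure enters only here, through [run]. *)
Definition tr A (c : prog F A) (n : nat) (P : A -> Prop) :=
  P (run c).1 /\ ((run c).2 <= n)%N.

Lemma run_bind A B (c : prog F A) (f : A -> prog F B) :
  run (cbind c f) = ((run (f (run c).1)).1, ((run c).2 + (run (f (run c).1)).2)%N).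
Proof.
elim: c => [a|x y k IH|x y k IH|x k IH|x k IH|x k IH] /=;
  first by rewrite add0n; case: (run (f a)).
all: by rewrite IH; case: (run (k _)) => a n /=; rewrite addSn.
Qed.

Lemma tr_bind A B (c : prog F A) (f : A -> prog F B) n m P Q :
  tr c n P -> (forall a, P a -> tr (f a) m Q) -> tr (cbind c f) (n + m) Q.
Proof.
move=> [Pc cn] H; have [Qf fm] := H _ Pc.
by rewrite /tr run_bind; split=> //=; apply: leq_add.
Qed.

Lemma tr_ret A (a : A) n (P : A -> Prop) : P a -> tr (Ret F a) n P.
Proof. by move=> Pa; split. Qed.

Lemma tr_weak A (c : prog F A) n m (P Q : A -> Prop) :
  tr c n P -> (n <= m)%N -> (forall a, P a -> Q a) -> tr c m Q.
Proof. by move=> [Pc cn] nm PQ; split; [apply: PQ | apply: leq_trans nm]. Qed.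

Lemma tr_seq A B (c : prog F A) (f : A -> prog F B) n m N P Q :
  tr c n P -> (n + m <= N)%N -> (forall a, P a -> tr (f a) m Q) -> tr (cbind c f) N Q.
Proof. by move=> hc hN hf; apply: tr_weak (tr_bind hc hf) hN _. Qed.

Lemma tr_add A (x y : F) (k : F -> prog F A) n P :
  tr (k (x + y)) n P -> tr (OpAdd x y k) n.+1 P.
Proof. by rewrite /tr /=; case: (run _). Qed.
Lemma tr_mul A (x y : F) (k : F -> prog F A) n P :
  tr (k (x * y)) n P -> tr (OpMul x y k) n.+1 P.
Proof. by rewrite /tr /=; case: (run _). Qed.
Lemma tr_opp A (x : F) (k : F -> prog F A) n P :
  tr (k (- x)) n P -> tr (OpOpp x k) n.+1 P.
Proof. by rewrite /tr /=; case: (run _). Qed.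
Lemma tr_inv A (x : F) (k : F -> prog F A) n P :
  tr (k x^-1) n P -> tr (OpInv x k) n.+1 P.
Proof. by rewrite /tr /=; case: (run _). Qed.
Lemma tr_isz A (x : F) (k : bool -> prog F A) n P :
  tr (k (x == 0)) n P -> tr (OpIsZero x k) n.+1 P.
Proof. by rewrite /tr /=; case: (run _). Qed.

Lemma tr_cmap A (f : nat -> prog F A) i0 n c (P : nat -> A -> Prop) d :
  (forall i, (i0 <= i < i0 + n)%N -> tr (f i) c (P i)) ->
  tr (cmap f (iota i0 n)) (n * c)
     (fun s => size s = n /\ forall i, (i < n)%N -> P (i0 + i)%N (nth d s i)).
Proof.
elim: n i0 => [|n IH] i0 H /=; first by split.
rewrite mulSn; apply: tr_bind (H i0 _) _; first by lia.
move=> a Pa; rewrite -[X in tr _ X]addn0; apply: tr_bind.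
  by apply: IH => i Hi; apply: H; lia.
move=> s [sn Hs]; apply: tr_ret; split=> /=; first by rewrite sn.
by case=> [|i] Hi /=; rewrite ?addn0 // -addSnnS; apply: Hs.
Qed.

Lemma tr_tab A (d : A) n (f : nat -> prog F A) c (P : nat -> A -> Prop) :
  (forall i, (i < n)%N -> tr (f i) c (P i)) ->
  tr (tab n f) (n * c)
     (fun s => size s = n /\ forall i, (i < n)%N -> P i (nth d s i)).
Proof. by move=> H; apply: (@tr_cmap A f 0 n c P d) => i /andP[_]; apply: H. Qed.

Lemma tr_crepeat A n (f : nat -> A -> prog F A) a c (P : nat -> A -> Prop) :
  P 0%N a -> (forall i x, (i < n)%N -> P i x -> tr (f i x) c (P i.+1)) ->
  tr (crepeat n f a) (n * c) (P n).
Proof.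
move=> P0; elim: n => [|n IH] H /=; first by split.
rewrite mulSn addnC; apply: tr_bind (IH _) _; first by move=> i x Hi; apply: H; lia.
by move=> x; apply: H.
Qed.

End Triples.

(** * Coefficient lists as polynomials *)

Section PolySeq.
Variable R : nzRingType.
Implicit Types (s t : seq R) (p q : {poly R}).

Lemma Poly_cat s t : Poly (s ++ t) = Poly s + 'X^(size s) * Poly t.
Proof.
apply/polyP=> i; rewrite coefD coefXnM !coef_Poly nth_cat.
case: ltnP => h; first by rewrite addr0.
by rewrite [X in X + _]nth_default // add0r.
Qed.

Lemma Poly_nseq0 n : Poly (nseq n 0 : seq R) = 0.
Proof. by apply/polyP=> i; rewrite coef_Poly coef0 nth_nseq if_same. Qed.

Lemma Poly_nil : Poly ([::] : seq R) = 0.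
Proof. exact: (Poly_nseq0 0). Qed.

Lemma Poly_take_drop n s : (n <= size s)%N ->
  Poly s = Poly (take n s) + 'X^n * Poly (drop n s).
Proof. by move=> h; rewrite -{1}(cat_take_drop n s) Poly_cat size_takel. Qed.

Lemma Poly_split n s : Poly s = Poly (take n s) + 'X^n * Poly (drop n s).
Proof.
case: (leqP n (size s)) => h; first exact: Poly_take_drop.
by rewrite take_oversize ?drop_oversize ?Poly_nil ?mulr0 ?addr0 // ltnW.
Qed.

Lemma size_Poly_le s n : (size s <= n)%N -> (size (Poly s) <= n)%N.
Proof. by move=> h; apply: leq_trans (size_Poly _) h. Qed.

Lemma mulXn_inj n p q : 'X^n * p = 'X^n * q -> p = q.
Proof.
move=> /polyP h; apply/polyP=> i; have := h (n + i)%N.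
by rewrite !coefXnM ltnNge leq_addr /= addKn.
Qed.

Lemma Poly_drop n s q : Poly s = 'X^n * q -> Poly (drop n s) = q.
Proof.
move=> h; apply/polyP=> i; have /polyP/(_ (n + i)%N) := h.
by rewrite coefXnM ltnNge leq_addr /= addKn !coef_Poly nth_drop.
Qed.

Lemma size_pad (z : R) n s : size (pad z n s) = n.
Proof. by rewrite size_takel // size_cat size_nseq leq_addl. Qed.

Lemma nth_pad n s i : nth 0 (pad 0 n s) i = if (i < n)%N then nth 0 s i else 0.
Proof.
case: ltnP => h; last by rewrite nth_default // size_pad.
rewrite nth_take // nth_cat; case: ltnP => // h'.
by rewrite nth_nseq if_same nth_default.
Qed.

Lemma Poly_pad n s : (size (Poly s) <= n)%N -> Poly (pad 0 n s) = Poly s.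
Proof.
move=> h; apply/polyP=> i; rewrite !coef_Poly nth_pad; case: ltnP => // h'.
by rewrite -coef_Poly nth_default // (leq_trans h).
Qed.

Lemma Poly_flatten m (bs : seq (seq R)) : (forall b, b \in bs -> size b = m) ->
  Poly (flatten bs) = \sum_(j < size bs) 'X^(m * j) * Poly (nth [::] bs j).
Proof.
elim: bs => [|b bs IH] H; first by rewrite big_ord0 Poly_nil.
rewrite /= big_ord_recl /= muln0 mul1r Poly_cat IH ?mulr_sumr; last first.
  by move=> c hc; apply: H; rewrite inE hc orbT.
rewrite (H b) ?mem_head //; congr (_ + _); apply: eq_bigr => j _.
by rewrite mulrA -exprD /bump /= add1n mulnS.
Qed.

Lemma Poly_blocks m n s : (size s <= n * m)%N ->
  Poly s = \sum_(j < n) 'X^(m * j) * Poly (take m (drop (j * m) s)).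
Proof.
elim: n s => [|n IH] s h.
  by rewrite big_ord0; case: s h => // _; rewrite Poly_nil.
rewrite big_ord_recl /= muln0 mul0n drop0 mul1r (Poly_split m); congr (_ + _).
rewrite (IH (drop m s)) ?size_drop; last by rewrite leq_subLR -mulSn.
rewrite mulr_sumr; apply: eq_bigr => j _.
by rewrite mulrA -exprD /bump /= add1n mulnS drop_drop [(n in drop n _)]addnC -mulSn.
Qed.

End PolySeq.

Section VectorPrograms.
Variables (F : Type) (zero one : F).

(** Missing entries are read as [zero], so the cost depends on [n] alone; with [a] empty this is
    multiplication by a scalar. *)
Definition axpy n (c : F) (a b : seq F) : prog F (seq F) :=
  tab n (fun i => OpMul c (nth zero b i) (fun z =>
    OpAdd (nth zero a i) z (fun y => Ret F y))).

Definition vsum L n (f : nat -> prog F (seq F)) : prog F (seq F) :=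
  crepeat n (fun i acc => v <-- f i; axpy L one acc v) (nseq L zero).

End VectorPrograms.

Section VectorTriples.
Variable F : fieldType.

Lemma tr_axpy n (c : F) a b : (size a <= n)%N -> (size b <= n)%N ->
  tr (axpy 0 n c a b) (n * 2)
    (fun o => size o = n /\ Poly o = Poly a + c *: Poly b).
Proof.
move=> ha hb; apply: tr_weak (tr_tab 0 (P := fun i y => y = nth 0 a i + c * nth 0 b i) _) _ _.
- by move=> i _; apply: tr_mul; apply: tr_add; apply: tr_ret.
- by [].
- move=> o [so Ho]; split=> //; apply/polyP=> i.
  rewrite coefD coefZ !coef_Poly; case: (ltnP i n) => hi; first by rewrite Ho.
  by rewrite !nth_default ?so ?mulr0 ?addr0 //; apply: leq_trans hi.
Qed.

Lemma tr_vsum L n (f : nat -> prog F (seq F)) c (g : nat -> {poly F}) :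
  (forall i, (i < n)%N -> tr (f i) c (fun v => (size v <= L)%N /\ Poly v = g i)) ->
  tr (vsum 0 1 L n f) (n * (c + L * 2))
    (fun o => size o = L /\ Poly o = \sum_(i < n) g i).
Proof.
move=> H; apply: (tr_crepeat (P := fun i o => size o = L /\ Poly o = \sum_(j < i) g j)).
  by rewrite size_nseq big_ord0 Poly_nseq0.
move=> i x hi [sx Hx]; apply: tr_bind (H i hi) _ => v [sv Hv].
apply: tr_weak (tr_axpy _ _ sv) _ _ => //; first by rewrite sx.
by move=> o [so ->]; rewrite big_ord_recr /= Hx Hv scale1r.
Qed.

End VectorTriples.

(** * Fast multiplication over an arbitrary field *)

Section FastMul.
Variables (F : Type) (zero one : F) (r : nat).

(* Modulo X^L - 1 the roots of unity X^(g e) act by rotations, which are free: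
   only the additions of the butterflies are counted. *)
Fixpoint dft c g L (f : seq (seq F)) : prog F (seq (seq F)) :=
  if c is c'.+1 then
    fs <-- tab r (fun i =>
      dft c' (g * r) L [seq nth [::] f (j * r + i) | j <- iota 0 (r ^ c')]);
    tab (r ^ c) (fun e => vsum zero one L r (fun i =>
      Ret F (rotr ((g * e * i) %% L) (nth [::] (nth [::] fs i) (e %% r ^ c')))))
  else Ret F [:: nth [::] f 0].

(** Passage from modulo X^(r^(k+1)) - 1 to modulo Psi_k, where X^((r-1) r^k) is minus the sum of the
    lower powers of X^(r^k): the top block is subtracted from each of the r - 1 others. *)
Definition fold_cyclotomic k (v : seq F) : prog F (seq F) :=
  OpOpp one (fun mone => axpy zero (r.-1 * r ^ k) mone (take (r.-1 * r ^ k) v)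
    (flatten (nseq r.-1 (drop (r.-1 * r ^ k) v)))).

(** Schoolbook product modulo X^(r^(k+1)) - 1, where the shifts of [b] are free rotations, followed
    by reduction modulo Psi_k. Meant for k <= 2. *)
Definition mulmod_naive k (a b : seq F) : prog F (seq F) :=
  c <-- vsum zero one (r ^ k.+1) (r.-1 * r ^ k) (fun u =>
    axpy zero (r ^ k.+1) (nth zero a u) [::]
      (rotr (u %% r ^ k.+1) (pad zero (r ^ k.+1) b)));
  fold_cyclotomic k c.

(** The equation (r - 1) r^k' = 2 r^ka forces k' = ka + 1 in radix 2 and k' = ka in radix 3. The
    rounding of ka then ensures k - ka <= k', so that a power of X is a principal root of unity of
    order r^(k-ka+1) modulo Psi_k'. *)
Definition split_lo k := if r == 2%N then k./2 else (k - k./2)%N.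
Definition split_in k := if r == 2%N then (split_lo k).+1 else split_lo k.

Definition fnat n : prog F F :=
  crepeat n (fun _ x => OpAdd x one (fun y => Ret F y)) zero.

(* Product modulo Psi_k = 1 + X^(r^k) + ... + X^((r-1) r^k).  The operands are cut
   into blocks of m coefficients, polynomials in Y = X^m over F[X]/Psi_k'.  Only
   the points that are roots of Psi_r(Y^t), those of index e prime to r, are
   multiplied; the value 0 at the other points changes the interpolated
   polynomial by a multiple of Psi_r(Y^t) only.  Since (r - 1) r^k' = 2 m, the
   total size of the recursive products is exactly twice that of the operands. *)
Fixpoint mulmod fuel k (a b : seq F) : prog F (seq F) :=
  if fuel isn't fuel'.+1 then mulmod_naive k a b else
  if (k <= 2)%N then mulmod_naive k a b else
  let ka := split_lo k in let kb := (k - ka)%N in let k' := split_in k in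
  let m := (r ^ ka)%N in let t := (r ^ kb)%N in let K := (r ^ kb.+1)%N in
  let L := (r ^ k'.+1)%N in let g := (r ^ (k' - kb))%N in
  let blocks s := [seq pad zero L (take m (drop (j * m) s)) | j <- iota 0 K] in
  ah <-- dft kb.+1 g L (blocks a);
  bh <-- dft kb.+1 g L (blocks b);
  cs <-- tab t (fun e => tab r.-1 (fun i =>
    u <-- fold_cyclotomic k' (nth [::] ah (e * r + i.+1));
    v <-- fold_cyclotomic k' (nth [::] bh (e * r + i.+1));
    mulmod fuel' k' u v));
  dh <-- dft kb.+1 g L [seq if (r %| e)%N then nseq L zero else
    pad zero L (nth [::] (nth [::] cs (e %/ r)) (e %% r).-1) | e <- iota 0 K];
  kf <-- fnat K;
  OpInv kf (fun ki =>
  qs <-- tab K (fun j =>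
    u <-- fold_cyclotomic k' (nth [::] dh ((K - j) %% K));
    axpy zero (m + m) ki [::] u);
  os <-- tab K (fun j => axpy zero m one (take m (nth [::] qs j))
    (drop m (nth [::] qs ((j + K.-1) %% K))));
  fold_cyclotomic k (flatten os)).

End FastMul.

(** * Sums over principal roots of unity *)

Section Sums.

Lemma sum_mul_split (V : nmodType) r n (h : nat -> V) :
  \sum_(j < n * r) h j = \sum_(i < r) \sum_(j < n) h (j * r + i)%N.
Proof.
elim: n => [|n IH]; first by rewrite mul0n big_ord0 big1 // => i _; rewrite big_ord0.
rewrite mulSn addnC big_split_ord /= IH -big_split /=.
by apply: eq_bigr => i _; rewrite big_ord_recr.
Qed.

Lemma dvdn_add_mod t x j w : (t %| x + j)%N -> (t %| x + w)%N = (j == w %[mod t]).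
Proof.
move=> h; rewrite -(eqn_modDl x j w) [LHS]/dvdn eq_sym.
by move: h; rewrite /dvdn => /eqP ->.
Qed.

Lemma neg_mod_add K j t : (j < K)%N -> (t %| K)%N -> (t %| (K - j) %% K + j)%N.
Proof.
move=> jK tK; case: j jK => [|j] jK; first by rewrite subn0 modnn addn0 dvdn0.
by rewrite modn_small ?subnK //; lia.
Qed.

Variables (A : comNzRingType) (r : nat) (y : A).
Hypothesis r23 : r = 2%N \/ r = 3%N.

Lemma cyclo_root1 : \sum_(i < r) y ^+ i = 0 -> y ^+ r = 1.
Proof. by move=> h; apply/eqP; rewrite -subr_eq0 subrX1 h mulr0. Qed.

(** As y^r = 1 and multiplication by d permutes the residues modulo r, the terms are merely
    permuted. For r = 2 or 3 it is enough to inspect d modulo r. *)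
Lemma cyclo_twist d : \sum_(i < r) y ^+ i = 0 -> ~~ (r %| d)%N ->
  \sum_(i < r) y ^+ (d * i) = 0.
Proof.
move=> h rd; have y1 := cyclo_root1 h.
have -> : \sum_(i < r) y ^+ (d * i) = \sum_(i < r) (y ^+ (d %% r)) ^+ i.
  by apply: eq_bigr => i _; rewrite exprM -(expr_mod d y1).
have := ltn_pmod d (ltac:(by case: r23 => ->) : 0 < r)%N.
move: rd y1 h; rewrite /dvdn.
case: r23 => ->; case: (d %% _)%N => [|[|[|//]]] //= _ y1 h _.
rewrite -[RHS]h !big_ord_recl !big_ord0 /= /bump /= !addr0 ?addn0 !expr0.
have y4 : y ^+ 2 ^+ 2 = y by rewrite -exprM -[RHS]mul1r -y1 -exprSr.
by rewrite !expr1 -[(1 + 1)%N]/2%N y4; congr (_ + _); rewrite addrC.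
Qed.

End Sums.

Section RootSum.
Variables (A : comNzRingType) (r : nat) (x : A) (M : nat).
Hypothesis r23 : r = 2%N \/ r = 3%N.
Hypothesis xM : \sum_(i < r) (x ^+ M) ^+ i = 0.

Let r_gt0 : (0 < r)%N. Proof. by case: r23 => ->. Qed.

Lemma cyclo_order : x ^+ (r * M) = 1.
Proof. by rewrite mulnC exprM cyclo_root1. Qed.

(** Orthogonality. A may have zero divisors, so the geometric series cannot be divided by its ratio
    minus 1; instead e = j r^c + i is split on its top digit j. If r divides d the terms do not
    depend on j and the induction applies to d / r; otherwise the sum over j vanishes by
    [cyclo_twist]. *)
Lemma root_sum c g d : (g * r ^ c = r * M)%N ->
  \sum_(e < r ^ c) x ^+ (g * e * d) = if (r ^ c %| d)%N then (r ^ c)%:R else 0.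
Proof.
elim: c g d => [|c IH] g d hg.
  by rewrite expn0 big_ord_recl big_ord0 dvd1n /= muln0 mul0n addr0.
rewrite expnS (@sum_mul_split A (r ^ c) r (fun e => x ^+ (g * e * d))).
have hg' : (g * r ^ c = M)%N.
  by apply/eqP; rewrite -(eqn_pmul2l r_gt0) -hg expnS; apply/eqP; ring.
have [/dvdnP[d' ->]|rd] := boolP (r %| d)%N.
  have e1 (i : 'I_(r ^ c)) (j : 'I_r) :
      x ^+ (g * (j * r ^ c + i) * (d' * r)) = x ^+ (g * r * i * d').
    have -> : (g * (j * r ^ c + i) * (d' * r) = g * r * i * d' + r * M * (j * d'))%N.
      by rewrite -hg'; ring.
    by rewrite exprD (exprM _ (r * M)) cyclo_order expr1n mulr1.
  under eq_bigr => i _ do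
    (under eq_bigr => j _ do rewrite e1; rewrite sumr_const card_ord).
  rewrite sumrMnl IH; last by rewrite -hg expnS; ring.
  rewrite [(d' * r)%N]mulnC dvdn_pmul2l //; case: ifP => _; last by rewrite mul0rn.
  by rewrite -mulrnA mulnC.
rewrite [(_ %| d)%N](negPf _); last first.
  by apply: contra rd; apply: dvdn_trans; rewrite dvdn_mulr.
rewrite big1 // => i _.
rewrite (eq_bigr (fun j : 'I_r => x ^+ (g * i * d) * (x ^+ M) ^+ (d * j))); last first.
  by move=> j _; rewrite -exprM -exprD -hg'; congr (_ ^+ _); ring.
by rewrite -mulr_sumr cyclo_twist ?mulr0.
Qed.

End RootSum.

(** * Correctness and cost of the product modulo Psi_k *)

Section DftTriple.
Variables (F : fieldType) (r : nat).
Hypothesis r_gt0 : (0 < r)%N.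

Lemma phi_rotr (A : comNzRingType) (phi : {rmorphism {poly F} -> A}) L e s :
  size s = L -> (0 < L)%N -> phi 'X ^+ L = 1 ->
  phi (Poly (rotr (e %% L) s)) = phi 'X ^+ e * phi (Poly s).
Proof.
move=> ss L0 xL; rewrite -(expr_mod e xL); set k := (e %% L)%N.
have kL : (k < L)%N by apply: ltn_pmod.
rewrite /rotr /rot ss Poly_cat size_drop ss subKn ?(ltnW kL) //.
rewrite [in RHS](Poly_split (L - k)) !rmorphD !rmorphM !rmorphXn /= mulrDr mulrA.
by rewrite -exprD subnKC ?(ltnW kL) // xL mul1r addrC.
Qed.

(** Decimation in time: writing j = j' r + i gives r transforms of size r^c with root X^(g r),
    recombined with the twiddle factors X^(g e i). Quantifying over every [phi] with phi(X)^L = 1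
    expresses congruence modulo X^L - 1, which can later be specialised to Psi_k'. *)
Lemma tr_dft c g L f : (0 < L)%N -> (g * r ^ c = L)%N ->
  (forall j, (j < r ^ c)%N -> size (nth [::] f j) = L) ->
  tr (dft 0 (1 : F) r c g L f) (c * r ^ c * (r * (L * 2)))
    (fun o => forall e, (e < r ^ c)%N -> size (nth [::] o e) = L /\
      forall (A : comNzRingType) (phi : {rmorphism {poly F} -> A}),
        phi 'X ^+ L = 1 ->
        phi (Poly (nth [::] o e)) =
        \sum_(j < r ^ c) phi 'X ^+ (g * e * j) * phi (Poly (nth [::] f j))).
Proof.
move=> L0; elim: c g f => [|c IH] g f hg hf.
  apply: tr_ret => e; rewrite expn0 ltnS leqn0 => /eqP -> /=; split; first exact: hf.
  by move=> A phi _; rewrite big_ord_recl big_ord0 muln0 mul1r addr0.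
have rc : (0 < r ^ c)%N by rewrite expn_gt0 r_gt0.
rewrite [dft _ _ _ _ _ _ _]/=.
set fi := fun i => [seq nth [::] f (j * r + i) | j <- iota 0 (r ^ c)].
have nfi i j : (j < r ^ c)%N -> nth [::] (fi i) j = nth [::] f (j * r + i).
  by move=> hj; rewrite (nth_map 0%N) ?size_iota // nth_iota.
have hidx i j : (i < r)%N -> (j < r ^ c)%N -> (j * r + i < r ^ c.+1)%N.
  move=> hi hj; rewrite expnS; apply: (@leq_trans (j.+1 * r)).
    by rewrite mulSn addnC ltn_add2r.
  by rewrite mulnC leq_mul2l hj orbT.
apply: tr_seq (tr_tab [::] (c := c * r ^ c * (r * (L * 2)))
  (P := fun i o => forall e, (e < r ^ c)%N -> size (nth [::] o e) = L /\
      forall (A : comNzRingType) (phi : {rmorphism {poly F} -> A}),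
        phi 'X ^+ L = 1 -> phi (Poly (nth [::] o e)) =
        \sum_(j < r ^ c) phi 'X ^+ (g * r * e * j) * phi (Poly (nth [::] (fi i) j))) _)
  (_ : (_ + r ^ c.+1 * (r * (0 + L * 2)) <= _)%N) _.
- move=> i hi; apply: IH; first by rewrite -hg expnS mulnA.
  by move=> j hj; rewrite nfi // hf // hidx.
- by rewrite add0n expnS; lia.
move=> fs [sfs Hfs]; apply: tr_weak (tr_tab [::] (P := fun e o => size o = L /\ Poly o =
    \sum_(i < r) Poly (rotr ((g * e * i) %% L) (nth [::] (nth [::] fs i) (e %% r ^ c)))) _) (leqnn _) _.
  move=> e he; have em : (e %% r ^ c < r ^ c)%N by apply: ltn_pmod.
  apply: (tr_vsum (c := 0) (g := fun i => Poly (rotr ((g * e * i) %% L)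
            (nth [::] (nth [::] fs i) (e %% r ^ c))))).
  move=> i hi; apply: tr_ret; split=> //.
  by rewrite size_rot (Hfs i hi _ em).1.
move=> o [so Ho] e he; have [s1 ->] := Ho e he; split=> // A phi xL.
  have em : (e %% r ^ c < r ^ c)%N by apply: ltn_pmod.
  rewrite rmorph_sum /= expnSr
    (sum_mul_split r (r ^ c) (fun j => phi 'X ^+ (g * e * j) * phi (Poly (nth [::] f j)))).
  apply: eq_bigr => i _; have [sz Hp] := Hfs i (ltn_ord i) _ em.
  rewrite phi_rotr // Hp // mulr_sumr; apply: eq_bigr => j _.
  rewrite nfi // mulrA -exprD; congr (_ * _).
  rewrite -[in RHS](expr_mod _ xL) -[in LHS](expr_mod _ xL); congr (_ ^+ _).
  (* Taking e modulo r^c in the smaller transforms changes the exponent by a multiple of L = g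
     r^(c+1). *)
  rewrite {3}(divn_eq e (r ^ c)).
  have -> : (g * (e %/ r ^ c * r ^ c + e %% r ^ c) * (j * r + i) =
     (g * (e %/ r ^ c * r ^ c + e %% r ^ c) * i + g * r * (e %% r ^ c) * j)
     + (e %/ r ^ c * j) * L)%N by rewrite -hg expnS; ring.
  by rewrite -divn_eq [in RHS]addnC modnMDl.
Qed.

End DftTriple.

Section Mulmod.
Variables (F : fieldType) (r : nat).
Hypothesis r23 : r = 2%N \/ r = 3%N.
Hypothesis r_unit : r%:R != 0 :> F.

Let r_gt0 : (0 < r)%N. Proof. by case: r23 => ->. Qed.
Let r_gt1 : (1 < r)%N. Proof. by case: r23 => ->. Qed.

(* The morphisms killing Psi_k: congruence modulo Psi_k is equality under all of them. *)
Definition cyclotomic_hom k (A : comNzRingType) (phi : {rmorphism {poly F} -> A}) :=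
  \sum_(i < r) (phi 'X ^+ (r ^ k)) ^+ i = 0.

Definition cyclo k : {poly F} := \sum_(i < r) ('X^(r ^ k)) ^+ i.

Lemma cyclo_size_monic k : cyclo k \is monic /\ size (cyclo k) = (r.-1 * r ^ k).+1.
Proof.
have M0 : (0 < r ^ k)%N by rewrite expn_gt0 r_gt0.
rewrite /cyclo; case: r23 => ->; rewrite !big_ord_recl big_ord0 /= /bump /= addr0 expr0.
  by rewrite expr1 mul1n addrC -[1]/(1%:P) monicXnaddC ?expn_gt0 // size_XnaddC ?expn_gt0.
have s1 : (size (1 + 'X^(3 ^ k) : {poly F})%R < size ('X^(3 ^ k) ^+ 2 : {poly F})%R)%N.
  rewrite addrC -[1]/(1%:P) size_XnaddC ?expn_gt0 // -exprM size_polyXn ltnS.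
  by have := expn_gt0 3 k; lia.
rewrite expr1 -[(1 + 1)%N]/2%N addrA monicE lead_coefDr // addrC size_polyDl //.
by rewrite -exprM lead_coefXn size_polyXn mulnC.
Qed.

(** The projection onto F[X]/Psi_k is itself such a morphism, and it is injective below the degree
    of Psi_k. *)
Lemma cyclo_exact k (p q : {poly F}) :
  (size p <= r.-1 * r ^ k)%N -> (size q <= r.-1 * r ^ k)%N ->
  (forall (A : comNzRingType) (phi : {rmorphism {poly F} -> A}),
     cyclotomic_hom k phi -> phi p = phi q) -> p = q.
Proof.
move=> sp sq H; have [cm cs] := cyclo_size_monic k.
have M0 : (0 < r ^ k)%N by rewrite expn_gt0 r_gt0.
(* [in_qpoly] works modulo [mk_monic], which substitutes a default for any modulus that is not monic
   and nonconstant. *)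
have mk : mk_monic (cyclo k) = cyclo k.
  by rewrite /mk_monic cm andbT cs ltnS muln_gt0 M0 andbT -subn1 subn_gt0 r_gt1.
have := H _ (in_qpoly (cyclo k)); rewrite /cyclotomic_hom.
have -> : \sum_(i < r) in_qpoly (cyclo k) 'X ^+ (r ^ k) ^+ i = in_qpoly (cyclo k) (cyclo k).
  by rewrite [in RHS]/cyclo rmorph_sum /=; apply: eq_bigr => i _; rewrite !rmorphXn.
have c0 : in_qpoly (cyclo k) (cyclo k) = 0.
  by apply: val_inj; rewrite /= mk Pdiv.RingMonic.rmodpp.
move=> /(_ c0) /(congr1 val) /=.
by rewrite mk !Pdiv.Ring.rmodp_small // cs ltnS.
Qed.

Lemma tr_fold_cyclotomic k v : size v = (r ^ k.+1)%N ->
  tr (fold_cyclotomic 0 (1 : F) r k v) (r.-1 * r ^ k * 2).+1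
    (fun o => size o = (r.-1 * r ^ k)%N /\
       forall (A : comNzRingType) (phi : {rmorphism {poly F} -> A}),
         cyclotomic_hom k phi -> phi (Poly o) = phi (Poly v)).
Proof.
move=> sv; set N := (r.-1 * r ^ k)%N.
have sN : (size v = N + r ^ k)%N.
  by rewrite sv expnS /N -{1}(prednK r_gt0) mulSn addnC.
apply: tr_opp; apply: tr_weak (tr_axpy _ _ _) (leqnn _) _.
- by rewrite size_take_min geq_minl.
- rewrite size_flatten /shape map_nseq sumn_nseq size_drop sN addKn.
  by rewrite mulnC.
move=> o [so ->]; split=> // A phi h.
rewrite [in RHS](Poly_split N) scaleN1r rmorphB rmorphD; congr (_ + _).
rewrite rmorphM rmorphXn /= (@Poly_flatten _ (r ^ k)); last first.
  by move=> b /nseqP[-> _]; rewrite size_drop sN addKn.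
rewrite size_nseq rmorph_sum /=.
under eq_bigr => i _ do rewrite nth_nseq ltn_ord rmorphM rmorphXn /= exprM.
rewrite -mulr_suml -mulNr; congr (_ * _).
have sr (y : A) : \sum_(i < r) y ^+ i = \sum_(i < r.-1) y ^+ i + y ^+ r.-1.
  by case: r r_gt0 => // r' _; rewrite big_ord_recr.
move: h; rewrite /cyclotomic_hom sr => /eqP.
by rewrite addrC addr_eq0 => /eqP <-; rewrite -exprM mulnC.
Qed.

Lemma cyclo_hom_order k (A : comNzRingType) (phi : {rmorphism {poly F} -> A}) :
  cyclotomic_hom k phi -> phi 'X ^+ (r ^ k.+1) = 1.
Proof. by move=> h; rewrite expnS; apply: cyclo_order. Qed.

Lemma tr_mulmod_naive k a b :
  size a = (r.-1 * r ^ k)%N -> size b = (r.-1 * r ^ k)%N ->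
  tr (mulmod_naive 0 (1 : F) r k a b)
    (r.-1 * r ^ k * (r ^ k.+1 * 2 + r ^ k.+1 * 2) + (r.-1 * r ^ k * 2).+1)
    (fun o => size o = (r.-1 * r ^ k)%N /\
       forall (A : comNzRingType) (phi : {rmorphism {poly F} -> A}),
         cyclotomic_hom k phi -> phi (Poly o) = phi (Poly a) * phi (Poly b)).
Proof.
move=> sa sb; have L0 : (0 < r ^ k.+1)%N by rewrite expn_gt0 r_gt0.
have bl : (size b <= r ^ k.+1)%N by rewrite sb expnS leq_mul2r leq_pred orbT.
apply: tr_bind (tr_vsum (c := r ^ k.+1 * 2) (g := fun u => (nth 0 a u) *:
  Poly (rotr (u %% r ^ k.+1) (pad 0 (r ^ k.+1) b))) _) _.
  move=> u _; apply: tr_weak (tr_axpy _ _ _) (leqnn _) _ => //.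
    by rewrite size_rot size_pad.
  by move=> o [-> ->]; rewrite Poly_nil add0r.
move=> c [sc Hc]; apply: tr_weak (tr_fold_cyclotomic sc) (leqnn _) _.
move=> o [so Ho]; split=> // A phi h; rewrite Ho // Hc rmorph_sum.
have -> : Poly a = \sum_(u < r.-1 * r ^ k) nth 0 a u *: 'X^u.
  by rewrite -poly_def -sa; apply/polyP=> i; rewrite coef_Poly coef_poly; case: ltnP => // hi; rewrite nth_default.
have pZ x p : phi (x *: p) = phi x%:P * phi p by rewrite -mul_polyC rmorphM.
rewrite rmorph_sum mulr_suml; apply: eq_bigr => u _.
rewrite !pZ (@phi_rotr _ _ _ (r ^ k.+1)) ?size_pad ?cyclo_hom_order //.
by rewrite Poly_pad ?size_Poly_le // rmorphXn mulrA.
Qed.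

(* Up to the factor K, the sum of the x^(e w) over the indices e < K prime to r,
   where x is a principal K-th root of unity and K = r t. *)
Definition kappa K t w : F := (K %| w)%:R - (t %| w)%:R / r%:R.

(** Value at y of the polynomial whose coefficient of Y^j is [kappa] at w - j. The first term of
    [kappa] singles out j congruent to w modulo K and yields y^w; the second depends only on j
    modulo t, and grouping by residues brings out the factor Psi_r(y^t) = 0. Hence the masked points
    do no harm. *)
Lemma kappa_resum (A : comNzRingType) (phi : {rmorphism {poly F} -> A}) (y : A) t w :
  (0 < t)%N -> \sum_(i < r) (y ^+ t) ^+ i = 0 ->
  \sum_(j < r * t) y ^+ j * phi (kappa (r * t) t ((r * t - j) %% (r * t) + w))%:P = y ^+ w.
Proof.
move=> t0 hy; have K0 : (0 < r * t)%N by rewrite muln_gt0 r_gt0.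
have yK : y ^+ (r * t) = 1 by rewrite cyclo_order.
under eq_bigr => j _ do rewrite /kappa polyCB rmorphB mulrBr
   (dvdn_add_mod _ (neg_mod_add (ltn_ord j) (dvdnn _)))
   (dvdn_add_mod _ (neg_mod_add (ltn_ord j) (dvdn_mull r (dvdnn t)))) polyCM rmorphM mulrA.
rewrite sumrB -[RHS]subr0; congr (_ - _).
  have hw : (w %% (r * t) < r * t)%N by apply: ltn_pmod.
  rewrite (bigD1 (Ordinal hw)) //= modn_mod eqxx polyCMn rmorphMn /= rmorph1 mulr1.
  rewrite expr_mod // big1 ?addr0 // => j jw.
  rewrite (modn_small (ltn_ord j)).
  have /negPf -> : (j : nat) != (w %% (r * t))%N by apply: contra jw => /eqP e; apply/eqP/val_inj.
  by rewrite polyC0 rmorph0 mulr0.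
rewrite -mulr_suml (sum_mul_split t r (fun j => y ^+ j * phi ((j == w %[mod t])%:R)%:P)).
rewrite big1 ?mul0r // => c _.
under eq_bigr => j _ do rewrite modnMDl exprD mulnC exprM -mulrA.
by rewrite -mulr_suml hy mul0r.
Qed.

(** For fixed u and v there remains a sum of powers over the e prime to r: the sum over all e minus
    the sum over the multiples of r, both given by [root_sum]. The second has r^kb = K / r terms,
    whence the division by r in [kappa]. J plays the part of -j in the inverse transform. *)
Lemma masked_dft_product (A : comNzRingType) (phi : {rmorphism {poly F} -> A})
    M kb g J (a b : nat -> A) :
  \sum_(i < r) (phi 'X ^+ M) ^+ i = 0 -> (g * r ^ kb.+1 = r * M)%N ->
  \sum_(e < r ^ kb.+1) phi 'X ^+ (g * J * e) *
     (if (r %| e)%N then 0 else (\sum_(u < r ^ kb.+1) phi 'X ^+ (g * e * u) * a u) *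
                            (\sum_(v < r ^ kb.+1) phi 'X ^+ (g * e * v) * b v))
  = \sum_(u < r ^ kb.+1) \sum_(v < r ^ kb.+1)
      a u * b v * ((r ^ kb.+1)%:R * phi (kappa (r ^ kb.+1) (r ^ kb) (J + u + v))%:P).
Proof.
move=> hM hg; set K := (r ^ kb.+1)%N; set x := phi 'X.
transitivity (\sum_(e < K) \sum_(u < K) \sum_(v < K)
   a u * b v * (if (r %| e)%N then 0 else x ^+ (g * e * (J + u + v)))).
  apply: eq_bigr => e _; case: ifP => _.
    by rewrite mulr0 big1 // => u _; rewrite big1 // => v _; rewrite mulr0.
  rewrite mulr_suml mulr_sumr; apply: eq_bigr => u _.
  rewrite !mulr_sumr; apply: eq_bigr => v _.
  have -> : (g * e * (J + u + v) = g * J * e + g * e * u + g * e * v)%N by ring.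
  by rewrite !exprD; ring.
rewrite exchange_big /=; apply: eq_bigr => u _.
rewrite exchange_big /=; apply: eq_bigr => v _.
rewrite -mulr_sumr; congr (_ * _); set w := (J + u + v)%N.
transitivity (\sum_(e < K) x ^+ (g * e * w) -
              \sum_(e < K) (if (r %| e)%N then x ^+ (g * e * w) else 0)).
  by rewrite -sumrB; apply: eq_bigr => e _; case: ifP => _; rewrite ?subrr ?subr0.
rewrite (root_sum r23 hM w hg).
have -> : \sum_(e < K) (if (r %| e)%N then x ^+ (g * e * w) else 0) =
          \sum_(e < r ^ kb) x ^+ (g * r * e * w).
  rewrite /K expnSr (sum_mul_split r (r ^ kb) (fun e => if (r %| e)%N then x ^+ (g * e * w) else 0)).
  rewrite exchange_big /=; apply: eq_bigr => j _.
  rewrite (bigD1 (Ordinal r_gt0)) //= addn0 dvdn_mull // big1 ?addr0.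
    by congr (_ ^+ _); ring.
  move=> i i0; rewrite dvdn_addr ?dvdn_mull // ifF //.
  by apply: contraNF i0 => /dvdnP[[|q] e]; [apply/eqP/val_inj|have := ltn_ord i; rewrite e; lia].
rewrite (root_sum r23 hM w (c := kb)); last by rewrite -hg expnS mulnA.
rewrite /kappa polyCB rmorphB mulrBr; congr (_ - _).
  by case: ifP => _; rewrite ?polyC0 ?polyC1 ?rmorph0 ?rmorph1 ?mulr0 ?mulr1.
case: ifP => _; last by rewrite mul0r polyC0 rmorph0 mulr0.
have -> : (true%:R / r%:R)%:P = (r%:R^-1)%:P :> {poly F} by rewrite mul1r.
rewrite /K expnS natrM mulrAC -[r%:R](rmorph_nat phi) -polyC_natr -rmorphM -polyCM.
by rewrite divff // rmorph1 mul1r.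
Qed.

End Mulmod.

(** The high half of block j - 1 overlaps the low half of block j: j + K - 1 is j - 1 modulo K, and
    y^K = 1 lets the last block wrap around to the first. *)
Lemma sum_cyclic_shift (A : comNzRingType) (y : A) K (h : nat -> A) : y ^+ K = 1 ->
  \sum_(j < K) y ^+ j * h ((j + K.-1) %% K)%N = \sum_(j < K) y ^+ j.+1 * h j.
Proof.
case: K => [|K] yK; first by rewrite !big_ord0.
rewrite big_ord_recl big_ord_recr /= yK expr0 add0n modn_small // addrC; congr (_ + _).
apply: eq_bigr => i _; rewrite /bump /= add1n addSnnS modnDr modn_small //.
by rewrite ltnS ltnW.
Qed.

(* Solves the recurrence v(k) >= 2 v(k/2 + 1) + O(k); the constant 2000 of
   mulmod_cost is five times the overhead 400 (k+1) r^k of one level. *)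
Definition mulmod_weight k := (2 * ((k - 2) * (lg (k - 2)).+1) + 1)%N.

Lemma lgS_half j : (1 < j)%N -> lg j = (lg j./2).+1.
Proof. by move=> h; rewrite /lg trunc_log2S. Qed.

Lemma leq_lg a b : (a <= b)%N -> (lg a <= lg b)%N.
Proof. exact: leq_trunc_log. Qed.

Lemma leq_mulmod_weight a b : (a <= b)%N -> (mulmod_weight a <= mulmod_weight b)%N.
Proof.
move=> h; rewrite /mulmod_weight leq_add2r leq_mul2l /= leq_mul ?leq_sub2r // ltnS.
by rewrite leq_lg // leq_sub2r.
Qed.

(** The offset 2 in the weight makes k/2 + 1 an exact halving of k - 2, so [lg] drops by one and
    leaves a slack of at least 2 (k - 2) - 1; k = 3 is checked apart. *)
Lemma mulmod_weight_rec k : (2 < k)%N ->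
  (5 * (2 * mulmod_weight (k./2.+1)) + k.+1 <= 5 * mulmod_weight k)%N.
Proof.
move=> hk; rewrite /mulmod_weight.
have -> : (k./2.+1 - 2 = (k - 2)./2)%N by lia.
case: (ltnP 1 (k - 2)) => h.
  rewrite (lgS_half h); set L := lg _; set j := (k - 2)%N in h *.
  have h2 : (2 * (j./2 * L.+1) <= j * L.+1)%N.
    rewrite mulnA leq_mul //.
    by rewrite mul2n -[X in (_ <= X)%N](odd_double_half j) leq_addl.
  have kj : (k = j + 2)%N by rewrite /j; lia.
  by move: h2 h; rewrite {}kj; clearbody j L; rewrite [(j * L.+2)%N]mulnS; lia.
by have -> : k = 3%N by lia.
Qed.

Section MulmodTriple.
Variables (F : fieldType) (r : nat).
Hypothesis r23 : r = 2%N \/ r = 3%N.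
Hypothesis r_unit : r%:R != 0 :> F.

Let r_gt0 : (0 < r)%N. Proof. by case: r23 => ->. Qed.
Let r_gt1 : (1 < r)%N. Proof. by case: r23 => ->. Qed.
Let rX_gt0 i : (0 < r ^ i)%N. Proof. by rewrite expn_gt0 r_gt0. Qed.

Lemma tr_fnat n : tr (fnat 0 (1 : F) n) n (fun x => x = n%:R).
Proof.
rewrite -[X in tr _ X]muln1; apply: (tr_crepeat (P := fun i x => x = i%:R)) => //.
by move=> i x _ ->; apply: tr_add; apply: tr_ret; rewrite -natr1.
Qed.

Lemma split_facts k : let ka := split_lo r k in let k' := split_in r k in
  [/\ (ka <= k)%N, (k - ka <= k')%N, (r.-1 * r ^ k' = r ^ ka + r ^ ka)%N
    & (k' <= k./2.+1)%N].
Proof.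
rewrite /split_in /split_lo; case: r23 => -> /=; split; try lia.
by rewrite expnS; lia.
Qed.

Definition mulmod_cost k := (2000 * (r.-1 * r ^ k * mulmod_weight k))%N.

Lemma mulmod_naive_cost k : (k <= 2)%N ->
  (r.-1 * r ^ k * (r ^ k.+1 * 2 + r ^ k.+1 * 2) + (r.-1 * r ^ k * 2).+1
   <= mulmod_cost k)%N.
Proof.
move=> hk; have -> : mulmod_cost k = (2000 * (r.-1 * r ^ k))%N.
  by rewrite /mulmod_cost /mulmod_weight; move: hk; rewrite -subn_eq0 => /eqP ->; rewrite muln1.
have L27 : (r ^ k.+1 <= 27)%N.
  by apply: (@leq_trans (r ^ 3)); [rewrite leq_pexp2l | case: r23 => ->].
have N1 : (0 < r.-1 * r ^ k)%N by rewrite muln_gt0 rX_gt0 andbT -subn1 subn_gt0.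
by have := leq_mul (leqnn (r.-1 * r ^ k)) L27; lia.
Qed.

(** Each transform costs at most 108 (k + 1) r^k, from 2 r^3 <= 54 and r^k' <= 2m. The three of them
    take 324 of the 400 (k + 1) r^k available; the other linear work is a multiple of r^k that fits
    in the rest because k > 2. *)
Lemma mulmod_cost_rec k : (2 < k)%N ->
  let ka := split_lo r k in let kb := (k - ka)%N in let k' := split_in r k in
  let m := (r ^ ka)%N in let t := (r ^ kb)%N in let K := (r ^ kb.+1)%N in
  let L := (r ^ k'.+1)%N in
  let D := (kb.+1 * K * (r * (L * 2)))%N in
  is_true (D + (D + (t * (r.-1 * (((m + m) * 2).+1 + (((m + m) * 2).+1 + mulmod_cost k')))
   + (D + (K + (K * (((m + m) * 2).+1 + (m + m) * 2)
   + (K * (m * 2) + (r.-1 * r ^ k * 2).+1)).+1))))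
   <= mulmod_cost k)%N.
Proof.
move=> hk ka kb k' m t K L D; have [h1 h2 h3 h4] := split_facts k.
rewrite -/ka -/k' -/kb -/m in h1 h2 h3 h4.
have Mmt : (r ^ k = m * t)%N by rewrite -expnD subnKC.
have m0 : (0 < m)%N by exact: rX_gt0.
have t0 : (0 < t)%N by exact: rX_gt0.
have hw := mulmod_weight_rec hk.
have hv := leq_mulmod_weight h4.
have kbk : (kb.+1 <= k.+1)%N by rewrite ltnS leq_subr.
have bD : (D <= 108 * (k.+1 * (m * t)))%N.
  have e : D = (kb.+1 * (2 * r ^ 3 * (t * r ^ k')))%N by rewrite /D /K /L !expnS -/t expn0; ring.
  have h3' : (r ^ k' <= m + m)%N by rewrite -h3 leq_pmull // -subn1 subn_gt0.
  have r27 : (2 * r ^ 3 <= 54)%N by case: r23 => ->.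
  rewrite e; apply: leq_trans (leq_mul kbk (leq_mul r27 (leq_mul (leqnn t) h3'))) _.
  by apply: eq_leq; ring.
have Kt : (K <= 3 * t)%N by rewrite /K expnS leq_mul2r; case: r23 => ->; rewrite orbT.
have rp : (r.-1 <= 2)%N by case: r23 => ->.
have rp1 : (1 <= r.-1)%N by rewrite -subn1 subn_gt0.
set M := (m * t)%N in bD *.
have tM : (t <= M)%N by rewrite leq_pmull.
have M0 : (0 < M)%N by rewrite muln_gt0 m0.
have b3 : (t * (r.-1 * (((m + m) * 2).+1 + (((m + m) * 2).+1 + mulmod_cost k')))
   <= 20 * M + 2000 * (r.-1 * M * (2 * mulmod_weight k./2.+1)))%N.
  have e c T : (t * (r.-1 * (c + (c + T))) =
      t * (r.-1 * c) + t * (r.-1 * c) + t * (r.-1 * T))%N by ring.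
  rewrite {}e; apply: leq_add.
    have : (t * (r.-1 * ((m + m) * 2).+1) <= t * (2 * (5 * m)))%N.
      by rewrite leq_mul2l leq_mul ?orbT //; lia.
    by rewrite /M; lia.
  rewrite /mulmod_cost h3.
  have -> : (t * (r.-1 * (2000 * ((m + m) * mulmod_weight k'))) =
             2000 * (r.-1 * M * (2 * mulmod_weight k')))%N by rewrite /M; ring.
  by rewrite leq_mul2l leq_mul2l leq_mul2l hv !orbT.
have b6 : (K * (((m + m) * 2).+1 + (m + m) * 2) <= 27 * M)%N.
  apply: leq_trans (leq_mul Kt (_ : _ <= 9 * m)%N) _; [lia | rewrite /M; lia].
have b7 : (K * (m * 2) <= 6 * M)%N.
  by apply: leq_trans (leq_mul Kt (leqnn _)) _; rewrite /M; lia.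
have b8 : (r.-1 * r ^ k * 2 <= 4 * M)%N.
  by rewrite Mmt -/M mulnAC; apply: leq_trans (leq_mul (leq_mul rp (leqnn 2)) (leqnn M)) _.
have b5 : (K <= 3 * M)%N by lia.
have key : (2000 * (r.-1 * M * (2 * mulmod_weight k./2.+1)) + 400 * (k.+1 * M)
   <= mulmod_cost k)%N.
  rewrite /mulmod_cost Mmt -/M.
  have : (400 * (k.+1 * M) <= 400 * (k.+1 * (r.-1 * M)))%N.
    by rewrite leq_mul2l leq_mul2l leq_pmull ?orbT.
  set Q := (r.-1 * M)%N => hQ.
  have := leq_mul (leqnn (400 * Q)) hw; lia.
have k1 : (M <= k.+1 * M)%N by rewrite leq_pmull.
have k4 : (4 * M <= k.+1 * M)%N by rewrite leq_mul2r; lia.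
by lia.
Qed.

(** Two rings are involved: blocks are multiplied modulo Psi_k', but the result is read modulo Psi_k
    with Y = X^m, where a congruence modulo Psi_k' means nothing. The interpolated blocks are
    therefore proved equal, as polynomials, to the sums [q], and only then does [kappa_resum]
    recover the product. *)
Lemma tr_mulmod fuel k a b : (k <= fuel)%N ->
  size a = (r.-1 * r ^ k)%N -> size b = (r.-1 * r ^ k)%N ->
  tr (mulmod 0 (1 : F) r fuel k a b) (mulmod_cost k)
    (fun o => size o = (r.-1 * r ^ k)%N /\
       forall (A : comNzRingType) (phi : {rmorphism {poly F} -> A}),
         cyclotomic_hom r k phi -> phi (Poly o) = phi (Poly a) * phi (Poly b)).
Proof.
elim: fuel k a b => [|fuel IH] k a b hk sa sb.
  apply: tr_weak (tr_mulmod_naive r23 sa sb) _ _ => //.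
  by apply: mulmod_naive_cost; lia.
rewrite [mulmod _ _ _ _ _ _ _]/=; case: leqP => k2.
  by apply: tr_weak (tr_mulmod_naive r23 sa sb) _ _ => //; apply: mulmod_naive_cost.
have [h1 h2 h3 h4] := split_facts k; have hcost := mulmod_cost_rec k2.
move: hcost h1 h2 h3 h4.
set ka := split_lo r k; set kb := (k - ka)%N; set k' := split_in r k.
set m := (r ^ ka)%N; set t := (r ^ kb)%N; set L := (r ^ k'.+1)%N.
set K := (r ^ kb.+1)%N.
set g := (r ^ (k' - kb))%N; move=> hcost h1 h2 h3 h4.
set blocks := fun s : seq F => [seq pad 0 L (take m (drop (j * m) s)) | j <- iota 0 K].
have KE : (K = r * t)%N by rewrite /K expnS.
have L0 : (0 < L)%N := rX_gt0 _.
have K0 : (0 < K)%N := rX_gt0 _.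
have m0 : (0 < m)%N := rX_gt0 _.
have t0 : (0 < t)%N := rX_gt0 _.
have gK : (g * K = L)%N by rewrite /g /K /L -expnD addnS subnK.
have mL : (m + m <= L)%N by rewrite -h3 /L expnS leq_mul2r leq_pred orbT.
have mt : (m * t = r ^ k)%N by rewrite -expnD subnKC.
pose bl (s : seq F) j := Poly (take m (drop (j * m) s)).
have sbl s j : (size (bl s j) <= m)%N.
  by apply: size_Poly_le; rewrite size_take_min geq_minl.
have nbl s j : (j < K)%N -> nth [::] (blocks s) j = pad 0 L (take m (drop (j * m) s)).
  by move=> hj; rewrite (nth_map 0%N) ?size_iota // nth_iota.
have pbl s j : (j < K)%N -> Poly (nth [::] (blocks s) j) = bl s j.
  by move=> hj; rewrite nbl // Poly_pad //; apply: leq_trans (sbl s j) _; lia.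
have hblk s j : (j < K)%N -> size (nth [::] (blocks s) j) = L.
  by move=> hj; rewrite nbl // size_pad.
apply: tr_seq (tr_dft r_gt0 L0 gK (hblk a)) hcost _ => ah Hah.
apply: tr_bind (tr_dft r_gt0 L0 gK (hblk b)) _ => bh Hbh.
have ixK e i : (e < t)%N -> (i < r.-1)%N -> (e * r + i.+1 < K)%N.
  move=> he hi; rewrite KE [(r * t)%N]mulnC; apply: (@leq_trans (e.+1 * r)); last by rewrite leq_mul2r he orbT.
  by rewrite mulSn addnC ltn_add2r; lia.
apply: tr_bind (tr_tab [::] (P := fun e o => forall i, (i < r.-1)%N ->
   size (nth [::] o i) = (m + m)%N /\
   forall (A : comNzRingType) (phi : {rmorphism {poly F} -> A}),
     cyclotomic_hom r k' phi -> phi (Poly (nth [::] o i)) =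
     phi (Poly (nth [::] ah (e * r + i.+1))) * phi (Poly (nth [::] bh (e * r + i.+1)))) _) _.
  move=> e he; apply: tr_weak (tr_tab [::] (P := fun i o => size o = (m + m)%N /\
   forall (A : comNzRingType) (phi : {rmorphism {poly F} -> A}),
     cyclotomic_hom r k' phi -> phi (Poly o) =
     phi (Poly (nth [::] ah (e * r + i.+1))) * phi (Poly (nth [::] bh (e * r + i.+1)))) _)
     (leqnn _) _; last by move=> o [].
  move=> i hi; have hix := ixK e i he hi.
  rewrite -h3; apply: tr_bind (tr_fold_cyclotomic r23 (Hah _ hix).1) _ => u [su Hu].
  apply: tr_bind (tr_fold_cyclotomic r23 (Hbh _ hix).1) _ => v [sv Hv].
  apply: tr_weak (IH k' u v _ su sv) (leqnn _) _; first by rewrite -/k'; lia.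
  by move=> o [so Ho]; split=> // A phi hphi; rewrite Ho // Hu // Hv.
move=> cs [scs Hcs]; set ch := [seq _ | e <- iota 0 K].
have nch e : (e < K)%N -> nth [::] ch e = if (r %| e)%N then nseq L 0 else
    pad 0 L (nth [::] (nth [::] cs (e %/ r)) (e %% r).-1).
  by move=> he; rewrite (nth_map 0%N) ?size_iota // nth_iota.
have szch e : (e < K)%N -> size (nth [::] ch e) = L.
  by move=> he; rewrite nch //; case: ifP => _; rewrite ?size_nseq ?size_pad.
have Hch e : (e < K)%N -> forall (A : comNzRingType) (phi : {rmorphism {poly F} -> A}),
     cyclotomic_hom r k' phi -> phi (Poly (nth [::] ch e)) =
     if (r %| e)%N then 0 else phi (Poly (nth [::] ah e)) * phi (Poly (nth [::] bh e)).
  move=> he A phi hphi; rewrite nch //; case: ifP => re.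
    by rewrite Poly_nseq0 rmorph0.
  have h0 : (0 < e %% r)%N by rewrite lt0n; move: re; rewrite /dvdn => ->.
  have he1 : (e %/ r < t)%N by rewrite ltn_divLR // mulnC -KE.
  have he2 : ((e %% r).-1 < r.-1)%N by have := ltn_pmod e r_gt0; lia.
  have [sz Hc] := Hcs _ he1 _ he2.
  rewrite Poly_pad; last by apply: size_Poly_le; rewrite sz.
  by rewrite Hc // prednK // -divn_eq.
apply: tr_bind (tr_dft r_gt0 L0 gK szch) _ => dh Hdh.
apply: tr_bind (tr_fnat K) _ => kf ->.
apply: tr_inv.
have Kf : K%:R != 0 :> F by rewrite natrX expf_neq0.
pose q j : {poly F} := \sum_(u < K) \sum_(v < K)
  kappa F r K t ((K - j) %% K + u + v) *: (bl a u * bl b v).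
apply: tr_bind (tr_tab [::] (P := fun j o => size o = (m + m)%N /\ Poly o = q j) _) _.
  move=> j hj; set J := ((K - j) %% K)%N.
  have JK : (J < K)%N by apply: ltn_pmod.
  rewrite -[in X in tr _ X]h3.
  apply: tr_bind (tr_fold_cyclotomic r23 (Hdh _ JK).1) _ => u [su Hu]; rewrite h3.
  apply: tr_weak (tr_axpy _ _ _) (leqnn _) _ => //; first by rewrite su h3.
  move=> o [so Ho]; split=> //; rewrite Ho Poly_nil add0r.
  (* Products of two blocks of length m fit in 2m = (r - 1) r^k' coefficients, so congruence modulo
     Psi_k' is equality here. *)
  apply: (@cyclo_exact F r r23 r_unit k') => [||A phi hphi].
  - by apply: leq_trans (size_scale_leq _ _) _; apply: size_Poly_le; rewrite su.
  - rewrite h3; apply: leq_trans (size_sum _ _ _) _; apply/bigmax_leqP => i _.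
    apply: leq_trans (size_sum _ _ _) _; apply/bigmax_leqP => i' _.
    apply: leq_trans (size_scale_leq _ _) _; apply: leq_trans (size_polyMleq _ _) _.
    by apply: leq_trans (leq_pred _) _; apply: leq_add.
  have xL : phi 'X ^+ L = 1 by apply: cyclo_hom_order.
  rewrite -mul_polyC rmorphM Hu // (Hdh _ JK).2 //.
  under eq_bigr => e _ do rewrite Hch // (Hah _ (ltn_ord e)).2 // (Hbh _ (ltn_ord e)).2 //.
  under eq_bigr => e _ do (
    rewrite (eq_bigr (fun u : 'I_K => phi 'X ^+ (g * e * u) * phi (bl a u)));
     last by move=> i _; rewrite pbl).
  under eq_bigr => e _ do (
    rewrite [\sum_(j < _) phi 'X ^+ _ * phi (Poly (nth [::] (blocks b) j))]
      (eq_bigr (fun u : 'I_K => phi 'X ^+ (g * e * u) * phi (bl b u)));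
     last by move=> i _; rewrite pbl).
  rewrite (@masked_dft_product F r r23 r_unit A phi (r ^ k') kb g J
    (fun u => phi (bl a u)) (fun u => phi (bl b u))) //; last by rewrite -expnS -/L -gK.
  rewrite mulr_sumr rmorph_sum; apply: eq_bigr => i _.
  rewrite mulr_sumr rmorph_sum; apply: eq_bigr => i' _.
  rewrite -mul_polyC !rmorphM -/K -/t -(rmorph_nat phi K) -polyC_natr.
  have e1 : phi (K%:R^-1)%:P * phi (K%:R)%:P = 1.
    by rewrite -rmorphM -polyCM mulVf // rmorph1.
  rewrite -[RHS]mulr1 -e1; ring.
move=> qs [sqs Hqs].
apply: tr_bind (tr_tab [::] (P := fun j o => size o = m /\ Poly o =
   Poly (take m (nth [::] qs j)) + Poly (drop m (nth [::] qs ((j + K.-1) %% K)))) _) _.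
  move=> j hj; have j'K : ((j + K.-1) %% K < K)%N by apply: ltn_pmod.
  apply: tr_weak (tr_axpy _ _ _) (leqnn _) _.
  - by rewrite size_take_min geq_minl.
  - by rewrite size_drop (Hqs _ j'K).1 addKn.
  - by move=> o [-> ->]; rewrite scale1r.
move=> os [sos Hos].
have szos o : o \in os -> size o = m.
  by move=> /(nthP [::])[i hi <-]; rewrite (Hos i _).1 // -sos.
have sfl : size (flatten os) = (r ^ k.+1)%N.
  rewrite size_flatten; have -> : shape os = nseq K m.
    apply: (@eq_from_nth _ 0%N); rewrite ?size_map ?size_nseq ?sos // => i hi.
    by rewrite (nth_map [::]) ?sos // nth_nseq hi (Hos i hi).1.
  by rewrite sumn_nseq KE mulnA [(m * r)%N]mulnC -mulnA mt -expnS.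
apply: tr_weak (tr_fold_cyclotomic r23 sfl) (leqnn _) _.
move=> o [so Ho]; split=> // A phi hphi; rewrite Ho //.
rewrite (Poly_flatten szos) sos rmorph_sum /=; set y := phi 'X ^+ m.
have hy : \sum_(i < r) (y ^+ t) ^+ i = 0 by rewrite /y -exprM mt.
have yK : y ^+ K = 1 by rewrite /y -exprM KE mulnCA mt -expnS; apply: cyclo_hom_order.
transitivity (\sum_(j < K) y ^+ j * phi (q j)).
  rewrite (eq_bigr (fun j : 'I_K => y ^+ j * phi (Poly (take m (nth [::] qs j))) +
     y ^+ j * (fun i => phi (Poly (drop m (nth [::] qs i)))) ((j + K.-1) %% K)%N)); last first.
    by move=> j _; rewrite (Hos j _).2 // rmorphM rmorphD rmorphXn /= exprM mulrDr.
  rewrite big_split /= (sum_cyclic_shift (fun i => phi (Poly (drop m (nth [::] qs i)))) yK) -big_split /=; apply: eq_bigr => j _.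
  rewrite -(Hqs j _).2 // [in RHS](Poly_split m) rmorphD rmorphM rmorphXn /= -/y.
  by rewrite mulrDr mulrA exprSr.
have pb s : size s = (r.-1 * r ^ k)%N -> phi (Poly s) = \sum_(u < K) y ^+ u * phi (bl s u).
  move=> ss; rewrite (@Poly_blocks _ m K); last first.
    by rewrite ss KE -mulnA [(t * m)%N]mulnC mt leq_mul2r leq_pred orbT.
  by rewrite rmorph_sum; apply: eq_bigr => u _; rewrite rmorphM rmorphXn /= exprM.
rewrite (pb a) // (pb b) // mulr_suml.
rewrite /q; under eq_bigr => j _ do rewrite rmorph_sum mulr_sumr.
rewrite exchange_big /=; apply: eq_bigr => u _.
under eq_bigr => j _ do rewrite rmorph_sum mulr_sumr.
rewrite exchange_big /= mulr_sumr; apply: eq_bigr => v _.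
under eq_bigr => j _ do rewrite -mul_polyC !rmorphM -addnA mulrA.
rewrite -mulr_suml [X in kappa _ _ X]KE.
have := @kappa_resum F r r23 A phi y t (u + v) t0 hy; rewrite -KE => ->.
by rewrite exprD; ring.
Qed.

End MulmodTriple.

(** * Products of arbitrary coefficient lists *)

Section PolyMul.
Variables (F : Type) (zero one : F) (r : nat).

(** Since r^k > n, the degree of Psi_k exceeds that of the product, whose residue is therefore the
    product itself. *)
Definition pmul (a b : seq F) : prog F (seq F) :=
  if (size a == 0) || (size b == 0) then Ret F [::] else
  let n := (size a + size b)%N in let k := (trunc_log r n).+1 in
  c <-- mulmod zero one r k k (pad zero (r.-1 * r ^ k) a) (pad zero (r.-1 * r ^ k) b);
  Ret F (take n.-1 c).

End PolyMul.

Definition logs n := ((lg n).+1 * (lg (lg n)).+1)%N.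
(** 18 is 6 times 3: the padded length is at most 6 n and [mulmod_weight] at most 3 [logs n]; 2000
    is the constant of [mulmod_cost]. *)
Definition pmul_cost n := (18 * (2000 * (n * logs n)))%N.

Lemma leq_logs a b : (a <= b)%N -> (logs a <= logs b)%N.
Proof. by move=> h; apply: leq_mul; rewrite ltnS !leq_lg // leq_lg. Qed.

Lemma leq_pmul_cost a b : (a <= b)%N -> (pmul_cost a <= pmul_cost b)%N.
Proof. by move=> h; rewrite leq_mul2l leq_mul2l leq_mul ?leq_logs. Qed.

Lemma tr_pmul (F : fieldType) r (a b : seq F) :
  r = 2%N \/ r = 3%N -> r%:R != 0 :> F ->
  tr (pmul 0 (1 : F) r a b) (pmul_cost (size a + size b))
    (fun o => (size o <= (size a + size b).-1)%N /\ Poly o = Poly a * Poly b).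
Proof.
move=> r23 hr; rewrite /pmul; case: eqP => sa /=.
  by apply: tr_ret; rewrite (size0nil sa) Poly_nil mul0r; split.
case: eqP => sb /=; first by apply: tr_ret; rewrite (size0nil sb) Poly_nil mulr0; split.
set n := (size a + size b)%N; set k := (trunc_log r n).+1; set N := (r.-1 * r ^ k)%N.
have n0 : (0 < n)%N by rewrite /n; lia.
have r1 : (1 < r)%N by case: r23 => ->.
have hk : (n < r ^ k)%N by apply: trunc_log_ltn.
have hN : (n < N)%N by apply: leq_trans hk _; rewrite leq_pmull // -subn1 subn_gt0.
have hk2 : (r ^ (trunc_log r n) <= n)%N by apply: trunc_logP.
apply: tr_seq (tr_mulmod r23 hr (leqnn k) (size_pad _ _ _) (size_pad _ _ _))
  (_ : _ + 0 <= _)%N _.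
  rewrite addn0 /mulmod_cost /pmul_cost.
  have b1 : (r.-1 * r ^ k <= 6 * n)%N.
    by rewrite /k expnS mulnA leq_mul //; case: r23 => ->.
  have b2 : (mulmod_weight k <= 3 * logs n)%N.
    have kl : (k <= (lg n).+1)%N.
      rewrite ltnS; apply: trunc_log_max => //; apply: leq_trans hk2.
      by elim: (trunc_log r n) => // e IHe; rewrite !expnS leq_mul.
    apply: leq_trans (leq_mulmod_weight kl) _; rewrite /mulmod_weight /logs subSS.
    have : ((lg n - 1) * (lg (lg n - 1)).+1 <= (lg n).+1 * (lg (lg n)).+1)%N.
      by rewrite leq_mul // ?ltnS ?leq_lg // ?leq_subr // ltnW // ltnS leq_subr.
    have : (0 < (lg n).+1 * (lg (lg n)).+1)%N by [].
    by lia.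
  by have := leq_mul b1 b2; lia.
move=> c [sc Hc]; apply: tr_ret; split; first by rewrite size_take_min geq_minl.
have sA : (size (Poly a) <= size a)%N := size_Poly _.
have sB : (size (Poly b) <= size b)%N := size_Poly _.
have e : Poly c = Poly a * Poly b.
  apply: (@cyclo_exact F r r23 hr k) => [||A phi hphi].
  - by apply: size_Poly_le; rewrite sc.
  - apply: leq_trans (size_polyMleq _ _) _; apply: leq_trans (leq_pred _) _.
    by apply: leq_trans (leq_add sA sB) (ltnW hN).
  rewrite Hc // rmorphM !Poly_pad //.
    by apply: leq_trans sB (leq_trans (leq_addl _ _) (ltnW hN)).
  by apply: leq_trans sA (leq_trans (leq_addr _ _) (ltnW hN)).
rewrite -e; apply/polyP=> i; rewrite !coef_Poly; case: (ltnP i n.-1) => hi.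
  by rewrite nth_take.
rewrite nth_default ?size_take_min ?geq_min ?hi //.
rewrite -coef_Poly e nth_default //; apply: leq_trans (size_polyMleq _ _) _.
by rewrite /n in hi; lia.
Qed.

(** * Reduced matrices and determinants *)

Section TopCoefficients.
Variable F : fieldType.
Implicit Types p q : {poly F}.

Lemma coefM_top p q a b : (size p <= a.+1)%N -> (size q <= b.+1)%N ->
  (p * q)`_(a + b) = p`_a * q`_b.
Proof.
move=> sp sq; have ha : (a < (a + b).+1)%N by rewrite ltnS leq_addr.
rewrite coefM (bigD1 (Ordinal ha)) //= addKn big1 ?addr0 // => j ja.
have {}ja : (j : nat) != a by apply: contra ja => /eqP e; apply/eqP/val_inj.
case: (ltnP j a) => h; last first.
  have -> : p`_j = 0 by apply: nth_default; apply: leq_trans sp _; rewrite ltn_neqAle eq_sym ja.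
  by rewrite mul0r.
have -> : q`_(a + b - j) = 0 by apply: nth_default; apply: leq_trans sq _; lia.
by rewrite mulr0.
Qed.

Lemma prod_top (I : Type) (r : seq I) (f : I -> {poly F}) (e : I -> nat) :
  (forall i, (size (f i) <= (e i).+1)%N) ->
  (size (\prod_(i <- r) f i)%R <= (\sum_(i <- r) e i).+1)%N /\
  (\prod_(i <- r) f i)`_(\sum_(i <- r) e i)%N = \prod_(i <- r) (f i)`_(e i).
Proof.
move=> H; elim: r => [|x r [s1 s2]]; first by rewrite !big_nil size_poly1 coef1.
rewrite !big_cons coefM_top // s2; split=> //.
by apply: leq_trans (size_polyMleq _ _) _; have := H x; lia.
Qed.

Variable m : nat.
Implicit Types (Z : 'M[{poly F}]_m) (E : 'I_m -> nat).

Definition degbound Z E := forall i j, (size (Z i j) <= (E i).+1)%N.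
Definition lcoefs Z E : 'M[F]_m := \matrix_(i, j) (Z i j)`_(E i).

(** Every term of the Leibniz expansion has degree at most the sum of the E i, with the product of
    the row coefficients in that degree. *)
Lemma det_top Z E : degbound Z E ->
  (size (\det Z) <= (\sum_i E i).+1)%N /\ (\det Z)`_(\sum_i E i)%N = \det (lcoefs Z E).
Proof.
move=> H; have Hs (s : 'S_m) := @prod_top 'I_m (index_enum 'I_m) (fun i => Z i (s i)) E (fun i => H i (s i)).
split.
  apply: leq_trans (size_sum _ _ _) _; apply/bigmax_leqP => s _.
  by rewrite mulr_sign; case: ifP => _; rewrite ?size_polyN; apply: (Hs s).1.
rewrite /determinant coef_sum; apply: eq_bigr => s _.
rewrite !mulr_sign; have := (Hs s).2.
case: ifP => _; rewrite ?coefN => ->; [congr (- _) |];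
  by apply: eq_bigr => i _; rewrite mxE.
Qed.

Definition pivots (L : 'M[F]_m) (p : 'I_m -> 'I_m) :=
  [/\ injective p, forall i, L i (p i) != 0 & forall (i j : 'I_m), (p i < j)%N -> L i j = 0].

(** Sorting the rows by pivot column gives a lower triangular matrix with nonzero diagonal. *)
Lemma pivots_det (L : 'M[F]_m) (p : 'I_m -> 'I_m) : pivots L p -> \det L != 0.
Proof.
case=> pI p1 p2; pose s := (perm pI)^-1%g.
have sp j : p (s j) = j by rewrite -[RHS](permKV (perm pI) j) permE.
have tri : is_trig_mx (row_perm s L).
  by apply/is_trig_mxP => i j ij; rewrite mxE p2 // sp.
have : \det (row_perm s L) != 0.
  by rewrite det_trig //; apply/prodf_neq0 => i _; rewrite mxE -{2}(sp i) p1.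
by rewrite row_permE det_mulmx det_perm mulf_eq0 negb_or => /andP[].
Qed.

(** Weak Popov form with its row degrees [E] and leading positions [p] as explicit data. Unlike
    [weak_popov] it excludes zero rows, whose [LP] is by convention the last index. *)
Definition reduced Z E := degbound Z E /\ exists p : 'I_m -> 'I_m, pivots (lcoefs Z E) p.

(** The equality case of [det_top]. For a general matrix, the gap between the two sides will bound
    the number of passes. *)
Lemma reduced_det Z E : reduced Z E -> size (\det Z) = (\sum_i E i).+1.
Proof.
move=> [dZ [p /pivots_det hp]]; have [s1 s2] := det_top dZ.
apply/eqP; rewrite eqn_leq s1 ltnNge; apply: contra hp => h.
by rewrite -s2 nth_default.
Qed.

Lemma LP_eq (v : 'rV[{poly F}]_m) (j : 'I_m) e :
  (forall i, (size (v ord0 i) <= e.+1)%N) -> (v ord0 j)`_e != 0 ->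
  (forall i : 'I_m, (j < i)%N -> (v ord0 i)`_e = 0) -> rdeg v = e.+1 /\ LP v = j.
Proof.
move=> h1 h2 h3.
have sj : size (v ord0 j) = e.+1.
  apply/eqP; rewrite eqn_leq h1 ltnNge; apply: contra h2 => h.
  by rewrite nth_default.
have rd : rdeg v = e.+1.
  apply/eqP; rewrite eqn_leq; apply/andP; split; first by apply/bigmax_leqP => i _.
  by rewrite -sj; apply: (leq_bigmax j).
split=> //; rewrite /LP rd; apply/eqP; rewrite eqn_leq; apply/andP; split.
  apply/bigmax_leqP => i /eqP si; rewrite leqNgt; apply/negP => /h3 h.
  have : lead_coef (v ord0 i) != 0 by rewrite lead_coef_eq0 -size_poly_eq0 si.
  by rewrite lead_coefE si /= h eqxx.
by apply: (leq_bigmax_cond (F := fun i : 'I_m => i : nat) j); rewrite sj.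
Qed.

Lemma reduced_weak_popov Z E : reduced Z E -> weak_popov Z.
Proof.
move=> [dZ [p [pI p1 p2]]] i j ij.
have lp k : LP (row k Z) = p k.
  apply: (@LP_eq _ _ (E k) _ _ _).2 => [j'||j' hj]; rewrite ?mxE.
  - exact: dZ.
  - by have := p1 k; rewrite mxE.
  - by have := p2 k j' hj; rewrite mxE.
by rewrite !lp; apply: contra ij => /eqP e; apply/eqP/pI/val_inj.
Qed.

Lemma LP_lead (v : 'rV[{poly F}]_m) : v != 0 -> exists j : 'I_m, [/\ LP v = j,
  size (v ord0 j) = rdeg v & forall i : 'I_m, (j < i)%N -> (size (v ord0 i) < rdeg v)%N].
Proof.
move=> v0.
have sz i : (size (v ord0 i) <= rdeg v)%N by apply: (leq_bigmax i).
have [i0 _ hi0] : {i0 : 'I_m | true & rdeg v = size (v ord0 i0)}.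
  apply: eq_bigmax_cond; apply/card_gt0P.
  have /matrix0Pn[i [j _]] := v0; by exists j.
have ne : (0 < #|[pred i | size (v ord0 i) == rdeg v]|)%N.
  by apply/card_gt0P; exists i0; rewrite inE hi0.
have [j hj ej] := eq_bigmax_cond (fun i : 'I_m => i : nat) ne.
rewrite inE in hj; exists j; split=> //; last first.
  move=> i ji; rewrite ltn_neqAle sz andbT; apply: contraL ji => si.
  rewrite -leqNgt -ej; exact: (leq_bigmax_cond (F := fun i : 'I_m => i : nat) i).
by apply/eqP.
Qed.

Lemma weak_popov_reduced Z : weak_popov Z -> (forall i, row i Z != 0) ->
  reduced Z (fun i => (rdeg (row i Z)).-1).
Proof.
move=> wp nz; have H i := LP_lead (nz i).
have rpos i : (0 < rdeg (row i Z))%N.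
  have [j [_ sj _]] := H i; rewrite lt0n -sj; apply/eqP => s0.
  have /matrix0Pn[i' [j' /negP]] := nz i; apply; rewrite ord1 -size_poly_leq0.
  by have := (leq_bigmax j' : (size (row i Z ord0 j') <= rdeg (row i Z))%N); rewrite -sj s0.
split=> [i j|].
  by rewrite prednK //; have := (leq_bigmax j : (size (row i Z ord0 j) <= rdeg (row i Z))%N); rewrite mxE.
have [p hp] := fin_all_exists H.
exists p; split=> [i j e|i|i j hj].
- apply/eqP; apply/negPn/negP => /wp.
  by have [-> _ _] := hp i; have [-> _ _] := hp j; rewrite e eqxx.
- have [_ sj _] := hp i; rewrite mxE -sj mxE -lead_coefE lead_coef_eq0 -size_poly_eq0.
  by have := rpos i; rewrite -sj mxE lt0n.
- have [_ _ /(_ j hj)] := hp i; rewrite !mxE => h.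
  by rewrite nth_default // -ltnS prednK.
Qed.

End TopCoefficients.

(** * Reduction by passes on the reversed matrix *)

Section Reversal.
Variable F : fieldType.
Implicit Types p q : {poly F}.

(** This is X^e p(1/X), a polynomial in x = 1/X, when [p] has degree at most [e]; coefficients
    beyond [e] are lost. *)
Definition revp e p : {poly F} := \poly_(i < e.+1) p`_(e - i).

Lemma coef_revp e p i : (revp e p)`_i = if (i <= e)%N then p`_(e - i) else 0.
Proof. by rewrite coef_poly ltnS. Qed.

Lemma revp_sum (I : Type) (r : seq I) e (f : I -> {poly F}) :
  revp e (\sum_(i <- r) f i) = \sum_(i <- r) revp e (f i).
Proof.
apply/polyP=> i; rewrite coef_revp !coef_sum; case: leqP => h.
  by apply: eq_bigr => j _; rewrite coef_revp h.
by rewrite big1 // => j _; rewrite coef_revp leqNgt h.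
Qed.

Lemma revpZ e c p : revp e (c *: p) = c%:P * revp e p.
Proof.
apply/polyP=> i; rewrite coefCM !coef_revp; case: ifP => _; last by rewrite mulr0.
by rewrite coefZ.
Qed.

(** The reason for reversing: a row operation whose multiplier is a monomial filling the gap between
    two degree bounds becomes an operation with a constant multiplier. *)
Lemma revp_shift e e' p : (size p <= e.+1)%N -> (e <= e')%N ->
  revp e' ('X^(e' - e) * p) = revp e p.
Proof.
move=> sp le; apply/polyP=> i; rewrite !coef_revp coefXnM.
case: (leqP i e) => h.
  have h' : (i <= e')%N by apply: leq_trans le.
  rewrite h' ltnNge leq_sub2l // /=; congr (p`_ _); lia.
by case: (leqP i e') => // h'; rewrite ifT //; lia.
Qed.

(** Once the top coefficient is eliminated, lowering the degree bound amounts to dividing by x. *)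
Lemma revp_drop e p : p`_e.+1 = 0 -> revp e.+1 p = 'X * revp e p.
Proof.
move=> pe; apply/polyP=> i; rewrite coefXM !coef_revp.
by case: i => [|i] /=; rewrite ?subn0 ?pe // ltnS subSS.
Qed.

End Reversal.

Section Passes.
Variables (F : fieldType) (m : nat).
Implicit Types (A B Z T P U V : 'M[{poly F}]_m) (L : 'M[F]_m) (D E : 'I_m -> nat).

Definition revm E Z : 'M[{poly F}]_m := \matrix_(i, j) revp (E i) (Z i j).

(** Row i may only receive rows of degree at most its own, so that the multiplier X^(D i - D j) is a
    polynomial. *)
Definition graded D L := forall i j, L i j != 0 -> (D j <= D i)%N.

(* T0 eliminates, with rows of smaller degree D; fl marks the pivot rows and p
   their columns.  Pivot rows are then multiplied by the variable x = 1/X. *)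
Definition ispass L D T D' := exists (T0 Ti : 'M[F]_m) (fl : 'I_m -> bool) (p : 'I_m -> 'I_m),
  [/\ [/\ Ti *m T0 = 1%:M, graded D T0 & graded D Ti],
      [/\ {in fl &, injective p}, forall i, fl i -> (T0 *m L) i (p i) != 0
        & forall i j : 'I_m, fl i -> (p i < j)%N -> (T0 *m L) i j = 0],
      forall i j, ~~ fl i -> (T0 *m L) i j = 0,
      T = \matrix_(i, j) ((T0 i j)%:P * 'X^(fl i))
    & forall i, D' i = (D i + fl i)%N].

(** A pass makes all constant coefficients zero, by the factor x in the pivot rows and by
    elimination in the others, and the next pass works on the quotient by x. [D] is the current
    degree plus the number of passes done: it grows on pivot rows instead of decreasing on the
    others, which leaves all comparisons unchanged. *)
Fixpoint passes s A D P D' : Prop :=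
  if s is s'.+1 then exists T D1 A1 P1,
    [/\ ispass (map_mx (coefp 0) A) D T D1, T *m A = 'X *: A1,
        passes s' A1 D1 P1 D' & P = P1 *m T]
  else P = 1%:M /\ forall i, D' i = D i.

Lemma scaleXn_inj s A B : 'X^s *: A = 'X^s *: B -> A = B.
Proof.
move=> h; apply/matrixP=> i j; have /matrixP/(_ i j) := h.
by rewrite !mxE; apply: mulXn_inj.
Qed.

Lemma eq_ispass L D D2 T D' : D =1 D2 -> ispass L D T D' -> ispass L D2 T D'.
Proof.
move=> e [T0 [Ti [fl [p [[h1 h2 h3] h4 h5 h6 h7]]]]]; exists T0, Ti, fl, p.
split=> //; last by move=> i; rewrite -e.
by split=> // i j h; rewrite -!e; [apply: h2 | apply: h3].
Qed.

Lemma eq_passes s A D D2 P D' : D =1 D2 -> passes s A D P D' -> passes s A D2 P D'.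
Proof.
case: s => [|s] e /=; first by case=> -> h; split=> // i; rewrite h.
case=> T [D1 [A1 [P1 [h1 h2 h3 h4]]]]; exists T, D1, A1, P1; split=> //.
exact: eq_ispass h1.
Qed.

Lemma passes_cat s1 s2 A D P1 D1 A2 P2 D2 :
  passes s1 A D P1 D1 -> P1 *m A = 'X^s1 *: A2 -> passes s2 A2 D1 P2 D2 ->
  passes (s1 + s2) A D (P2 *m P1) D2.
Proof.
elim: s1 A D P1 => [|s1 IH] A D P1.
  rewrite add0n => -[-> e]; rewrite mul1mx expr0 scale1r mulmx1 => ->.
  exact: eq_passes.
rewrite addSn /= => -[T [D3 [A3 [P3 [h1 h2 h3 ->]]]]] e h4.
exists T, D3, A3, (P2 *m P3); split=> //; last by rewrite mulmxA.
apply: IH h3 _ h4; apply: (@scaleXn_inj 1); rewrite expr1 scalerA -exprS -e.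
by rewrite -mulmxA h2 scalemxAr.
Qed.

(** Each pass reads constant coefficients and divides by x, so s passes see only the first s
    coefficients. This permits the truncations of the divide and conquer. *)
Lemma passes_trunc s A D P D' B : passes s A D P D' -> passes s (A + 'X^s *: B) D P D'.
Proof.
elim: s A D P B => [|s IH] A D P B //= [T [D1 [A1 [P1 [h1 h2 h3 ->]]]]].
exists T, D1, (A1 + 'X^s *: (T *m B))%R, P1; split=> //; last exact: IH.
  have -> // : map_mx (coefp 0) (A + 'X^(s.+1) *: B) = map_mx (coefp 0) A.
  by apply/matrixP=> i j; rewrite !mxE /= coefD coefXnM addr0.
by rewrite mulmxDr h2 -scalemxAr scalerDr scalerA -exprS.
Qed.

Lemma passes_div s A D P D' : passes s A D P D' -> exists A2, P *m A = 'X^s *: A2.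
Proof.
elim: s A D P => [|s IH] A D P /=; first by case=> -> _; exists A; rewrite mul1mx scale1r.
case=> [T [D1 [A1 [P1 [h1 h2 h3 ->]]]]]; have [A2 e] := IH _ _ _ h3.
by exists A2; rewrite -mulmxA h2 -scalemxAr e scalerA -exprS.
Qed.

(** The operation on the original rows corresponding to the constant operation [L] on the reversed
    ones. On [graded] matrices the natural subtraction is exact, hence multiplicativity and
    unimodularity. *)
Definition gradedX E (L : 'M[F]_m) : 'M[{poly F}]_m := \matrix_(i, j) (L i j *: 'X^(E i - E j)).

Lemma gradedX_mul E L1 L2 : graded E L1 -> graded E L2 ->
  gradedX E L1 *m gradedX E L2 = gradedX E (L1 *m L2).
Proof.
move=> g1 g2; apply/matrixP=> i k; rewrite !mxE scaler_suml; apply: eq_bigr => j _.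
rewrite !mxE -scalerAl -scalerAr scalerA.
have [->|n1] := eqVneq (L1 i j) 0; first by rewrite !mul0r !scale0r.
have [->|n2] := eqVneq (L2 j k) 0; first by rewrite !mulr0 !scale0r.
by rewrite -exprD; congr (_ *: 'X^_); have := g1 _ _ n1; have := g2 _ _ n2; lia.
Qed.

Lemma gradedX1 E : gradedX E 1%:M = 1%:M.
Proof.
apply/matrixP=> i j; rewrite !mxE; case: eqP => [->|_]; last by rewrite scale0r.
by rewrite subnn expr0 scale1r.
Qed.

Lemma unimodular_det U V : V *m U = 1%:M -> \det U != 0.
Proof.
move=> /(congr1 determinant); rewrite det_mulmx det1 => h.
by apply/eqP => e; move: h; rewrite e mulr0 => /eqP; rewrite eq_sym oner_eq0.
Qed.

Lemma revm_coef0 E Z : map_mx (coefp 0) (revm E Z) = lcoefs Z E.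
Proof. by apply/matrixP=> i j; rewrite !mxE /= coef_revp subn0. Qed.

Lemma graded_rows E Z L : degbound Z E -> graded E L ->
  degbound (gradedX E L *m Z) E /\
  revm E (gradedX E L *m Z) = map_mx polyC L *m revm E Z.
Proof.
move=> dZ gL; split=> [i k|].
  rewrite mxE; apply: leq_trans (size_sum _ _ _) _; apply/bigmax_leqP => j _.
  rewrite mxE -scalerAl; have [->|n] := eqVneq (L i j) 0; first by rewrite scale0r size_poly0.
  apply: leq_trans (size_scale_leq _ _) _; apply: leq_trans (size_polyMleq _ _) _.
  rewrite size_polyXn addSn /=; apply: leq_trans (leq_add (leqnn _) (dZ j k)) _.
  by rewrite addnS subnK // gL.
apply/matrixP=> i k; rewrite !mxE revp_sum; apply: eq_bigr => j _.
rewrite !mxE -scalerAl revpZ; have [->|n] := eqVneq (L i j) 0; first by rewrite !polyC0 !mul0r.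
by rewrite revp_shift //; apply: gL.
Qed.

(** On the original matrix a pass is a unimodular row operation. A row without pivot loses its top
    coefficient, which lowers the sum of the bounds; if there is no such row, the pivots exhibit a
    reduced form. As D exceeds E by the same t in every row, both give the same comparisons. *)
Lemma one_pass Z E D T D1 t : degbound Z E -> \det Z != 0 ->
  (forall i, D i = (E i + t)%N) -> ispass (lcoefs Z E) D T D1 ->
  exists U V Z1 E1,
  [/\ V *m U = 1%:M, Z1 = U *m Z, forall i, D1 i = (E1 i + t.+1)%N,
      T *m revm E Z = 'X *: revm E1 Z1 & [/\ degbound Z1 E1,
        (\sum_i E1 i < \sum_i E i)%N \/ reduced Z1 E1
      & reduced Z E -> reduced Z1 E1]].
Proof.
move=> dZ nZ hD [T0 [Ti [fl [p [[h1 g2 g3] [h4 h5 h6] h7 h8 h9]]]]].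
have gE L : graded D L -> graded E L.
  by move=> g i j /g; rewrite !hD leq_add2r.
have [dZ1 rZ1] := graded_rows dZ (gE _ g2).
set U := gradedX E T0; set Z1 := U *m Z in dZ1 rZ1.
have VU : gradedX E Ti *m U = 1%:M by rewrite gradedX_mul ?h1 ?gradedX1 //; apply: gE.
have lZ1 : lcoefs Z1 E = T0 *m lcoefs Z E.
  rewrite -!revm_coef0 rZ1; apply/matrixP=> i j; rewrite !mxE /= coef_sum.
  by apply: eq_bigr => k _; rewrite !mxE coefCM.
have nU := unimodular_det VU.
have nZ1 : \det Z1 != 0 by rewrite det_mulmx mulf_neq0.
(* A row without pivot and of bound 0 would be zero, against det Z1 != 0; so E i - 1 is not
   truncated. *)
have Epos i : ~~ fl i -> (0 < E i)%N.
  move=> hi; rewrite lt0n; apply: contra nZ1 => /eqP e0.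
  rewrite (expand_det_row _ i) big1 // => j _.
  have -> : Z1 i j = 0; last by rewrite mul0r.
  have := h7 i j hi; rewrite -lZ1 mxE e0 => z.
  have s1 : (size (Z1 i j) <= 1)%N by have := dZ1 i j; rewrite e0.
  by rewrite (size1_polyC s1) z polyC0.
pose E1 i := (E i - ~~ fl i)%N.
exists U, (gradedX E Ti), Z1, E1.
have dE1 : degbound Z1 E1.
  move=> i j; rewrite /E1; case hi: (fl i); first by rewrite subn0.
  have := dZ1 i j; rewrite leq_eqVlt => /orP[/eqP s|]; last by have := Epos i; rewrite hi; lia.
  have : lead_coef (Z1 i j) = 0.
    by rewrite lead_coefE s /=; have := h7 i j; rewrite hi -lZ1 mxE => ->.
  by move/eqP; rewrite lead_coef_eq0 => /eqP ->; rewrite size_poly0.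
have full : (forall i, fl i) -> reduced Z1 E1.
  move=> hf; split=> //; exists p.
  have e i : E1 i = E i by rewrite /E1 hf subn0.
  have el : lcoefs Z1 E1 = lcoefs Z1 E by apply/matrixP=> i j; rewrite !mxE e.
  rewrite el lZ1; split=> [i j|i|i j]; [|exact: h5|exact: h6].
  by apply: h4; rewrite ?[_ \in _]hf.
have dich : (\sum_i E1 i < \sum_i E i)%N \/ forall i, fl i.
  have [/forallP hf|/forallPn[i0 hi0]] := boolP [forall i, fl i]; [by right | left].
  rewrite [X in (X < _)%N](bigD1 i0) //= [X in (_ < X)%N](bigD1 i0) //= -addSn.
  apply: leq_add; first by rewrite /E1 hi0 subn1 prednK // Epos.
  by apply: leq_sum => i _; apply: leq_subr.
split=> //.
- by move=> i; rewrite h9 hD /E1; case hi: (fl i) => /=; [lia | have := Epos i; rewrite hi; lia].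
- rewrite h8; have -> : (\matrix_(i, j) ((T0 i j)%:P * 'X^(fl i))) *m revm E Z =
     \matrix_(i, j) ('X^(fl i) * (revm E Z1) i j).
    rewrite rZ1; apply/matrixP=> i j; rewrite !mxE mulr_sumr; apply: eq_bigr => k _.
    by rewrite !mxE mulrA ['X^_ * _]mulrC.
  apply/matrixP=> i j; rewrite [LHS]mxE [RHS]mxE [revm E Z1 i j]mxE [revm E1 Z1 i j]mxE /E1.
  case hi: (fl i) => /=; first by rewrite expr1 subn0.
  rewrite expr0 mul1r subn1; have ep := Epos i; rewrite hi in ep.
  have z : (Z1 i j)`_((E i).-1.+1) = 0.
    by rewrite prednK ?ep //; have := h7 i j; rewrite hi -lZ1 mxE => ->.
  by rewrite -{1}[E i]prednK ?ep // revp_drop.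
split=> //; first by case: dich => [|/full]; [left | right].
(* A smaller sum would force det Z1 below the degree of det Z, of which it is a nonzero multiple. *)
move=> /reduced_det sZ; case: dich => [lt|/full //].
have [s1 _] := det_top dE1.
have : (size (\det Z) <= size (\det Z1))%N.
  by rewrite det_mulmx size_mul // -(prednK (_ : 0 < size (\det U))%N) ?size_poly_gt0 // addSn leq_addl.
by rewrite sZ => h; have := leq_trans h s1; rewrite ltnS leqNgt lt.
Qed.

Lemma passes_reduced s Z E D P D' t : degbound Z E -> \det Z != 0 ->
  (forall i, D i = (E i + t)%N) -> passes s (revm E Z) D P D' ->
  exists U V Z1 E1,
  [/\ V *m U = 1%:M, Z1 = U *m Z, forall i, D' i = (E1 i + (t + s))%N,
      P *m revm E Z = 'X^s *: revm E1 Z1 & [/\ degbound Z1 E1,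
        (\sum_i E1 i + s <= \sum_i E i)%N \/ reduced Z1 E1
      & reduced Z E -> reduced Z1 E1]].
Proof.
elim: s Z E D P t => [|s IH] Z E D P t dZ nZ hD /=.
  case=> -> e; exists 1%:M, 1%:M, Z, E; rewrite !mul1mx expr0 scale1r; split=> //.
    by move=> i; rewrite e hD addn0.
  by split=> //; left; rewrite addn0.
case=> T [D1 [A1 [P1 [h1 h2 h3 ->]]]].
rewrite revm_coef0 in h1.
have [U [V [Z1 [E1 [u1 u2 u3 u4 [u5 u6 u7]]]]]] := one_pass dZ nZ hD h1.
have eA : A1 = revm E1 Z1.
  by apply: (@scaleXn_inj 1); rewrite expr1 -u4 h2.
rewrite eA in h3 h2.
have nZ1 : \det Z1 != 0 by rewrite u2 det_mulmx mulf_neq0 // (unimodular_det u1).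
have [U' [V' [Z2 [E2 [v1 v2 v3 v4 [v5 v6 v7]]]]]] := IH _ _ _ _ _ u5 nZ1 u3 h3.
exists (U' *m U), (V *m V'), Z2, E2; split.
- by rewrite mulmxA -(mulmxA V) v1 mulmx1.
- by rewrite v2 u2 mulmxA.
- by move=> i; rewrite v3 addnS addSn.
- by rewrite -mulmxA h2 -scalemxAr v4 scalerA -exprS.
split=> //; last by move/u7/v7.
case: u6 => [lt|/v7]; last by right.
by case: v6 => [h|]; [left; rewrite addnS; apply: leq_ltn_trans h lt | right].
Qed.

(** If the outcome were not reduced, s passes would have brought the sum of the bounds below the
    degree of det Z, which divides the nonzero determinant of the result. *)
Lemma enough_passes s Z E P D' : degbound Z E ->
  (\sum_i E i < (size (\det Z)).-1 + s)%N -> \det Z != 0 -> passes s (revm E Z) E P D' ->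
  exists U V Z1 E1, [/\ V *m U = 1%:M, Z1 = U *m Z, forall i, D' i = (E1 i + s)%N,
      P *m revm E Z = 'X^s *: revm E1 Z1 & reduced Z1 E1].
Proof.
move=> dZ hs nZ hp.
have [U [V [Z1 [E1 [u1 u2 u3 u4 [u5 u6 u7]]]]]] := passes_reduced dZ nZ (fun i => esym (addn0 (E i))) hp.
exists U, V, Z1, E1; split=> //; case: u6 => // h; exfalso.
have [s1 _] := det_top u5.
have q : (size (\det Z) <= size (\det Z1))%N.
  rewrite u2 det_mulmx size_mul ?(unimodular_det u1) //.
  by rewrite -(prednK (_ : 0 < size (\det U))%N) ?size_poly_gt0 ?(unimodular_det u1) // addSn leq_addl.
have pos : (0 < size (\det Z))%N by rewrite size_poly_gt0.
move: h s1 hs q pos; move: (\sum_i E1 i)%N (\sum_i E i)%N (size (\det Z)) (size (\det Z1)).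
by lia.
Qed.

End Passes.

(** * Reduction programs *)

Section GaussStep.
Variables (F : fieldType) (m : nat) (D : 'I_m -> nat).
Implicit Types (L T : 'M[F]_m).

Lemma graded_mul T1 T2 : graded D T1 -> graded D T2 -> graded D (T1 *m T2).
Proof.
move=> g1 g2 i j; rewrite mxE; apply: contraR => h; rewrite big1 // => k _.
have [->|n1] := eqVneq (T1 i k) 0; first by rewrite mul0r.
have [->|n2] := eqVneq (T2 k j) 0; first by rewrite mulr0.
by move: h; rewrite (leq_trans (g2 _ _ n2) (g1 _ _ n1)).
Qed.

(** State of the elimination when columns [c] and beyond are done: the unmarked rows vanish there,
    and every pivot found lies there. *)
Definition eliminated L (c : nat) (fl : 'I_m -> bool) (p : 'I_m -> 'I_m) :=
  [/\ {in fl &, injective p},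
      forall i, fl i -> (c <= p i)%N /\ L i (p i) != 0,
      forall i j : 'I_m, fl i -> (p i < j)%N -> L i j = 0
    & forall i j : 'I_m, ~~ fl i -> (c <= j)%N -> L i j = 0].

Lemma eliminate_skip L (c : 'I_m) fl p : eliminated L c.+1 fl p ->
  (forall i, ~~ fl i -> L i c = 0) -> eliminated L c fl p.
Proof.
move=> [h1 h2 h3 h4] hc; split=> //.
  by move=> i /h2[h ?]; split=> //; apply: ltnW.
move=> i j hi; rewrite leq_eqVlt => /orP[/eqP e|]; last exact: h4.
by rewrite -(val_inj e : c = j) hc.
Qed.

(** Marked rows are untouched; the new pivot row vanishes beyond column c because it was unmarked
    until now. *)
Lemma eliminate_step L (c pr : 'I_m) fl p (gam : 'I_m -> F) :
  eliminated L c.+1 fl p -> ~~ fl pr -> L pr c != 0 ->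
  (forall i, gam i = if fl i || (i == pr) then 0 else L i c / L pr c) ->
  eliminated (\matrix_(i, j) (L i j - gam i * L pr j)) c
    (fun i => fl i || (i == pr)) (fun i => if i == pr then c else p i).
Proof.
move=> [h1 h2 h3 h4] hpr npr hg.
have fpr i : fl i -> i != pr by move=> hi; apply: contra hpr => /eqP <-.
split.
- move=> i j; rewrite !unfold_in; case: (eqVneq i pr) => [->|ni]; case: (eqVneq j pr) => [->|nj] //=.
  + by rewrite orbF => _ hj e; have [] := h2 j hj; rewrite -e ltnn.
  + by rewrite orbF => hi _ e; have [] := h2 i hi; rewrite e ltnn.
  + by rewrite !orbF => hi hj; apply: h1.
- move=> i; rewrite mxE hg; case: (eqVneq i pr) => [->|ni] /=.
    by rewrite orbT mul0r subr0.
  by rewrite orbF => hi; rewrite hi mul0r subr0; have [h ?] := h2 i hi; split=> //; apply: ltnW.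
- move=> i j; rewrite mxE hg; case: (eqVneq i pr) => [->|ni] /=.
    by rewrite orbT mul0r subr0 => _ hj; rewrite h4.
  by rewrite orbF => hi hj; rewrite hi mul0r subr0 h3.
- move=> i j; rewrite mxE hg negb_or => /andP[hi ni]; rewrite (negPf hi) (negPf ni) /=.
  rewrite leq_eqVlt => /orP[/eqP e|hj]; last by rewrite (h4 i j) // (h4 pr j) // mulr0 subr0.
  by rewrite -(val_inj e : c = j) mulfVK // subrr.
Qed.

(** The new matrix is (1 - N) T0 with N of rank one, supported on column [pr]. From gam pr = 0
    follows N^2 = 0, so 1 + N is inverse to 1 - N; both are graded when the pivot row has least
    degree among the rows it modifies. *)
Lemma graded_eliminate T0 Ti (pr : 'I_m) (gam : 'I_m -> F) :
  Ti *m T0 = 1%:M -> graded D T0 -> graded D Ti -> gam pr = 0 ->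
  (forall i, gam i != 0 -> (D pr <= D i)%N) ->
  exists Ti', [/\ Ti' *m (\matrix_(i, j) (T0 i j - gam i * T0 pr j)) = 1%:M,
    graded D (\matrix_(i, j) (T0 i j - gam i * T0 pr j)) & graded D Ti'].
Proof.
move=> h1 g1 g2 hg hD.
pose N : 'M[F]_m := (\col_i gam i) *m delta_mx (0 : 'I_1) pr.
have NE i j : N i j = gam i * (j == pr)%:R by rewrite !mxE big_ord1 !mxE.
have NN : N *m N = 0.
  apply/matrixP=> i j; rewrite !mxE big1 // => k _; rewrite !NE.
  by case: (eqVneq k pr) => [->|_]; rewrite ?hg ?mul0r mulr0 ?mul0r.
have gN c : graded D (1%:M + c *: N).
  move=> i j.
  have -> : (1%:M + c *: N) i j = (i == j)%:R + c * (gam i * (j == pr)%:R).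
    by rewrite -NE mxE [X in X + _]mxE [X in _ + X]mxE.
  have [->//|_] := eqVneq i j; rewrite add0r.
  case: (eqVneq j pr) => [->|_]; last by rewrite !mulr0 eqxx.
  by rewrite mulr1 mulf_eq0 negb_or => /andP[_ /hD].
have eT : (1%:M + (-1) *: N) *m T0 = \matrix_(i, j) (T0 i j - gam i * T0 pr j).
  rewrite mulmxDl mul1mx scaleN1r mulNmx; apply/matrixP=> i j; rewrite !mxE; congr (_ - _).
  rewrite (bigD1 pr) //= NE eqxx mulr1 big1 ?addr0 // => k kp.
  by rewrite NE (negPf kp) mulr0 mul0r.
exists (Ti *m (1%:M + 1 *: N)); rewrite -eT; split; try exact: graded_mul.
have e : (1%:M + 1 *: N) *m (1%:M + (-1) *: N) = 1%:M.
  rewrite scale1r scaleN1r mulmxDl mul1mx mulmxDr mulmx1 mulmxN NN oppr0 addr0.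
  by rewrite addrNK.
by rewrite mulmxA -(mulmxA Ti) e mulmx1.
Qed.

End GaussStep.

Section MatrixPrograms.
Variables (F : Type) (zero one : F) (r : nat).

Definition ent (A : seq (seq (seq F))) i j := nth [::] (nth [::] A i) j.

Definition mtab m (f : nat -> nat -> prog F (seq F)) := tab m (fun i => tab m (f i)).

Definition mxfun m (f : nat -> nat -> seq F) :=
  [seq [seq f i j | j <- iota 0 m] | i <- iota 0 m].

Definition matmul m S A B := mtab m (fun i j =>
  vsum zero one S m (fun k => pmul zero one r (ent A i k) (ent B k j))).

Definition rent (rows : seq (seq F)) i j := nth zero (nth [::] rows i) j.

Definition argmin (D : nat -> nat) i0 s :=
  foldr (fun i a => if (D i <= D a)%N then i else a) i0 s.

(* Columns are treated from the last to the first because the leading position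
   is the largest index reaching the degree. *)
Fixpoint gauss m (D : nat -> nat) c (rows : seq (seq F)) (fl : nat -> bool) :
    prog F (seq (seq F) * (nat -> bool)) :=
  if c is c'.+1 then
    zs <-- tab m (fun i => OpIsZero (rent rows i c') (fun b => Ret F b));
    if [seq i <- iota 0 m | ~~ fl i && ~~ nth true zs i] is i0 :: s then
      let p := argmin D i0 s in
      OpInv (rent rows p c') (fun pinv =>
      rows' <-- tab m (fun i => if fl i || (i == p) then Ret F (nth [::] rows i) else
        OpMul (rent rows i c') pinv (fun x => OpOpp x (fun y =>
          axpy zero (m + m) y (nth [::] rows i) (nth [::] rows p))));
      gauss m D c' rows' (fun i => fl i || (i == p)))
    else gauss m D c' rows fl
  else Ret F (rows, fl).

(** The constant coefficients are augmented by the identity, whose half of the rows ends up as the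
    transformation; a list of length two encodes the extra factor x on a pivot row. *)
Definition gauss_pass m (D : nat -> nat) (A : seq (seq (seq F))) :
    prog F (seq (seq (seq F)) * (nat -> nat)) :=
  st <-- gauss m D m
    [seq [seq nth zero (ent A i j) 0 | j <- iota 0 m] ++
         [seq if i == j then one else zero | j <- iota 0 m] | i <- iota 0 m]
    (fun=> false);
  Ret F (mxfun m (fun i j => let x := rent st.1 i (m + j) in
           if st.2 i then [:: zero; x] else [:: x]),
         fun i => D i + st.2 i)%N.

(** The first H passes make the transformed matrix divisible by x^H, so the other H passes need
    exactly its coefficients H to 2H - 1, together with the updated degrees. *)
Fixpoint pmbasis m h (A : seq (seq (seq F))) (D : nat -> nat) :
    prog F (seq (seq (seq F)) * (nat -> nat)) :=
  if h is h'.+1 then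
    let H := (2 ^ h')%N in
    st1 <-- pmbasis m h' (mxfun m (fun i j => take H (ent A i j))) D;
    R <-- matmul m (H.+1 + (H + H)) st1.1 A;
    st2 <-- pmbasis m h' (mxfun m (fun i j => take H (drop H (ent R i j)))) st1.2;
    P <-- matmul m (H + H).+1 st2.1 st1.1;
    Ret F (P, st2.2)
  else gauss_pass m D A.

(** After 2^h passes [st.2 i] is the new row degree plus 2^h, and the transformed matrix is
    divisible by x^(2^h): hence the [drop] and the bound for reversing back. *)
Definition reduce m h (Z : seq (seq (seq F))) (E : nat -> nat) :
    prog F (seq (seq (seq F))) :=
  let A := mxfun m (fun i j => rev (pad zero (E i).+1 (ent Z i j))) in
  st <-- pmbasis m h (mxfun m (fun i j => take (2 ^ h) (ent A i j))) E;
  R <-- matmul m ((2 ^ h).+1 + (\max_(i < m) E i).+1) st.1 A;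
  Ret F (mxfun m (fun i j =>
    rev (pad zero (st.2 i - 2 ^ h).+1 (drop (2 ^ h) (ent R i j))))).

End MatrixPrograms.

Section MatrixTriples.
Variables (F : fieldType) (r : nat).
Hypothesis r23 : r = 2%N \/ r = 3%N.
Hypothesis r_unit : r%:R != 0 :> F.

Definition entsize m S (A : seq (seq (seq F))) := forall i j : 'I_m, (size (ent A i j) <= S)%N.

Lemma decode_ent m (A : seq (seq (seq F))) (i j : 'I_m) : decode_mx m A i j = Poly (ent A i j).
Proof. by rewrite mxE. Qed.

Lemma ent_mxfun m (f : nat -> nat -> seq F) (i j : 'I_m) : ent (mxfun m f) i j = f i j.
Proof. by rewrite /ent /mxfun !(nth_map 0%N) ?size_iota ?nth_iota. Qed.

Lemma well_shaped_mxfun m (f : nat -> nat -> seq F) : well_shaped m (mxfun m f).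
Proof.
rewrite /well_shaped /mxfun size_map size_iota eqxx /=; apply/allP => x /mapP[i _ ->].
by rewrite size_map size_iota.
Qed.

Lemma tr_mtab m (f : nat -> nat -> prog F (seq F)) c S (M : 'M[{poly F}]_m) :
  (forall i j : 'I_m, tr (f i j) c (fun v => (size v <= S)%N /\ Poly v = M i j)) ->
  tr (mtab m f) (m * (m * c)) (fun A => decode_mx m A = M /\ entsize m S A).
Proof.
move=> H; apply: tr_weak (tr_tab [::] (P := fun i row => forall i' j : 'I_m, i' = i :> nat ->
   (size (nth [::] row j) <= S)%N /\ Poly (nth [::] row j) = M i' j) _) (leqnn _) _.
  move=> i hi; apply: tr_weak (tr_tab [::] (P := fun j v => forall i' j' : 'I_m,
     i' = i :> nat -> j' = j :> nat -> (size v <= S)%N /\ Poly v = M i' j') _) (leqnn _) _.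
    move=> j hj; apply: tr_weak (H (Ordinal hi) (Ordinal hj)) (leqnn _) _.
    move=> v [sv e] i' j' ei ej; rewrite sv e; split=> //.
    by congr (M _ _); apply: val_inj; rewrite /= ?ei ?ej.
  by move=> o [so Ho] i' j ei; apply: (Ho j (ltn_ord j) i' j ei).
move=> A [sA HA]; split=> [|i j]; last by apply: (HA i (ltn_ord i) i j erefl).1.
by apply/matrixP=> i j; rewrite decode_ent; apply: (HA i (ltn_ord i) i j erefl).2.
Qed.

Lemma tr_matmul m a b S (A B : seq (seq (seq F))) :
  entsize m a A -> entsize m b B -> ((a + b).-1 <= S)%N ->
  tr (matmul 0 1 r m S A B) (m * (m * (m * (pmul_cost (a + b) + S * 2))))
    (fun C => decode_mx m C = decode_mx m A *m decode_mx m B /\ entsize m S C).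
Proof.
move=> sA sB hS; apply: tr_mtab => i j.
apply: tr_weak (tr_vsum (c := pmul_cost (a + b))
  (g := fun k => Poly (ent A i k) * Poly (ent B k j)) _) (leqnn _) _.
  move=> k hk; apply: tr_weak (tr_pmul _ _ r23 r_unit) (leq_pmul_cost _) _.
    by apply: leq_add; [apply: (sA i (Ordinal hk)) | apply: (sB (Ordinal hk) j)].
  move=> o [so e]; split=> //; apply: leq_trans so (leq_trans _ hS).
  have := sA i (Ordinal hk); have := sB (Ordinal hk) j => /= h1 h2.
  by rewrite -!subn1 leq_sub2r // leq_add.
move=> o [so ->]; rewrite so; split=> //; rewrite mxE; apply: eq_bigr => k _.
by rewrite !decode_ent.
Qed.

Lemma argminP (D : nat -> nat) i0 s : argmin D i0 s \in i0 :: s /\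
  forall j, j \in i0 :: s -> (D (argmin D i0 s) <= D j)%N.
Proof.
elim: s => [|x s [h1 h2]] /=; first by split=> [|j]; rewrite inE // => /eqP ->.
case: leqP => hx; split.
- by rewrite !inE eqxx orbT.
- move=> j; rewrite !inE => /or3P[/eqP->|/eqP->//|hj].
    by apply: leq_trans hx (h2 _ _); rewrite inE eqxx.
  by apply: leq_trans hx (h2 _ _); rewrite inE hj orbT.
- by move: h1; rewrite !inE => /orP[->//|->]; rewrite !orbT.
- move=> j; rewrite !inE => /or3P[/eqP->|/eqP->|hj]; last by apply: h2; rewrite inE hj orbT.
    by apply: h2; rewrite inE eqxx.
  exact: ltnW.
Qed.

Definition gauss_inv m (L0 : 'M[F]_m) (D : nat -> nat) c (rows : seq (seq F)) (fl : nat -> bool) :=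
  exists (T0 Ti : 'M[F]_m) (p : 'I_m -> 'I_m),
  [/\ [/\ Ti *m T0 = 1%:M, graded (fun i : 'I_m => D i) T0 & graded (fun i : 'I_m => D i) Ti],
      forall i : 'I_m, size (nth [::] rows i) = (m + m)%N,
      forall i j : 'I_m, rent 0 rows i j = (T0 *m L0) i j,
      forall i j : 'I_m, rent 0 rows i (m + j) = T0 i j
    & eliminated (T0 *m L0) c (fun i : 'I_m => fl i) p].

Lemma tr_gauss m (L0 : 'M[F]_m) D c rows fl : (c <= m)%N -> gauss_inv L0 D c rows fl ->
  tr (gauss 0 m D c rows fl) (c * (m + (m * ((m + m) * 2).+2).+1))
    (fun st => gauss_inv L0 D 0 st.1 st.2).
Proof.
elim: c rows fl => [|c IH] rows fl hc inv; first exact: tr_ret.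
rewrite mulSn /= -addnA.
apply: tr_bind.
  have := @tr_tab F bool true m (fun i => OpIsZero (rent 0 rows i c) (fun b => Ret F b)) 1
     (fun i b => b = (rent 0 rows i c == 0)).
  by rewrite muln1; apply=> i _; apply: tr_isz; apply: tr_ret.
move=> zs [szs Hzs].
have [T0 [Ti [p [[h1 h2 h3] h4 h5 h6 h7]]]] := inv.
set cand := filter _ _.
have hcand i : (i \in cand) = [&& (i < m)%N, ~~ fl i & rent 0 rows i c != 0].
  rewrite mem_filter mem_iota /= add0n andbC; case: ltnP => //= hi.
  by rewrite Hzs.
have cO : (c < m)%N by [].
pose co := Ordinal cO.
case ec: cand => [|i0 s].
  apply: tr_weak (IH rows fl (ltnW hc) _) _ _ => //; last by rewrite leq_addl.
  exists T0, Ti, p; split=> //.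
  apply: (eliminate_skip (c := co)) => // i hi; apply/eqP; rewrite -h5 /=.
  by have := hcand i; rewrite ec in_nil ltn_ord hi /= => /esym/negbFE.
have [pin pmin] := argminP D i0 s; rewrite -ec in pin pmin.
set pv := argmin D i0 s in pin pmin *.
have := pin; rewrite hcand => /and3P[pvm flp npv].
pose po := Ordinal pvm.
rewrite addSn; apply: tr_inv.
pose gam (i : 'I_m) := if fl i || (i == po) then 0 else (T0 *m L0) i co / (T0 *m L0) po co.
apply: tr_bind (tr_tab [::] (P := fun i row => forall i' : 'I_m, i' = i :> nat ->
  size row = (m + m)%N /\ forall j, nth 0 row j = rent 0 rows i j - gam i' * rent 0 rows pv j) _) _.
  move=> i hi; case: ifP => hfl.
    apply: tr_ret => i' e; split=> [|j]; first by rewrite -e h4.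
    by rewrite /gam -val_eqE /= e hfl mul0r subr0.
  apply: tr_mul; apply: tr_opp.
  apply: tr_weak (tr_axpy _ _ _) (leqnn _) _.
  - by rewrite -[i]/(nat_of_ord (Ordinal hi)) h4.
  - by rewrite -[pv]/(nat_of_ord po) h4.
  move=> o [so Ho] i' e; split=> // j.
  have /polyP/(_ j) := Ho; rewrite coefD coefZ !coef_Poly => ->.
  rewrite /gam -val_eqE /= e hfl mulNr /rent; congr (_ - _ * _).
  have := h5 i' co; have := h5 po co; rewrite /rent /= => <- <-.
  by rewrite e.
move=> rows' [srows' Hr].
apply: IH (ltnW hc) _.
have gam0 : gam po = 0 by rewrite /gam eqxx orbT.
have gamD (i : 'I_m) : gam i != 0 -> (D po <= D i)%N.
  rewrite /gam; case: ifP => [_|/negbT]; first by rewrite eqxx.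
  rewrite negb_or => /andP[hf _] hn; apply: pmin; rewrite hcand ltn_ord hf /=.
  rewrite (h5 i co); apply: contra hn => /eqP ->; by rewrite mul0r.
have [Ti' [e1 e2 e3]] := graded_eliminate h1 h2 h3 gam0 gamD.
have eL : (\matrix_(i, j) (T0 i j - gam i * T0 po j)) *m L0 =
   \matrix_(i, j) ((T0 *m L0) i j - gam i * (T0 *m L0) po j).
  apply/matrixP=> i j; rewrite !mxE mulr_sumr -sumrB; apply: eq_bigr => k _.
  by rewrite mxE mulrBl mulrA.
exists (\matrix_(i, j) (T0 i j - gam i * T0 po j)), Ti', (fun i => if i == po then co else p i).
split=> //.
- by move=> i; apply: (Hr i (ltn_ord i) i erefl).1.
- move=> i j; rewrite eL mxE /rent (Hr i (ltn_ord i) i erefl).2 h5.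
  by rewrite -[pv]/(nat_of_ord po) h5.
- move=> i j; rewrite mxE /rent (Hr i (ltn_ord i) i erefl).2 h6.
  by rewrite -[pv]/(nat_of_ord po) h6.
rewrite eL.
have npo : (T0 *m L0) po co != 0 by rewrite -h5.
have := eliminate_step (c := co) (pr := po) h7 flp npo (fun i => erefl (gam i)).
by [].
Qed.

End MatrixTriples.

Definition gauss_cost m := (m * (m + (m * ((m + m) * 2).+2).+1))%N.

Fixpoint pmbasis_cost m h :=
  if h is h'.+1 then
    let H := (2 ^ h')%N in
    (pmbasis_cost m h' +
     (m * (m * (m * (pmul_cost (H.+1 + (H + H)) + (H.+1 + (H + H)) * 2))) +
     (pmbasis_cost m h' +
      (m * (m * (m * (pmul_cost (H.+1 + H.+1) + (H + H).+1 * 2))) + 0))))%N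
  else gauss_cost m.

Section ReduceTriples.
Variables (F : fieldType) (r : nat).
Hypothesis r23 : r = 2%N \/ r = 3%N.
Hypothesis r_unit : r%:R != 0 :> F.

Lemma tr_gauss_pass m (D : nat -> nat) (A : seq (seq (seq F))) :
  tr (gauss_pass 0 1 m D A) (gauss_cost m)
    (fun st => ispass (map_mx (coefp 0) (decode_mx m A)) (fun i : 'I_m => D i)
         (decode_mx m st.1) (fun i : 'I_m => st.2 i) /\ entsize m 2 st.1).
Proof.
rewrite -[gauss_cost m]addn0 /gauss_pass.
set rows := [seq _ ++ _ | i <- _].
have nr (i : 'I_m) : nth [::] rows i = [seq nth 0 (ent A i j) 0 | j <- iota 0 m] ++
         [seq if (i : nat) == j then 1 else 0 | j <- iota 0 m].
  by rewrite /rows (nth_map 0%N) ?size_iota // nth_iota.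
have inv : gauss_inv (map_mx (coefp 0) (decode_mx m A)) D m rows (fun=> false).
  exists 1%:M, 1%:M, id; have g1 : graded (fun i : 'I_m => D i) (1%:M : 'M[F]_m).
    by move=> i j; rewrite mxE; case: (eqVneq i j) => [->|_] //; rewrite eqxx.
  split.
  - by split=> //; rewrite mul1mx.
  - by move=> i; rewrite nr size_cat !size_map !size_iota.
  - move=> i j; rewrite mul1mx /rent nr nth_cat size_map size_iota ltn_ord.
    by rewrite (nth_map 0%N) ?size_iota // nth_iota // !mxE /= coef_Poly.
  - move=> i j; rewrite /rent nr nth_cat size_map size_iota ltnNge leq_addr /= addKn.
    by rewrite (nth_map 0%N) ?size_iota // nth_iota // mxE -val_eqE /=; case: eqP.
  - by split=> // i j _; rewrite leqNgt ltn_ord.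
apply: tr_bind (tr_gauss (leqnn m) inv) _ => -[rows' fl] /= [T0 [Ti [p [h1 h2 h3 h4 [e1 e2 e3 e4]]]]].
apply: tr_ret; split=> /=; last by move=> i j; rewrite ent_mxfun; case: ifP.
exists T0, Ti, (fun i : 'I_m => fl i), p; split=> //.
- by split=> // i /e2[].
- by move=> i j hi; apply: e4.
apply/matrixP=> i j; rewrite decode_ent ent_mxfun !mxE h4.
have P1 (x : F) : Poly [:: x] = x%:P.
  by apply/polyP=> -[|n]; rewrite coef_Poly coefC /= ?nth_nil.
have P2 (x : F) : Poly [:: 0; x] = x%:P * 'X.
  by apply/polyP=> -[|[|n]]; rewrite coef_Poly coefMX coefC /= ?nth_nil.
by case: (fl i); rewrite ?P1 ?P2 ?expr0 ?expr1 ?mulr1.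
Qed.

Lemma decode_mxfun m (f : nat -> nat -> seq F) :
  decode_mx m (mxfun m f) = \matrix_(i, j) Poly (f i j).
Proof. by apply/matrixP=> i j; rewrite decode_ent ent_mxfun mxE. Qed.

Lemma decode_take m H (A : seq (seq (seq F))) :
  decode_mx m A = decode_mx m (mxfun m (fun i j => take H (ent A i j))) +
    'X^H *: decode_mx m (mxfun m (fun i j => drop H (ent A i j))).
Proof.
apply/matrixP=> i j; rewrite !decode_mxfun decode_ent [RHS]mxE [X in _ = X + _]mxE.
by rewrite [X in _ = _ + X]mxE [X in _ = _ + _ * X]mxE -Poly_split.
Qed.

Lemma tr_pmbasis m h (A : seq (seq (seq F))) (D : nat -> nat) : entsize m (2 ^ h) A ->
  tr (pmbasis 0 1 r m h A D) (pmbasis_cost m h)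
    (fun st => passes (2 ^ h) (decode_mx m A) (fun i : 'I_m => D i)
        (decode_mx m st.1) (fun i : 'I_m => st.2 i) /\ entsize m (2 ^ h).+1 st.1).
Proof.
elim: h A D => [|h IH] A D sA.
  apply: tr_weak (tr_gauss_pass m D A) (leqnn _) _ => st [h1 h2]; split=> //.
  have [T0 [Ti [fl [p [[g1 g2 g3] q1 q2 eT eD]]]]] := h1.
  exists (decode_mx m st.1), (fun i : 'I_m => st.2 i).
  set T := decode_mx m st.1 in h1 eT *; set M := decode_mx m A in h1 q1 q2 *.
  (* A pass leaves no constant coefficient, so dropping it is an exact division by the variable. *)
  exists (\matrix_(i, j) (drop_poly 1 ((T *m M) i j))), 1%:M.
  split=> //; [| by rewrite mul1mx].
  apply/matrixP=> i j; rewrite [RHS]mxE [X in _ * X]mxE.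
  apply/polyP=> -[|n]; rewrite coefXM /= ?coef_drop_poly ?addn1 //.
  rewrite eT mxE coef_sum.
  have -> : \sum_(k < m) ((\matrix_(i, j) ((T0 i j)%:P * 'X^(fl i))) i k * M k j)`_0 =
     (fl i == 0 :> nat)%:R * (T0 *m map_mx (coefp 0) M) i j.
    rewrite [(_ *m _) i j]mxE mulr_sumr; apply: eq_bigr => k _; rewrite !mxE /=.
    by rewrite !coef0M coefC coefXn; case: (fl i); rewrite /= ?mulr0 ?mul0r ?mulr1 ?mul1r.
  by case: (boolP (fl i)) => hi; rewrite ?mul0r // q2 // mulr0.
have e2 : (2 ^ h.+1 = 2 ^ h + 2 ^ h)%N by rewrite expnS mul2n addnn.
rewrite /= -/pmbasis e2 in sA *; set H := (2 ^ h)%N in sA *.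
apply: tr_bind (IH _ D _) _.
  by move=> i j; rewrite ent_mxfun size_take_min geq_minl.
move=> [P1 D1] /= [p1 s1].
apply: tr_bind (tr_matmul r23 r_unit s1 sA _) _; first exact: leq_pred.
move=> R [eR sR].
set A1 := mxfun m _ in p1.
have {}p1 : passes H (decode_mx m A) (fun i : 'I_m => D i) (decode_mx m P1) (fun i : 'I_m => D1 i).
  by rewrite (decode_take m H A); apply: passes_trunc.
have [A2 eA2] := passes_div p1.
have eR2 : A2 = decode_mx m (mxfun m (fun i j => drop H (ent R i j))).
  apply/matrixP=> i j; rewrite decode_ent ent_mxfun; apply/esym/Poly_drop.
  by rewrite -decode_ent eR eA2 mxE.
apply: tr_bind (IH _ D1 _) _.
  by move=> i j; rewrite ent_mxfun size_take_min geq_minl.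
move=> [P2 D2] /= [p2 s2].
apply: tr_bind (tr_matmul r23 r_unit s2 s1 _) _; first by rewrite addSn addnS.
move=> P [eP sP]; apply: tr_ret; split=> //=; rewrite eP.
apply: passes_cat p1 eA2 _; rewrite eR2 (decode_take m H).
set B := mxfun m _ in p2; set B' := mxfun m (fun i j => take H _).
have -> : decode_mx m B' = decode_mx m B.
  by rewrite !decode_mxfun; apply/matrixP=> i j; rewrite !mxE ent_mxfun.
exact: passes_trunc.
Qed.

Lemma Poly_rev_pad e (z : seq F) : Poly (rev (pad 0 e.+1 z)) = revp e (Poly z).
Proof.
apply/polyP=> i; rewrite coef_revp !coef_Poly; case: leqP => h; last first.
  by rewrite nth_default // size_rev size_pad.
by rewrite nth_rev size_pad ?ltnS // subSS nth_pad ltnS leq_subr.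
Qed.

Lemma revpK e (p : {poly F}) : (size p <= e.+1)%N -> revp e (revp e p) = p.
Proof.
move=> sp; apply/polyP=> i; rewrite !coef_revp leq_subr; case: leqP => h.
  by rewrite subKn.
by rewrite nth_default // (leq_trans sp).
Qed.

Definition reduce_cost m h (e : nat) :=
  (pmbasis_cost m h + (m * (m * (m * (pmul_cost ((2 ^ h).+1 + e.+1) +
    ((2 ^ h).+1 + e.+1) * 2))) + 0))%N.

Lemma tr_reduce m h (Z : seq (seq (seq F))) (E : nat -> nat) :
  degbound (decode_mx m Z) (fun i : 'I_m => E i) ->
  (\sum_(i < m) E i < (size (\det (decode_mx m Z))).-1 + 2 ^ h)%N ->
  \det (decode_mx m Z) != 0 ->
  tr (reduce 0 1 r m h Z E) (reduce_cost m h (\max_(i < m) E i))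
    (fun out => well_shaped m out /\ exists U V (E1 : 'I_m -> nat),
       [/\ V *m U = 1%:M, decode_mx m out = U *m decode_mx m Z
         & reduced (decode_mx m out) E1]).
Proof.
move=> dZ hs nZ; rewrite /reduce /reduce_cost.
set A := mxfun m (fun i j => rev (pad 0 (E i).+1 (ent Z i j))); set e := (\max_(i < m) E i)%N.
have eA : decode_mx m A = revm (fun i : 'I_m => E i) (decode_mx m Z).
  by apply/matrixP=> i j; rewrite decode_ent ent_mxfun Poly_rev_pad [RHS]mxE decode_ent.
have sA : entsize m e.+1 A.
  by move=> i j; rewrite ent_mxfun size_rev size_pad ltnS; apply: (leq_bigmax i).
apply: tr_bind (tr_pmbasis E _) _.
  by move=> i j; rewrite ent_mxfun size_take_min geq_minl.
move=> [P D] /= [p1 s1].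
have {}p1 : passes (2 ^ h) (decode_mx m A) (fun i : 'I_m => E i) (decode_mx m P) (fun i : 'I_m => D i).
  by rewrite (decode_take m (2 ^ h) A); apply: passes_trunc.
apply: tr_bind (tr_matmul r23 r_unit s1 sA (leq_pred _)) _ => R [eR sR].
apply: tr_ret; split; first exact: well_shaped_mxfun.
rewrite eA in p1 eR.
have [U [V [Z1 [E1 [u1 u2 u3 u4 u5]]]]] := enough_passes dZ hs nZ p1.
set out := mxfun m _.
have eo : decode_mx m out = Z1.
  apply/matrixP=> i j; rewrite decode_ent ent_mxfun u3 addnK Poly_rev_pad.
  have -> : Poly (drop (2 ^ h) (ent R i j)) = revp (E1 i) (Z1 i j).
    by apply: Poly_drop; rewrite -decode_ent eR u4 !mxE.
  by rewrite revpK //; apply: u5.1.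
by exists U, V, E1; rewrite eo.
Qed.

End ReduceTriples.

(** 19 is 18 plus 1: the 2 S operations of an accumulation fit in one more unit. *)
Lemma pmul_cost_le n S : (n <= S)%N -> (pmul_cost n + S * 2 <= 19 * (2000 * (S * logs S)))%N.
Proof.
move=> h; have hp := leq_pmul_cost h; have : (S <= S * logs S)%N by rewrite leq_pmulr.
by move: hp; rewrite /pmul_cost; move: (S * logs S)%N => x; lia.
Qed.

(** A level adds two matrix products of at most 4 * 19 = 76 units each, and the right-hand side
    gains 2 * 80; [logs] is taken at 2^(h+2) to cover the lengths of all levels. *)
Lemma pmbasis_cost_le m h : (0 < m)%N ->
  (pmbasis_cost m h <= 80 * (2000 * (m * (m * (m * (h.+1 * (2 ^ h * logs (2 ^ h.+2))))))))%N.
Proof.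
move=> m0; set Q := fun x => (m * (m * (m * x)))%N.
have QE x : (m * (m * (m * x)) = Q 1%N * x)%N by rewrite /Q; ring.
elim: h => [|h IH].
  have l1 : (0 < logs (2 ^ 2))%N by [].
  rewrite /= /gauss_cost QE.
  have b : (m * (m + (m * ((m + m) * 2).+2).+1) <= 8 * Q 1%N)%N.
    rewrite /Q muln1.
    have m1 : (m <= m * (m * m))%N by rewrite leq_pmulr // muln_gt0 m0.
    have m2 : (m * m <= m * (m * m))%N by rewrite leq_mul2l leq_pmulr ?orbT.
    by move: m1 m2; lia.
  apply: leq_trans b _; rewrite mul1n expn0 mul1n.
  by move: (Q 1%N) (logs (2 ^ 2)) l1 => q l; nia.
rewrite /= -/pmbasis_cost; move: IH; rewrite !QE.
set H := (2 ^ h)%N; set q := Q 1%N; set c := pmbasis_cost m h.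
have H0 : (0 < H)%N by rewrite expn_gt0.
have e1 : (2 ^ h.+1 = 2 * H)%N by rewrite expnS.
have e2 : (2 ^ h.+2 = 4 * H)%N by rewrite !expnS mulnA.
have e3 : (2 ^ h.+3 = 8 * H)%N by rewrite !expnS !mulnA.
rewrite e1 e2 e3 => IH.
have b1 : (pmul_cost (H.+1 + (H + H)) + (H.+1 + (H + H)) * 2 <=
    19 * (2000 * (4 * H * logs (4 * H))))%N.
  by apply: leq_trans (pmul_cost_le (_ : H.+1 + (H + H) <= 4 * H)%N); lia.
have b2 : (pmul_cost (H.+1 + H.+1) + (H + H).+1 * 2 <=
    19 * (2000 * (4 * H * logs (4 * H))))%N.
  by apply: leq_trans (pmul_cost_le (_ : H.+1 + H.+1 <= 4 * H)%N); lia.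
have lg8 : (logs (4 * H) <= logs (8 * H))%N by apply: leq_logs; lia.
have := leq_mul (leqnn q) b1; have := leq_mul (leqnn q) b2.
have := leq_mul (leqnn (q * H)) lg8; have := leq_mul (leqnn (q * H * h.+1)) lg8.
clear -IH; move: IH.
have -> : (q * (h.+1 * (H * logs (4 * H))) = q * H * h.+1 * logs (4 * H))%N by ring.
have -> : (q * (19 * (2000 * (4 * H * logs (4 * H)))) = 76 * (2000 * (q * H * logs (4 * H))))%N by ring.
have -> : (q * (h.+2 * (2 * H * logs (8 * H))) = 2 * (q * H * h.+1 * logs (8 * H)) + 2 * (q * H * logs (8 * H)))%N by ring.
move: (q * H * h.+1 * logs (4 * H))%N (q * H * h.+1 * logs (8 * H))%N
   (q * H * logs (4 * H))%N (q * H * logs (8 * H))%N => x1 x2 x3 x4.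
move: (q * _)%N (q * _)%N c => y1 y2 c.
lia.
Qed.

(** 100 exceeds 80 for the passes plus 19 for the final product. *)
Lemma reduce_cost_le m h e S : (0 < m)%N -> (2 ^ h.+2 + e.+1 <= S)%N ->
  (reduce_cost m h e <= 100 * (2000 * (m * (m * (m * ((lg S).+1 * (S * logs S)))))))%N.
Proof.
move=> m0 hS; rewrite /reduce_cost.
have hS1 : (2 ^ h.+2 <= S)%N by apply: leq_trans hS; apply: leq_addr.
have hl : (h.+2 <= lg S)%N by apply: trunc_log_max.
have H0 : (0 < 2 ^ h)%N by rewrite expn_gt0.
have e2 : (2 ^ h.+2 = 4 * 2 ^ h)%N by rewrite !expnS mulnA.
have b0 : ((2 ^ h).+1 + e.+1 <= S)%N by apply: leq_trans hS; rewrite e2; lia.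
have b1 := pmul_cost_le b0.
have b2 : (h.+1 * (2 ^ h * logs (2 ^ h.+2)) <= (lg S).+1 * (S * logs S))%N.
  apply: leq_mul; first by lia.
  by apply: leq_mul; [rewrite e2 in hS1; lia | apply: leq_logs].
have b3 := pmbasis_cost_le h m0.
have b4 : (S * logs S <= (lg S).+1 * (S * logs S))%N by rewrite leq_pmull.
have b5 : ((2 ^ h).+1 + e.+1 <= S)%N by [].
set X := ((lg S).+1 * (S * logs S))%N in b2 b4 *.
have b6 : (pmul_cost ((2 ^ h).+1 + e.+1) + ((2 ^ h).+1 + e.+1) * 2 <= 19 * (2000 * X))%N.
  apply: leq_trans (leq_add (leqnn _) (leq_mul b0 (leqnn 2))) _.
  by apply: leq_trans b1 _; rewrite leq_mul2l leq_mul2l b4.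
have QE x : (m * (m * (m * x)) = m * (m * m) * x)%N by ring.
rewrite !QE in b3 *; set q := (m * (m * m))%N in b3 *.
have := leq_mul (leqnn q) b2; have := leq_mul (leqnn q) b6.
have -> : (q * (19 * (2000 * X)) = 19 * (2000 * (q * X)))%N by ring.
move: b3; move: (q * X)%N (q * _)%N (q * _)%N => x y z; lia.
Qed.

(** * Interpolation *)

Section InterpolationPrograms.
Variables (F : Type) (zero one : F) (r : nat).

(** A subproduct tree for G, for N = sum_i r_i prod_(j <> i) (X - alpha_j), and for the same sum
    with all values 1, which is G'. *)
Fixpoint ptree d (pts : seq (F * F)) : prog F (seq F * seq F * seq F) :=
  if d is d'.+1 then
    let H := (2 ^ d')%N in
    x <-- ptree d' (take H pts);
    y <-- ptree d' (drop H pts);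
    g <-- pmul zero one r x.1.1 y.1.1;
    n1 <-- pmul zero one r x.1.2 y.1.1;
    n2 <-- pmul zero one r x.1.1 y.1.2;
    n <-- axpy zero (H + H).+1 one n1 n2;
    d1 <-- pmul zero one r x.2 y.1.1;
    d2 <-- pmul zero one r x.1.1 y.2;
    d <-- axpy zero (H + H).+1 one d1 d2;
    Ret F (g, n, d)
  else if pts is a :: _ then
    OpOpp a.1 (fun na => Ret F ([:: na; one], [:: a.2], [:: one]))
  else Ret F ([:: one], [::], [::]).

(* The weight n + 1 on the first column forces the reduced row of leading position
   0 to be (c X^(n+1), u) with c constant, that is u G' = c modulo G; then u N / c
   interpolates, where N = sum_i r_i prod_(j <> i) (X - alpha_j). *)
Definition interpolate n (pts : seq (F * F)) : prog F (seq F * seq F) :=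
  t <-- ptree (lg n).+1 pts;
  let w := n.+1 in
  let Z := mxfun 2 (fun i j =>
    if j == 0%N then nseq w zero ++ (if i == 0%N then t.1.1 else t.2)
    else if i == 0%N then [::] else [:: one]) in
  Z' <-- reduce zero one r 2 (lg (n + w)).+1 Z (fun=> n + w)%N;
  OpIsZero (nth zero (ent Z' 0 0) w) (fun b =>
  let i := nat_of_bool b in
  OpInv (nth zero (ent Z' i 0) w) (fun ci =>
  u <-- pmul zero one r (take n.+2 (ent Z' i 1)) (take n t.1.2);
  v <-- axpy zero (n + n).+1 ci [::] u;
  Ret F (take n.+1 t.1.1, v))).

End InterpolationPrograms.

(** * The locator polynomial and the numerator of interpolation *)

Section ProductTree.
Variable F : fieldType.
Implicit Types (pts : seq (F * F)).

Fixpoint locator pts : {poly F} :=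
  if pts is a :: s then ('X - a.1%:P) * locator s else 1.

Fixpoint evaluator pts : {poly F} :=
  if pts is a :: s then a.2%:P * locator s + ('X - a.1%:P) * evaluator s else 0.

Definition ones pts : seq (F * F) := [seq (a.1, 1) | a <- pts].

Lemma locator_ones pts : locator (ones pts) = locator pts.
Proof. by elim: pts => //= a s ->. Qed.

Lemma locator_cat s1 s2 : locator (s1 ++ s2) = locator s1 * locator s2.
Proof. by elim: s1 => [|a s IH] /=; rewrite ?mul1r // IH mulrA. Qed.

Lemma evaluator_cat s1 s2 :
  evaluator (s1 ++ s2) = evaluator s1 * locator s2 + locator s1 * evaluator s2.
Proof.
elim: s1 => [|a s IH] /=; first by rewrite mul0r add0r mul1r.
by rewrite IH locator_cat; ring.
Qed.

Lemma locator_prod pts : locator pts = \prod_(a <- unzip1 pts) ('X - a%:P).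
Proof. by elim: pts => [|a s IH] /=; rewrite ?big_nil // big_cons IH. Qed.

Lemma size_locator pts : size (locator pts) = (size pts).+1.
Proof. by rewrite locator_prod size_prod_XsubC size_map. Qed.

Lemma monic_locator pts : locator pts \is monic.
Proof. by rewrite locator_prod monic_prod_XsubC. Qed.

Lemma locator_root pts a : a \in pts -> (locator pts).[a.1] = 0.
Proof.
move=> h; apply/eqP; rewrite -/(root _ _) locator_prod root_prod_XsubC.
by apply: map_f.
Qed.

Lemma size_evaluator pts : (size (evaluator pts) <= size pts)%N.
Proof.
elim: pts => [|a s IH] /=; first by rewrite size_poly0.
apply: leq_trans (size_polyD _ _) _; rewrite geq_max; apply/andP; split.
  rewrite mul_polyC; apply: leq_trans (size_scale_leq _ _) _; by rewrite size_locator.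
apply: leq_trans (size_polyMleq _ _) _; rewrite size_XsubC; exact: IH.
Qed.

(** At alpha_i only the i-th summand survives: N(alpha_i) = r_i G'(alpha_i), with G'(alpha_i)
    nonzero. So u N / c interpolates as soon as u G' = c modulo G with c a nonzero constant. *)
Lemma evaluator_value pts a : uniq (unzip1 pts) -> a \in pts ->
  (evaluator pts).[a.1] = a.2 * (evaluator (ones pts)).[a.1] /\
  (evaluator (ones pts)).[a.1] != 0.
Proof.
elim: pts => //= b s IH /andP[nb us]; rewrite inE locator_ones !hornerE => /predU1P[->|ain].
  rewrite subrr !mul0r !addr0 ?mul1r; split=> //.
  by rewrite -/(root _ _) locator_prod root_prod_XsubC.
have [e1 e2] := IH us ain; rewrite locator_root // !mulr0 !add0r e1; split; first by ring.
rewrite mulf_neq0 // subr_eq0; apply: contra nb => /eqP <-; exact: map_f.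
Qed.

End ProductTree.

Fixpoint ptree_cost d :=
  if d is d'.+1 then
    let H := (2 ^ d')%N in let c := pmul_cost (H.+1 + H.+1) in
    (ptree_cost d' + (ptree_cost d' + (c + (c + (c + ((H + H).+1 * 2 +
      (c + (c + ((H + H).+1 * 2 + 0)))))))))%N
  else 1%N.

Definition interpolate_cost n :=
  (ptree_cost (lg n).+1 + (reduce_cost 2 (lg (n + n.+1)).+1 (n + n.+1) +
   (pmul_cost (n.+2 + n) + ((n + n).+1 * 2 + 0)).+2))%N.

Section InterpolationTriples.
Variables (F : fieldType) (r : nat).
Hypothesis r23 : r = 2%N \/ r = 3%N.
Hypothesis r_unit : r%:R != 0 :> F.

Lemma tr_pmul_le (a b : seq F) A B :
  (size a <= A)%N -> (size b <= B)%N ->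
  tr (pmul 0 (1 : F) r a b) (pmul_cost (A + B))
    (fun o => (size o <= (A + B).-1)%N /\ Poly o = Poly a * Poly b).
Proof.
move=> ha hb; apply: tr_weak (tr_pmul _ _ r23 r_unit) (leq_pmul_cost (leq_add ha hb)) _.
move=> o [so ->]; split=> //; apply: leq_trans so _.
by rewrite -!subn1 leq_sub2r // leq_add.
Qed.

Lemma tr_ptree d (pts : seq (F * F)) : (size pts <= 2 ^ d)%N ->
  tr (ptree 0 1 r d pts) (ptree_cost d) (fun t =>
    [/\ Poly t.1.1 = locator pts, Poly t.1.2 = evaluator pts & Poly t.2 = evaluator (ones pts)] /\
    [/\ size t.1.1 <= (2 ^ d).+1, size t.1.2 <= (2 ^ d).+1 & size t.2 <= (2 ^ d).+1]%N).
Proof.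
elim: d pts => [|d IH] pts hp.
  have P1 (x : F) : Poly [:: x] = x%:P.
    by apply/polyP=> -[|n]; rewrite coef_Poly coefC /= ?nth_nil.
  have P2 (x y : F) : Poly [:: x; y] = x%:P + 'X * y%:P.
    by rewrite (Poly_cat [:: x] [:: y]) !P1.
  case: pts hp => [|a [|? ?]] // _.
    apply: (@tr_ret _ _ ([:: 1], [::], [::])); split; last by split.
    by split; [exact: P1 | exact: Poly_nil | exact: Poly_nil].
  apply: tr_opp; apply: (@tr_ret _ _ ([:: - a.1; 1], [:: a.2], [:: 1])).
  split; last by split.
  by split; rewrite ?[(_, _).1]/= ?[(_, _).2]/= ?P1 ?P2 [RHS]/= ?mulr0 ?mulr1 ?addr0 // polyCN addrC.
have e2 : (2 ^ d.+1 = 2 ^ d + 2 ^ d)%N by rewrite expnS mul2n addnn.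
rewrite /= -/(ptree _ _ _ d) e2; rewrite e2 in hp; set H := (2 ^ d)%N in hp *.
have eq_pts := cat_take_drop H pts.
have hs : ((H.+1 + H.+1).-1 = (H + H).+1)%N by rewrite addSn addnS.
apply: tr_bind (IH (take H pts) _) _; first by rewrite size_take_min geq_minl.
move=> [[g1 n1] d1] /= [[G1 N1 D1] [sg1 sn1 sd1]].
apply: tr_bind (IH (drop H pts) _) _; first by rewrite size_drop leq_subLR.
move=> [[g2 n2] d2] /= [[G2 N2 D2] [sg2 sn2 sd2]].
apply: tr_bind (tr_pmul_le sg1 sg2) _ => g; rewrite hs => -[sg Hg].
apply: tr_bind (tr_pmul_le sn1 sg2) _ => n; rewrite hs => -[sn Hn].
apply: tr_bind (tr_pmul_le sg1 sn2) _ => n'; rewrite hs => -[sn' Hn'].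
apply: tr_bind (tr_axpy _ sn sn') _ => n'' [sn'' Hn''].
apply: tr_bind (tr_pmul_le sd1 sg2) _ => p; rewrite hs => -[sp Hp].
apply: tr_bind (tr_pmul_le sg1 sd2) _ => p'; rewrite hs => -[sp' Hp'].
apply: tr_bind (tr_axpy _ sp sp') _ => p'' [sp'' Hp''].
apply: tr_ret; split=> /=; last by rewrite sn'' sp''.
split.
- by rewrite Hg G1 G2 -locator_cat eq_pts.
- by rewrite Hn'' scale1r Hn Hn' G1 G2 N1 N2 -evaluator_cat eq_pts.
have -> : ones pts = ones (take H pts) ++ ones (drop H pts) by rewrite -map_cat eq_pts.
by rewrite Hp'' scale1r Hp Hp' G1 G2 D1 D2 evaluator_cat !locator_ones.
Qed.

Lemma unimodular_size m (U V : 'M[{poly F}]_m) : V *m U = 1%:M -> size (\det U) = 1%N.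
Proof.
move=> h; have := congr1 (fun p : {poly F} => size p) (congr1 determinant h).
have nU := unimodular_det h; have nV := unimodular_det (mulmx1C h).
rewrite det_mulmx det1 size_poly1 size_mul //.
by move: nU nV; rewrite -!size_poly_gt0; move: (size (\det U)) (size (\det V)); lia.
Qed.

Lemma Poly_take n (s : seq F) : (size (Poly s) <= n)%N -> Poly (take n s) = Poly s.
Proof.
move=> h; apply/polyP=> i; rewrite !coef_Poly; case: (ltnP i n) => hi.
  by rewrite nth_take.
rewrite nth_default ?size_take_min ?geq_min ?hi //.
by rewrite -coef_Poly nth_default // (leq_trans h).
Qed.

(** The rows of Z' are (X^(n+1) f_i, U_i1) with f_i = U_i0 G + U_i1 G', and their degrees add up to
    2n + 1. Row a has its pivot in the first column, so its degree is at least n + 1; row b then has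
    degree at most n, which forces f_b = 0. Hence U_b1 vanishes at the n points, row b has degree
    exactly n, row a degree n + 1, and f_a is constant. *)
Lemma inverse_row n (pts : seq (F * F)) (U V Z' : 'M[{poly F}]_2) E1 (a b : 'I_2) p :
  size pts = n -> uniq (unzip1 pts) -> V *m U = 1%:M ->
  Z' = U *m \matrix_(i, j) (if j == 0 then 'X^(n.+1) * (if i == 0 then locator pts else evaluator (ones pts))
                       else if i == 0 then 0 else 1) ->
  degbound Z' E1 -> pivots (lcoefs Z' E1) p -> (\sum_i E1 i = n + n.+1)%N ->
  a != b -> p a = 0 -> p b = 1 ->
  [/\ Z' b 0 = 0, (Z' a 0)`_(n.+1) != 0, (size (Z' a 1%R) <= n.+2)%N
    & forall x, x \in pts -> (Z' a 0)`_(n.+1) = (Z' a 1).[x.1] * (evaluator (ones pts)).[x.1]].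
Proof.
move=> sp up VU eZ dZ [_ hp _] hE ab pa pb.
pose f i := U i 0 * locator pts + U i 1 * evaluator (ones pts).
have s2 (g : 'I_2 -> {poly F}) : \sum_i g i = g 0 + g 1.
  by rewrite !big_ord_recl big_ord0 addr0; congr (g _ + g _); apply: val_inj.
have Z0 i : Z' i 0 = 'X^(n.+1) * f i.
  by rewrite eZ mxE s2 !mxE /= /f mulrDr !(mulrCA 'X^(n.+1)).
have Z1 i : Z' i 1 = U i 1.
  by rewrite eZ mxE s2 !mxE /= mulr0 add0r mulr1.
have fx i x : x \in pts -> (f i).[x.1] = (U i 1).[x.1] * (evaluator (ones pts)).[x.1].
  by move=> hx; rewrite /f !hornerE locator_root // mulr0 add0r.
have Es : (E1 a + E1 b = n + n.+1)%N.
  rewrite -hE !big_ord_recl big_ord0 addn0.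
  case: a b ab {pa pb} => [[|[|//]] ia] [[|[|//]] ib] // _; [|rewrite addnC];
    by congr (E1 _ + E1 _)%N; apply: val_inj.
have Ea : (n.+1 <= E1 a)%N.
  have := hp a; rewrite pa mxE Z0 coefXnM; case: ltnP => //; by rewrite eqxx.
have fb0 : f b = 0.
  apply/eqP; apply/negPn/negP => nf; have := dZ b 0.
  rewrite Z0 mulrC size_mulXn // => h.
  by move: nf h; rewrite -size_poly_gt0; move: (size (f b)); lia.
have Ub : (n <= E1 b)%N.
  have nu : U b 1 != 0.
    by apply/eqP => u0; have := hp b; rewrite pb mxE Z1 u0 coef0 eqxx.
  have rts : all (root (U b 1)) (unzip1 pts).
    apply/allP => x /mapP[y hy ->]; have := fx b y hy; rewrite fb0 horner0 => /esym/eqP.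
    by rewrite mulf_eq0 (negPf (evaluator_value up hy).2) orbF.
  have := max_poly_roots nu rts up; rewrite size_map sp => h.
  by move: (dZ b 1) h; rewrite Z1; move: (size (U b 1)); lia.
have Ea' : E1 a = n.+1 by lia.
have sf : (size (f a) <= 1)%N.
  have [->|nf] := eqVneq (f a) 0; first by rewrite size_poly0.
  by have := dZ a 0; rewrite Z0 mulrC size_mulXn // Ea'; move: (size (f a)); lia.
split.
- by rewrite Z0 fb0 mulr0.
- by have := hp a; rewrite pa mxE Ea'.
- by have := dZ a 1; rewrite Ea'.
move=> x hx; rewrite Z0 coefXnM ltnn subnn Z1 -fx //.
by rewrite (size1_polyC sf) hornerC coefC.
Qed.

Lemma tr_interpolate n (pts : seq (F * F)) : (0 < n)%N -> size pts = n -> uniq (unzip1 pts) ->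
  tr (interpolate 0 1 r n pts) (interpolate_cost n) (fun o =>
    [/\ Poly o.1 = locator pts, (size o.1 <= n.+1)%N, (size o.2 <= (n + n).+1)%N
      & forall x, x \in pts -> (Poly o.2).[x.1] = x.2]).
Proof.
move=> n0 sp up.
have hn : (n < 2 ^ (lg n).+1)%N by apply: trunc_log_ltn.
apply: tr_bind (tr_ptree (_ : size pts <= 2 ^ (lg n).+1)%N) _; first by rewrite sp ltnW.
move=> [[g nn] d] [] /= [Hg Hn Hd] [_ _ _].
set Z := mxfun 2 _.
have eZ : decode_mx 2 Z = \matrix_(i, j) (if j == 0 then 'X^(n.+1) *
     (if i == 0 then locator pts else evaluator (ones pts)) else if i == 0 then 0 else 1).
  have pz t : Poly (nseq n.+1 (0 : F) ++ t) = 'X^(n.+1) * Poly t.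
    by rewrite Poly_cat Poly_nseq0 add0r size_nseq.
  have z (i : 'I_2) : (i == 0) = (nat_of_ord i == 0%N) by [].
  apply/matrixP=> i j; rewrite decode_ent ent_mxfun mxE !z.
  case: ifP => _; first by rewrite pz; case: ifP => _; rewrite ?Hg ?Hd.
  case: ifP => _; first exact: Poly_nil.
  by apply/polyP=> -[|k]; rewrite coef_Poly coef1 /= ?nth_nil.
have dZ : degbound (decode_mx 2 Z) (fun=> n + n.+1)%N.
  move=> i j; rewrite eZ mxE; case: ifP => _; last first.
    by case: ifP => _; rewrite ?size_poly0 ?size_poly1.
  apply: leq_trans (size_polyMleq _ _) _; rewrite size_polyXn addSn /=.
  case: ifP => _; first by rewrite size_locator sp; lia.
  by have := size_evaluator (ones pts); rewrite size_map sp; move: (size (evaluator _)); lia.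
have tZ : is_trig_mx (decode_mx 2 Z).
  apply/is_trig_mxP => i j ij; rewrite eZ mxE -!val_eqE /=.
  by case: i ij => [[|[|//]] ?]; case: j => [[|[|//]] ?].
have detZ : \det (decode_mx 2 Z) = 'X^(n.+1) * locator pts.
  by rewrite det_trig // !big_ord_recl big_ord0 eZ !mxE /= !mulr1.
have nl : locator pts != 0 by rewrite monic_neq0 ?monic_locator.
have sdet : size (\det (decode_mx 2 Z)) = (n + n.+1).+1.
  by rewrite detZ mulrC size_mulXn // size_locator sp addSn.
have nZ : \det (decode_mx 2 Z) != 0 by rewrite -size_poly_gt0 sdet.
apply: tr_seq (tr_reduce r23 r_unit (h := (lg (n + n.+1)).+1) (E := fun=> (n + n.+1)%N) dZ _ nZ) _ _.
(* The bounds sum to 2 (2n + 1) and the determinant has degree 2n + 1, so more than 2n + 1 passes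
   are enough. *)
- rewrite sdet /= sum_nat_const card_ord mul2n -addnn ltn_add2l.
  exact: trunc_log_ltn.
- rewrite !big_ord_recl big_ord0 maxn0 maxnn; apply: leqnn.
move=> Z' [_ [U [V [E1 [VU eZ' [dZ' [p hp]]]]]]].
rewrite eZ in eZ'.
have sE : (\sum_i E1 i = n + n.+1)%N.
  have : size (\det (decode_mx 2 Z')) = size (\det (decode_mx 2 Z)).
    by rewrite eZ' -eZ det_mulmx size_mul // ?(unimodular_det VU) // (unimodular_size VU).
  rewrite sdet (@reduced_det _ _ _ E1) => [[//]|]; by split; [|exists p].
have pI : injective p by case: hp.
have nth_ent (i j : 'I_2) k : nth 0 (ent Z' i j) k = (decode_mx 2 Z' i j)`_k.
  by rewrite decode_ent coef_Poly.
apply: tr_isz; rewrite (nth_ent 0 0).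
set i := nat_of_bool _.
(* The row of leading position 1 has first entry 0, while the other has a nonzero coefficient of
   X^(n+1) there: testing row 0 tells them apart. *)
have [a [hi H2 H3 H4]] : exists a : 'I_2, [/\ i = a,
    (decode_mx 2 Z' a 0)`_(n.+1) != 0, (size (decode_mx 2 Z' a 1%R) <= n.+2)%N
    & forall x, x \in pts -> (decode_mx 2 Z' a 0)`_(n.+1) =
         (decode_mx 2 Z' a 1).[x.1] * (evaluator (ones pts)).[x.1]].
  have o2 (j : 'I_2) : j = 0 \/ j = 1.
    by case: j => [[|[|//]] ?]; [left | right]; apply: val_inj.
  case: (o2 (p 0)) => p0.
    have p1 : p 1 = 1 by case: (o2 (p 1)) => // e; have := pI 0 1; rewrite p0 e => /(_ erefl).
    have [q1 q2 q3 q4] := inverse_row sp up VU eZ' dZ' hp sE (isT : 0 != 1 :> 'I_2) p0 p1.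
    by exists 0; split=> //; rewrite /i (negPf q2).
  have p1 : p 1 = 0 by case: (o2 (p 1)) => // e; have := pI 0 1; rewrite p0 e => /(_ erefl).
  have [q1 q2 q3 q4] := inverse_row sp up VU eZ' dZ' hp sE (isT : 1 != 0 :> 'I_2) p1 p0.
  by exists 1; split=> //; rewrite /i q1 coef0 eqxx.
rewrite {}hi; apply: tr_inv; rewrite (nth_ent a 0).
apply: tr_bind (tr_pmul_le (_ : _ <= n.+2)%N (_ : _ <= n)%N) _; try by rewrite size_take_min geq_minl.
move=> u [su Hu].
rewrite Poly_take in Hu; last by rewrite -(decode_ent (m := 2) _ a 1).
rewrite Poly_take in Hu; last by rewrite Hn -sp size_evaluator.
apply: tr_bind (tr_axpy _ _ su) _ => // v [sv Hv].
apply: tr_ret; split=> /=.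
- by rewrite Poly_take ?Hg // size_locator sp.
- by rewrite size_take_min geq_minl.
- by rewrite sv.
move=> x hx; rewrite Hv Poly_nil add0r Hu Hn hornerZ hornerM -(decode_ent (m := 2) _ a 1).
rewrite (evaluator_value up hx).1 (H4 x hx).
have h1 := H2; rewrite (H4 x hx) mulf_eq0 negb_or in h1; case/andP: h1 => h1 h2.
by field; rewrite h1 h2.
Qed.

End InterpolationTriples.

(** * The basis of the next module *)

Section LowMonomials.
Variable F : fieldType.
Implicit Types (P Q : {poly {poly F}}) (R p : {poly F}) (a b : F).

Lemma shiftXY_comp a b Q : shiftXY a b Q =
  comp_poly ('X + (b%:P)%:P) (map_poly (comp_poly ('X + a%:P)) Q).
Proof. by []. Qed.

Lemma shiftXY_D a b P Q : shiftXY a b (P + Q) = shiftXY a b P + shiftXY a b Q.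
Proof. by rewrite !shiftXY_comp !rmorphD. Qed.

Lemma shiftXY_B a b P Q : shiftXY a b (P - Q) = shiftXY a b P - shiftXY a b Q.
Proof. by rewrite !shiftXY_comp !rmorphB. Qed.

Lemma shiftXY_M a b P Q : shiftXY a b (P * Q) = shiftXY a b P * shiftXY a b Q.
Proof. by rewrite !shiftXY_comp !rmorphM. Qed.

Lemma shiftXY_0 a b : shiftXY a b 0 = 0.
Proof. by rewrite shiftXY_comp !rmorph0. Qed.

Lemma shiftXY_C a b p : shiftXY a b p%:P = (p \Po ('X + a%:P))%:P.
Proof. by rewrite shiftXY_comp map_polyC comp_polyC. Qed.

Lemma shiftXY_X a b : shiftXY a b 'X = 'X + (b%:P)%:P.
Proof. by rewrite shiftXY_comp map_polyX comp_polyX. Qed.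

Lemma comp_shift R a : exists h, R \Po ('X + a%:P) = (R.[a])%:P + 'X * h.
Proof.
have : root (R \Po ('X + a%:P) - (R.[a])%:P) 0.
  by rewrite /root !hornerE horner_comp !hornerE subrr.
case/factor_theorem => h; rewrite subr0 => e; exists h.
by rewrite mulrC -e addrCA subrr addr0.
Qed.

Lemma no_low_D s P Q : no_low_monomials s P -> no_low_monomials s Q -> no_low_monomials s (P + Q).
Proof. by move=> hP hQ i j h; rewrite !coefD hP // hQ // addr0. Qed.

Lemma no_low_B s P Q : no_low_monomials s P -> no_low_monomials s Q -> no_low_monomials s (P - Q).
Proof. by move=> hP hQ i j h; rewrite !coefB hP // hQ // subr0. Qed.

Lemma no_low_0 s : no_low_monomials s (0 : {poly {poly F}}).
Proof. by move=> i j _; rewrite !coef0. Qed.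

Lemma no_low_M s1 s2 P Q : no_low_monomials s1 P -> no_low_monomials s2 Q ->
  no_low_monomials (s1 + s2) (P * Q).
Proof.
move=> hP hQ i j h; rewrite coefM coef_sum big1 // => u _; rewrite coefM big1 // => v _.
case: (ltnP (v + u) s1) => h1; first by rewrite hP ?mul0r.
rewrite [X in _ * X]hQ ?mulr0 //; have := ltn_ord u; have := ltn_ord v; lia.
Qed.

Lemma no_low_M0 s P Q : no_low_monomials s P -> no_low_monomials s (Q * P).
Proof. by move=> h; rewrite -[s]add0n; apply: no_low_M. Qed.

Lemma no_low_Xn s : no_low_monomials s (('X^s : {poly F})%:P).
Proof.
move=> i j h; rewrite coefC; case: eqP h => [->|_] h; last by rewrite coef0.
by rewrite coefXn; case: eqP h => // ->; rewrite addn0 ltnn.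
Qed.

Lemma no_low_line h : no_low_monomials 1 ('X - ('X * h)%:P : {poly {poly F}}).
Proof.
move=> i j; case: i j => [|//] [|//] _.
by rewrite coefB coefX coefC /= sub0r coefN coefXM oppr0.
Qed.

(** Induction on the exponent i of X: the coefficient of X^i Y^(j+1) in the product is that of X^i
    Y^j in P, minus a combination of coefficients of P with a smaller power of X and total degree
    still below s. *)
Lemma no_low_line_cancel s h P :
  no_low_monomials s.+1 (('X - ('X * h)%:P) * P) -> no_low_monomials s P.
Proof.
move=> H i; elim/ltn_ind: i => i IH j hij.
have := H i j.+1; rewrite addnS ltnS => /(_ hij).
rewrite mulrBl coefB coefXM /= coefCM coefB -mulrA coefXM.
case: i IH hij => [|i] IH hij; first by rewrite subr0.
rewrite coefM big1 ?subr0 // => u _; rewrite IH ?mulr0 //; have := ltn_ord u; lia.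
Qed.

(** Writing R(X + a) = b + X h, the shifted Q(X, R) is the shifted Q at Y = X h, where every
    monomial of total degree at least s becomes divisible by X^s. *)
Lemma dvdp_eval_of_no_low s a b R Q : R.[a] = b -> no_low_monomials s (shiftXY a b Q) ->
  ('X - a%:P) ^+ s %| Q.[R].
Proof.
move=> Ra hQ; have [h eh] := comp_shift R a; rewrite Ra in eh.
have e : (Q.[R]) \Po ('X + a%:P) = (shiftXY a b Q).['X * h].
  rewrite shiftXY_comp horner_comp !hornerE.
  have -> : 'X * h + b%:P = R \Po ('X + a%:P) by rewrite eh addrC.
  by rewrite horner_map.
have d : 'X^s %| (Q.[R]) \Po ('X + a%:P).
  rewrite e horner_coef; elim/big_ind: _ => [|x y|j _]; [exact: dvdp0 | exact: dvdp_add |].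
  case: (leqP s j) => hj.
    by apply: dvdp_mull; rewrite exprMn; apply: dvdp_mulr; apply: dvdp_exp2l.
  rewrite -(subnK (ltnW hj)) exprD exprMn mulrA; apply: dvdp_mulr; apply: dvdp_mul => //.
  apply/dvdpP; exists (Poly (drop (s - j) (shiftXY a b Q)`_j)); rewrite mulrC.
  rewrite -{1}[_`_j]polyseqK (Poly_split (s - j)) -[RHS]add0r; congr (_ + _).
  apply/polyP=> i; rewrite coef_Poly coef0; case: (ltnP i (s - j)) => hi.
    by rewrite nth_take // hQ //; lia.
  by rewrite nth_default // size_take_min geq_min hi.
have := dvdp_comp_poly ('X - a%:P) d.
rewrite rmorphXn /= comp_polyX -comp_polyA comp_polyD comp_polyX comp_polyC.
by rewrite subrK comp_polyXr.
Qed.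

Lemma locator_exp_dvd (pts : seq (F * F)) e p : uniq (unzip1 pts) ->
  (forall x, x \in pts -> ('X - x.1%:P) ^+ e %| p) -> locator pts ^+ e %| p.
Proof.
elim: pts => [|x s IH] /=; first by rewrite expr1n dvd1p.
case/andP=> nx us H; rewrite exprMn Gauss_dvdp.
  by rewrite H ?mem_head // IH // => y hy; apply: H; rewrite inE hy orbT.
apply: coprimep_expl; apply: coprimep_expr; rewrite coprimep_sym coprimep_XsubC.
by rewrite locator_prod root_prod_XsubC.
Qed.

End LowMonomials.

Section Bivar.
Variables (F : fieldType).

Lemma coef_bivar m (v : 'rV[{poly F}]_m) (t : 'I_m) : (bivar v)`_t = v ord0 t.
Proof.
rewrite coef_sum (bigD1 t) //= coefCM coefXn eqxx mulr1 big1 ?addr0 // => u ut.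
by rewrite coefCM coefXn (_ : _ == _ = false) ?mulr0 //; apply: contraNF ut => /eqP e; apply/eqP/val_inj.
Qed.

Lemma bivar_inj m (u v : 'rV[{poly F}]_m) : bivar u = bivar v -> u = v.
Proof. by move=> e; apply/rowP=> t; rewrite -!coef_bivar e. Qed.

Lemma size_bivar m (v : 'rV[{poly F}]_m) : (size (bivar v) <= m)%N.
Proof.
apply: leq_trans (size_sum _ _ _) _; apply/bigmax_leqP => t _.
rewrite mul_polyC; apply: leq_trans (size_scale_leq _ _) _; by rewrite size_polyXn.
Qed.

Lemma bivar_row m (Q : {poly {poly F}}) : (size Q <= m)%N -> bivar (\row_(t < m) Q`_t) = Q.
Proof.
move=> sQ; apply/polyP=> i; case: (ltnP i m) => hi.
  by rewrite -[i]/(nat_of_ord (Ordinal hi)) coef_bivar mxE.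
by rewrite !nth_default // ?(leq_trans sQ) // (leq_trans (size_bivar _)).
Qed.

Lemma bivarD m (u v : 'rV[{poly F}]_m) : bivar (u + v) = bivar u + bivar v.
Proof. by rewrite /bivar -big_split; apply: eq_bigr => t _; rewrite mxE polyCD mulrDl. Qed.

Lemma bivarZ m (a : {poly F}) (v : 'rV[{poly F}]_m) : bivar (a *: v) = a%:P * bivar v.
Proof. by rewrite /bivar mulr_sumr; apply: eq_bigr => t _; rewrite mxE polyCM mulrA. Qed.

Lemma bivar0 m : bivar (0 : 'rV[{poly F}]_m) = 0.
Proof. by rewrite /bivar big1 // => t _; rewrite mxE polyC0 mul0r. Qed.

Lemma bivar_mul m q (u : 'rV[{poly F}]_m) (A : 'M[{poly F}]_(m, q)) :
  bivar (u *m A) = \sum_i (u ord0 i)%:P * bivar (row i A).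
Proof.
rewrite mulmx_sum_row; elim/big_rec2: _ => [|i x y _ IH]; first exact: bivar0.
by rewrite bivarD bivarZ IH.
Qed.

Variables (n s l : nat) (alpha w rr : 'I_n -> F).

Lemma in_M_mul m (u : 'rV[{poly F}]_m) (A : 'M[{poly F}]_(m, l.+1)) :
  (forall i, in_M s alpha w rr (row i A)) -> in_M s alpha w rr (u *m A).
Proof.
move=> H i; rewrite bivar_mul; elim/big_rec: _ => [|k x _ IH].
  by rewrite shiftXY_0; apply: no_low_0.
rewrite shiftXY_D; apply: no_low_D IH; rewrite shiftXY_M; apply: no_low_M0; exact: H.
Qed.

Lemma is_basis_unimodular (B U V : 'M[{poly F}]_l.+1) : V *m U = 1%:M ->
  is_basis s alpha w rr B -> is_basis s alpha w rr (U *m B).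
Proof.
move=> VU [h1 h2 h3]; have UV := mulmx1C VU; split.
- by move=> i; rewrite row_mul; apply: in_M_mul.
- move=> v /h2[u ->]; exists (u *m V).
  by rewrite mulmxA -(mulmxA u) VU mulmx1.
- move=> u; rewrite mulmxA => /h3 e.
  by rewrite -[u]mulmx1 -UV mulmxA e mul0mx.
Qed.

Lemma is_basis_det (B : 'M[{poly F}]_l.+1) : is_basis s alpha w rr B -> \det B != 0.
Proof.
case=> _ _ h; apply/negP => /det0P[v nv /h e]; by rewrite e eqxx in nv.
Qed.

End Bivar.

Section NextBasis.
Variables (F : fieldType) (n s l : nat) (alpha w rr : 'I_n -> F).
Variables (G R : {poly F}) (B : 'M[{poly F}]_l.+1).
(* Its rows are the coefficient vectors of 1 and of the Y^t (Y - R). *)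
Definition line_mx : 'M[{poly F}]_l.+2 :=
  \matrix_(i, j) ((j == i)%:R - (if (0 < i)%N then R * (j.+1 == i)%:R else 0)).

(** Factoring out the unitriangular [line_mx] makes the determinant immediate. *)
Definition next_mx : 'M[{poly F}]_l.+2 :=
  (block_mx (G ^+ s.+1)%:M 0 0 B : 'M_(1 + l.+1)) *m line_mx.

Lemma bivar_line (a : {poly F}) (u : 'rV[{poly F}]_l.+1) :
  bivar ((row_mx a%:M u : 'rV_(1 + l.+1)) *m line_mx) = a%:P + ('X - R%:P) * bivar u.
Proof.
rewrite bivar_mul (big_ord_recl l.+1); congr (_ + _).
  rewrite [row_mx _ _ _ _](_ : _ = a); last first.
    have -> : ord0 = lshift l.+1 (0 : 'I_1) :> 'I_(1 + l.+1) by apply: val_inj.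
    by rewrite row_mxEl mxE eqxx.
  rewrite /bivar (big_ord_recl l.+1) /= !mxE eqxx /= subr0 big1 ?addr0 ?expr0 ?mulr1 //.
  by move=> t _; rewrite !mxE /= subr0 polyC0 mul0r.
rewrite /bivar mulr_sumr; apply: eq_bigr => t _.
have -> : row_mx a%:M u ord0 (lift ord0 t) = u ord0 t.
  have -> : lift ord0 t = rshift 1 t :> 'I_(1 + l.+1) by apply: val_inj.
  by rewrite row_mxEr.
rewrite mulrCA mulrA -mulrA; congr (_ * _).
have -> : ('X - R%:P) * 'X^t = 'X^(t.+1) - R%:P * 'X^t :> {poly {poly F}}.
  by rewrite mulrBl -exprS.
rewrite (bigD1 (lift ord0 t)) //= !mxE eqxx /= (_ : _ == _ = false) ?mulr0 ?subr0 ?mul1r; last first.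
  by rewrite eqn_leq /bump /=; lia.
congr (_ + _).
have ht : (t < l.+2)%N by apply: leq_trans (ltn_ord t) _.
rewrite (bigD1 (Ordinal ht)) /=; last by rewrite -val_eqE /= /bump /=; lia.
rewrite !mxE -!val_eqE /= /bump /= add1n eqxx mulr1 (_ : _ == _ = false) ?sub0r; last by lia.
rewrite big1 ?addr0 ?polyCN ?mulNr // => i /andP[i1 i2].
rewrite !mxE -!val_eqE /= /bump /= add1n.
have -> : (i : nat) == t.+1 = false by apply: contraNF i1 => /eqP e; apply/eqP/val_inj; rewrite /= /bump /= add1n.
have -> : (i.+1 == t.+1) = false by apply: contraNF i2 => /eqP[e]; apply/eqP/val_inj.
by rewrite mulr0 subr0 polyC0 mul0r.
Qed.

Lemma next_mul (a : {poly F}) (u : 'rV[{poly F}]_l.+1) :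
  bivar ((row_mx a%:M u : 'rV_(1 + l.+1)) *m next_mx) =
  (a * G ^+ s.+1)%:P + ('X - R%:P) * bivar (u *m B).
Proof.
rewrite /next_mx mulmxA mul_row_block !mulmx0 addr0 add0r -scalar_mxM.
exact: bivar_line.
Qed.

Lemma row_split (u : 'rV[{poly F}]_l.+2) : u = row_mx (u ord0 ord0)%:M (\row_j u ord0 (lift ord0 j)) :> 'rV_(1 + l.+1).
Proof.
apply/rowP=> j; rewrite !mxE; case: splitP => k hk; rewrite !mxE.
  by rewrite !ord1 /= mulr1n; congr (u _ _); apply: val_inj; rewrite /= hk (ord1 k).
by congr (u _ _); apply: val_inj; rewrite /= hk.
Qed.

Lemma det_next : \det next_mx = G ^+ s.+1 * \det B.
Proof.
rewrite det_mulmx (@det_lblock _ 1 l.+1) det_scalar expr1 [X in _ * X](_ : _ = 1) ?mulr1 //.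
rewrite det_trig; last first.
  apply/is_trig_mxP => i j ij; rewrite mxE -val_eqE /=.
  have -> : (j : nat) == i = false by apply: gtn_eqF.
  case: ifP => _; last by rewrite subr0.
  by rewrite (gtn_eqF (leqW ij)) mulr0 subr0.
rewrite big1 // => i _; rewrite mxE eqxx (gtn_eqF (leqnn _)) mulr0.
by case: ifP; rewrite subr0.
Qed.

Hypothesis R_alpha : forall i, R.[alpha i] = rr i / w i.
Hypothesis G_root : forall i, root G (alpha i).
Hypothesis G_dvd : forall e p, (forall i, ('X - (alpha i)%:P) ^+ e %| p) -> G ^+ e %| p.
Hypothesis G_neq0 : G != 0.
Hypothesis B_basis : is_basis s alpha w rr B.

Lemma shift_line i : exists h,
  shiftXY (alpha i) (rr i / w i) ('X - R%:P) = 'X - ('X * h)%:P.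
Proof.
have [h e] := comp_shift R (alpha i); exists h.
by rewrite shiftXY_B shiftXY_X shiftXY_C e R_alpha polyCD opprD addrA addrK.
Qed.

Lemma no_low_locator e (a : {poly F}) i :
  no_low_monomials e (shiftXY (alpha i) (rr i / w i) (a * G ^+ e)%:P).
Proof.
rewrite shiftXY_C comp_polyM rmorphXn /= polyCM; apply: no_low_M0.
have /factor_theorem[g ->] := G_root i.
rewrite comp_polyM comp_polyB comp_polyX comp_polyC addrK exprMn polyCM.
by apply: no_low_M0; apply: no_low_Xn.
Qed.

(** Divide Q by Y - R: Q = Q(R) + (Y - R) P. Vanishing to order s + 1 makes Q(R) a multiple of
    G^(s+1), hence in the module; so (Y - R) P is in it too, and cancelling Y - R puts P in the
    module of order s. For independence, setting Y = R isolates the coefficient of G^(s+1). *)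
Lemma next_basis : is_basis s.+1 alpha w rr next_mx.
Proof.
have [h1 h2 h3] := B_basis; split.
- move=> i; have -> : row i next_mx = delta_mx 0 i *m next_mx by rewrite -rowE.
  rewrite (row_split (delta_mx 0 i)); set a := _ ord0 ord0; set u := \row_j _.
  move=> k; rewrite next_mul shiftXY_D; apply: no_low_D; first exact: no_low_locator.
  rewrite shiftXY_M; have [h ->] := shift_line k.
  rewrite -add1n; apply: no_low_M (no_low_line _) _.
  by apply: (@in_M_mul F n s l alpha w rr _ u B) => j; apply: h1.
- move=> v hv; set Q := bivar v.
  have : root (Q - (Q.[R])%:P) R by rewrite /root !hornerE subrr.
  case/factor_theorem => P eP.
  have eQ : Q = (Q.[R])%:P + ('X - R%:P) * P by rewrite mulrC -eP addrCA subrr addr0.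
  have sP : (size P <= l.+1)%N.
    have [->|nP] := eqVneq P 0; first by rewrite size_poly0.
    have := congr1 (fun p : {poly {poly F}} => size p) eP.
    rewrite size_Mmonic ?monicXsubC // size_XsubC addn2 /= => e.
    have : (size (Q - (Q.[R])%:P)%R <= l.+2)%N.
      apply: leq_trans (size_polyD _ _) _; rewrite size_polyN geq_max size_bivar.
      by rewrite (leq_trans (size_polyC_leq1 _)).
    by rewrite e.
  have : G ^+ s.+1 %| Q.[R].
    by apply: G_dvd => i; apply: dvdp_eval_of_no_low (R_alpha i) (hv i).
  case/dvdpP => a ea.
  pose p := \row_(t < l.+1) P`_t.
  have eP' : bivar p = P by apply: bivar_row.
  have hp : in_M s alpha w rr p.
    move=> i; rewrite eP'; have [h eh] := shift_line i.
    apply: (@no_low_line_cancel F s h); rewrite -eh -shiftXY_M.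
    have -> : ('X - R%:P) * P = Q - (a * G ^+ s.+1)%:P by rewrite -ea eP mulrC.
    by rewrite shiftXY_B; apply: no_low_B; [exact: hv | exact: no_low_locator].
  have [u eu] := h2 p hp.
  exists (row_mx a%:M u); apply: bivar_inj.
  by rewrite next_mul -eu eP' -ea -eQ.
- move=> u hu; rewrite (row_split u) in hu *.
  set a := u ord0 ord0 in hu *; set u' := \row_j _ in hu *.
  have := congr1 (@bivar F _) hu; rewrite next_mul bivar0 => e.
  have a0 : a = 0.
    have := congr1 (fun p : {poly {poly F}} => p.[R]) e; rewrite !hornerE subrr mul0r addr0.
    by move=> /eqP; rewrite mulf_eq0 expf_eq0 /= (negPf G_neq0) orbF => /eqP.
  have u0 : u' = 0.
    move: e; rewrite a0 mul0r polyC0 add0r => /eqP.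
    rewrite mulf_eq0 polyXsubC_eq0 /= -(bivar0 F l.+1) => /eqP/bivar_inj; exact: h3.
  by rewrite a0 u0; apply/rowP=> j; rewrite !mxE; case: splitP => k _; rewrite !mxE // mul0rn.
Qed.

End NextBasis.

(** * One step of the algorithm *)

Section Step.
Variables (F : Type) (zero one : F).

(** The row degrees of B W, read off for free from the lengths of the normalised coefficient lists
    in the encoding of B. *)
Definition step_rdeg (B : seq (seq (seq F))) k l i :=
  (\max_(t < l.+1) (if size (ent B i t) == 0 then 0 else size (ent B i t) + t * k.-1)).-1%N.

(** [n + n] bounds the degree of R, which is u N / c not reduced modulo G, and also the k - 1 added
    by multiplication by Y. *)
Definition step_bound (B : seq (seq (seq F))) n k s l i :=
  if i is i'.+1 then (step_rdeg B k l i' + (n + n))%N else (s.+1 * n)%N.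

(** The test 1 + 1 = 0 selects a radix invertible in the field. The weights are powers of X:
    applying and removing them only shifts lists. *)
Definition step_prog (inp : alg_input F) : prog F (seq (seq (seq F))) :=
  let n := in_n inp in let k := in_k inp in let s := in_s inp in let l := in_l inp in
  let B := in_B inp in
  OpAdd one one (fun two => OpIsZero two (fun b =>
  let r := if b then 3%N else 2%N in
  rs <-- tab n (fun i => OpInv (nth zero (in_w inp) i) (fun wi =>
    OpMul (nth zero (in_r inp) i) wi (fun x => Ret F x)));
  gr <-- interpolate zero one r n (zip (in_alpha inp) rs);
  gs <-- crepeat s.+1 (fun _ p => pmul zero one r gr.1 p) [:: one];
  rb <-- mtab l.+1 (fun i j => pmul zero one r gr.2 (ent B i j));
  c <-- mtab l.+2 (fun i j => if i is i'.+1 then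
      let x := if j is j'.+1 then ent B i' j' else [::] in
      let y := if (j < l.+1)%N then ent rb i' j else [::] in
      OpOpp one (fun mone => axpy zero (maxn (size x) (size y)) mone x y)
    else Ret F (if j == 0%N then gs else [::]));
  z <-- reduce zero one r l.+2 (lg ((n + n) * l.+1)).+1
    (mxfun l.+2 (fun i j => nseq (j * k.-1) zero ++ ent c i j)) (step_bound B n k s l);
  Ret F (mxfun l.+2 (fun i j => drop (j * k.-1) (ent z i j))))).

End Step.

(** * Row degrees of a basis in weak Popov form *)

Section Weights.
Variable F : fieldType.

Lemma mul_Wmx k l (A : 'M[{poly F}]_l.+1) (i j : 'I_l.+1) :
  (A *m Wmx F k l) i j = A i j * 'X^(j * k.-1).
Proof. by rewrite mul_mx_diag !mxE. Qed.

Lemma det_Wmx k l : \det (Wmx F k l) = 'X^(\sum_(t < l.+1) t * k.-1).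
Proof.
rewrite det_diag; elim/big_rec2: _ => [|i x y _ ->]; first by rewrite expr0.
by rewrite mxE exprD.
Qed.

Lemma size_det_W k l (A : 'M[{poly F}]_l.+1) : \det A != 0 ->
  size (\det (A *m Wmx F k l)) = (\sum_(t < l.+1) t * k.-1 + size (\det A))%N.
Proof. by move=> nA; rewrite det_mulmx det_Wmx size_mulXn. Qed.

Lemma row_neq0_det m (A : 'M[{poly F}]_m) i : \det A != 0 -> row i A != 0.
Proof.
move=> nA; apply: contra nA => /eqP e; rewrite (expand_det_row _ i) big1 // => j _.
by have /rowP/(_ j) := e; rewrite !mxE => ->; rewrite mul0r.
Qed.

Variables (n s l k : nat) (alpha w rr : 'I_n -> F) (B : 'M[{poly F}]_l.+1) (G : {poly F}).
Hypothesis G_root : forall i, root G (alpha i).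
Hypothesis G_size : size G = n.+1.
Hypothesis B_basis : is_basis s alpha w rr B.

(* Trade row i for the lattice vector G^s Y^t having the same leading position:
   the result is still reduced, and the index can only grow. *)
Lemma basis_row_degree (E : 'I_l.+1 -> nat) i : reduced (B *m Wmx F k l) E ->
  (E i <= s * n + l * k.-1)%N.
Proof.
set Z := B *m _ => redZ; have [dZ [p [pI p1 p2]]] := redZ.
have [_ h2 _] := B_basis.
have nG : G != 0 by rewrite -size_poly_eq0 G_size.
set t := p i; pose v : 'rV[{poly F}]_l.+1 := \row_j (if j == t then G ^+ s else 0).
have bv : bivar v = 'X^t * (1 * G ^+ s)%:P.
  rewrite /bivar (bigD1 t) //= mxE eqxx mul1r mulrC big1 ?addr0 // => j jt.
  by rewrite mxE (negPf jt) mul0r.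
have [u eu] : exists u, v = u *m B.
  apply: h2 => j; rewrite bv shiftXY_M; apply: no_low_M0.
  exact: (no_low_locator w rr G_root 1 j).
pose U : 'M[{poly F}]_l.+1 := \matrix_j (if j == i then u else delta_mx 0 j).
pose Z1 := U *m Z.
pose E1 j := if j == i then (s * n + t * k.-1)%N else E j.
have Z1E a j : Z1 a j = if a == i then (if j == t then G ^+ s * 'X^(t * k.-1) else 0) else Z a j.
  have -> : Z1 a j = (row a U *m Z) ord0 j by rewrite -row_mul [RHS]mxE.
  rewrite rowK; case: (a == i); last by rewrite -rowE [LHS]mxE.
  rewrite mulmxA -eu mul_mx_diag !mxE; case: eqP => [->|_] //.
  by rewrite mul0r.
have sGs : size (G ^+ s) = (s * n).+1.
  have := size_exp G s; rewrite G_size /= => e.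
  by rewrite -(prednK (_ : 0 < size (G ^+ s)%R)%N) ?size_poly_gt0 ?expf_neq0 // e mulnC.
have sv : size (G ^+ s * 'X^(t * k.-1)) = (s * n + t * k.-1).+1.
  by rewrite size_mulXn ?expf_neq0 // sGs addnS addnC.
have redZ1 : reduced Z1 E1.
  split=> [a j|].
    rewrite Z1E /E1; case: eqP => // _; case: eqP => _; last by rewrite size_poly0.
    by rewrite sv.
  exists p; split=> // [a|a j hj]; rewrite mxE Z1E /E1.
    case: (eqVneq a i) => [->|_]; last by have := p1 a; rewrite mxE.
    rewrite eqxx; have := lead_coef_eq0 (G ^+ s * 'X^(t * k.-1)).
    by rewrite lead_coefE sv /= => ->; rewrite -size_poly_eq0 sv.
  case: (eqVneq a i) hj => [->|_] hj; last by have := p2 a j hj; rewrite mxE.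
  by rewrite -val_eqE /= gtn_eqF ?coef0.
have e0 := reduced_det redZ; have e1 := reduced_det redZ1.
have nZ1 : \det Z1 != 0 by rewrite -size_poly_gt0 e1.
have nU : \det U != 0 by apply: contra nZ1 => /eqP e; rewrite /Z1 (det_mulmx U Z) e mul0r.
have nZ : \det Z != 0 by rewrite -size_poly_gt0 e0.
have : (size (\det Z) <= size (\det Z1))%N.
  rewrite /Z1 (det_mulmx U Z) size_mul //.
  by rewrite -(prednK (_ : 0 < size (\det U))%N) ?size_poly_gt0 // addSn leq_addl.
have eE : (\sum_(j < l.+1 | j != i) E1 j = \sum_(j < l.+1 | j != i) E j)%N.
  by apply: eq_bigr => j /negPf h; rewrite /E1 h.
rewrite e0 e1 ltnS (bigD1 i) //= [X in (_ <= X)%N](bigD1 i) //= eE {1}/E1 eqxx.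
rewrite leq_add2r => /leq_trans; apply; rewrite leq_add2l leq_mul2r -ltnS ltn_ord orbT //.
Qed.

End Weights.

Definition step_cost n k s l e :=
  let d := (s * n + l * k.-1)%N in
  (n * 2 + (interpolate_cost n + (s.+1 * pmul_cost (n.+1 + (s * n).+1) +
   (l.+1 * (l.+1 * pmul_cost ((n + n).+1 + d.+1)) +
   (l.+2 * (l.+2 * (((n + n).+1 + d.+1) * 2).+1) +
   (reduce_cost l.+2 (lg ((n + n) * l.+1)).+1 e + 0))))))%N.+2.

Section StepTriple.
Variables (F : fieldType) (n k s l : nat) (alpha w rr : 'I_n -> F) (B : 'M[{poly F}]_l.+1).
Hypothesis k_gt0 : (0 < k)%N.
Hypothesis k_ltn : (k < n)%N.
Hypothesis alpha_inj : injective alpha.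
Hypothesis B_basis : is_basis s alpha w rr B.
Hypothesis B_popov : weak_popov (B *m Wmx F k l).

Let inp := AlgInput n k s l [seq alpha i | i <- enum 'I_n] [seq w i | i <- enum 'I_n]
             [seq rr i | i <- enum 'I_n] (encode_mx B).

Lemma ent_encode m (A : 'M[{poly F}]_m) (i j : 'I_m) : ent (encode_mx A) i j = A i j.
Proof.
rewrite /ent /encode_mx (nth_map i) ?size_enum_ord // nth_ord_enum.
by rewrite (nth_map j) ?size_enum_ord // nth_ord_enum.
Qed.

Lemma ent_encode_out (i : 'I_l.+1) t : (l < t)%N -> ent (encode_mx B) i t = [::].
Proof.
move=> ht; rewrite /ent nth_default // /encode_mx (nth_map i) ?size_enum_ord //.
by rewrite size_map size_enum_ord.
Qed.

Lemma ent_encode_bivar (i : 'I_l.+1) t : Poly (ent (encode_mx B) i t) = (bivar (row i B))`_t.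
Proof.
case: (ltnP t l.+1) => ht.
  rewrite -[t]/(nat_of_ord (Ordinal ht)) ent_encode polyseqK coef_bivar mxE //.
rewrite nth_default; last exact: leq_trans (size_bivar _) ht.
by rewrite ent_encode_out // Poly_nil.
Qed.

Lemma rdeg_encode (i : 'I_l.+1) :
  step_rdeg (encode_mx B) k l i = (rdeg (row i (B *m Wmx F k l))).-1.
Proof.
rewrite /step_rdeg /rdeg; congr (_.-1); apply: eq_bigr => t _.
rewrite ent_encode mxE mul_Wmx; case: eqP => [/eqP|/eqP]; rewrite size_poly_eq0.
  by move=> /eqP ->; rewrite mul0r size_poly0.
by move=> nz; rewrite size_mulXn // addnC.
Qed.

Let delta (i : 'I_l.+1) := (rdeg (row i (B *m Wmx F k l))).-1.

Lemma B_reduced : reduced (B *m Wmx F k l) delta.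
Proof.
apply: weak_popov_reduced => // i; apply: row_neq0_det.
rewrite -size_poly_gt0 size_det_W ?(is_basis_det B_basis) // addn_gt0.
by rewrite size_poly_gt0 (is_basis_det B_basis) orbT.
Qed.

Lemma next_mx0 G R (j : 'I_l.+2) : next_mx s G R B ord0 j = if j == 0%N :> nat then G ^+ s.+1 else 0.
Proof.
have e : row ord0 (next_mx s G R B) = (row_mx 1%:M 0 : 'rV_(1 + l.+1)) *m next_mx s G R B.
  rewrite [LHS]rowE; congr (_ *m _); apply/rowP=> t; rewrite !mxE.
  rewrite (_ : (t == ord0) = (nat_of_ord t == 0%N)) //.
  by case: splitP => j' hj; rewrite !mxE hj // (ord1 j').
have := @next_mul F s l G R B 1 0; rewrite -e mul0mx bivar0 mulr0 addr0 mul1r.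
move=> /(congr1 (fun p : {poly {poly F}} => p`_j)); rewrite coef_bivar mxE => ->.
by rewrite coefC.
Qed.

Lemma next_mxS G R (i : 'I_l.+1) (j : 'I_l.+2) : next_mx s G R B (lift ord0 i) j =
  (if nat_of_ord j is j'.+1 then (bivar (row i B))`_j' else 0) - R * (bivar (row i B))`_j.
Proof.
have e : row (lift ord0 i) (next_mx s G R B) =
    (row_mx 0%:M (delta_mx 0 i) : 'rV_(1 + l.+1)) *m next_mx s G R B.
  rewrite [LHS]rowE; congr (_ *m _); apply/rowP=> t; rewrite !mxE.
  rewrite (_ : (t == lift ord0 i) = (nat_of_ord t == i.+1)) //.
  by case: splitP => j' hj; rewrite !mxE hj ?(ord1 j') ?mul0rn //= add1n eqSS.
have := @next_mul F s l G R B 0 (delta_mx 0 i); rewrite -e mul0r polyC0 add0r -rowE.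
move=> /(congr1 (fun p : {poly {poly F}} => p`_j)); rewrite coef_bivar mxE => ->.
by rewrite mulrBl coefB coefXM coefCM; case: (nat_of_ord j).
Qed.

Lemma tr_step : tr (step_prog 0 1 inp)
  (step_cost n k s l (\max_(i < l.+2) step_bound (encode_mx B) n k s l i))
  (fun out => [/\ well_shaped l.+2 out, is_basis s.+1 alpha w rr (decode_mx l.+2 out)
    & weak_popov (decode_mx l.+2 out *m Wmx F k l.+1)]).
Proof.
apply: tr_add; apply: tr_isz; set r := if _ then 3%N else 2%N; rewrite /inp /=.
have r23 : r = 2%N \/ r = 3%N by rewrite /r; case: ifP; [right | left].
have r_unit : r%:R != 0 :> F.
  rewrite /r; case: (1 + 1 =P 0 :> F) => e; last exact/eqP.
  by rewrite -natr1 -[2%:R]/(1 + 1) e add0r oner_eq0.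
have n0 : (0 < n)%N by apply: leq_trans k_ltn.
pose rl := [seq rr i / w i | i <- enum 'I_n].
have nth_enum (f : 'I_n -> F) (i : 'I_n) : nth 0 [seq f i | i <- enum 'I_n] i = f i.
  by rewrite (nth_map i) ?size_enum_ord // nth_ord_enum.
apply: tr_bind (tr_tab 0 (P := fun i x => x = nth 0 rl i) _) _.
  move=> i hi; apply: tr_inv; apply: tr_mul; apply: tr_ret.
  by rewrite -[i]/(nat_of_ord (Ordinal hi)) !nth_enum.
move=> rs [srs Hrs].
have {Hrs srs rs} -> : rs = rl.
  apply: (@eq_from_nth _ 0); first by rewrite srs size_map size_enum_ord.
  by rewrite srs; exact: Hrs.
pose pts := [seq (alpha i, rr i / w i) | i <- enum 'I_n].
have -> : zip [seq alpha i | i <- enum 'I_n] rl = pts by rewrite zip_map.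
have spts : size pts = n by rewrite size_map size_enum_ord.
have upts : uniq (unzip1 pts).
  by rewrite /unzip1 -map_comp map_inj_uniq ?enum_uniq.
have pin i : (alpha i, rr i / w i) \in pts by apply: map_f; rewrite mem_enum.
apply: tr_bind (tr_interpolate r23 r_unit n0 spts upts) _ => -[gl R1] /= [Hg sg sR HR].
set G := locator pts in Hg; set R := Poly R1 in HR.
have G_root i : root G (alpha i) by apply/eqP; apply: (locator_root (pin i)).
have G_size : size G = n.+1 by rewrite size_locator spts.
have G_neq0 : G != 0 by rewrite monic_neq0 ?monic_locator.
have R_alpha i : R.[alpha i] = rr i / w i by apply: (HR _ (pin i)).
have G_dvd e p : (forall i, ('X - (alpha i)%:P) ^+ e %| p) -> G ^+ e %| p.
  move=> h; apply: locator_exp_dvd => // x /mapP[i _ ->]; exact: h.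
set d := (s * n + l * k.-1)%N.
have redB := B_reduced.
have hd i : (delta i <= d)%N by apply: (basis_row_degree G_root G_size B_basis).
have sB (i t : 'I_l.+1) : (size (B i t) + t * k.-1 <= (delta i).+1)%N \/ B i t = 0.
  have [->|nz] := eqVneq (B i t) 0; [by right | left].
  by have := redB.1 i t; rewrite mul_Wmx size_mulXn // addnC.
have sB' (i t : 'I_l.+1) : (size (ent (encode_mx B) i t) <= d.+1)%N.
  rewrite ent_encode; case: (sB i t) => [h|->]; last by rewrite size_poly0.
  by apply: leq_trans (leq_trans (leq_addr _ _) h) _; rewrite ltnS.
apply: tr_bind (tr_crepeat (P := fun i p => Poly p = G ^+ i /\ (size p <= (i * n).+1)%N) _ _) _.
- by split=> //; apply/polyP=> -[|j]; rewrite coef_Poly coef1 /= ?nth_nil.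
- move=> i p hi [ep sp].
  have sp' : (size p <= (s * n).+1)%N.
    by apply: leq_trans sp _; rewrite ltnS leq_mul2r -ltnS hi orbT.
  apply: tr_weak (tr_pmul _ _ r23 r_unit) (leq_pmul_cost (leq_add sg sp')) _.
  move=> o [so ->]; rewrite Hg ep -exprS; split=> //; apply: leq_trans so _.
  by rewrite mulSn; move: sg sp; move: (size gl) (size p); lia.
move=> gs [egs sgs].
apply: tr_bind (tr_mtab (S := ((n + n).+1 + d.+1).-1) (M := R *: B) (c := pmul_cost ((n + n).+1 + d.+1)) _) _.
  move=> i j; apply: tr_weak (tr_pmul_le r23 r_unit sR (sB' i j)) (leqnn _) _.
  by move=> o [so ->]; split=> //; rewrite mxE ent_encode polyseqK.
move=> rb [erb srb].
have rbE (i : 'I_l.+1) t : Poly (if (t < l.+1)%N then ent rb i t else [::]) = R * (bivar (row i B))`_t.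
  case: ltnP => ht; last by rewrite Poly_nil nth_default ?mulr0 // (leq_trans (size_bivar _)).
  rewrite -[t]/(nat_of_ord (Ordinal ht)) -decode_ent erb mxE; congr (_ * _).
  by rewrite coef_bivar mxE.
have sbij (i : 'I_l.+1) t : (size (ent (encode_mx B) i t) <= d.+1)%N.
  case: (ltnP t l.+1) => ht; first by rewrite -[t]/(nat_of_ord (Ordinal ht)).
  by rewrite ent_encode_out.
apply: tr_bind (tr_mtab (S := maxn (s.+1 * n).+1 ((n + n).+1 + d.+1)) (M := next_mx s G R B)
    (c := (((n + n).+1 + d.+1) * 2).+1) _) _.
  move=> i j; case: (unliftP ord0 i) => [i'|] ->; last first.
    apply: tr_ret; rewrite next_mx0; case: ifP => _; last by rewrite Poly_nil.
    by split=> //; rewrite leq_max sgs.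
  rewrite next_mxS; apply: tr_opp.
  set x := (if nat_of_ord j is j'.+1 then _ else _).
  set y := (if (j < l.+1)%N then _ else _).
  have sx : (size x <= (n + n).+1 + d.+1)%N.
    rewrite /x; case: (nat_of_ord j) => // j'; apply: leq_trans (leq_addl _ _).
    exact: sbij.
  have sy : (size y <= (n + n).+1 + d.+1)%N.
    rewrite /y; case: ltnP => // hj; apply: leq_trans (leq_pred _).
    exact: (srb i' (Ordinal hj)).
  apply: tr_weak (tr_axpy _ (leq_maxl _ _) (leq_maxr _ _)) _ _.
    by rewrite leq_mul2r geq_max sx sy.
  move=> o [-> ->]; split; first by rewrite leq_max !geq_max sx sy orbT.
  rewrite scaleN1r /y rbE; congr (_ - _); rewrite /x; case: (nat_of_ord j) => [|j'].
    exact: Poly_nil.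
  exact: ent_encode_bivar.
move=> c [ec _].
set Zl := mxfun l.+2 _; set E := step_bound _ n k s l.
have eZ : decode_mx l.+2 Zl = next_mx s G R B *m Wmx F k l.+1.
  apply/matrixP=> i j; rewrite decode_ent ent_mxfun Poly_cat Poly_nseq0 add0r size_nseq.
  by rewrite mul_Wmx -ec decode_ent mulrC.
have hk : (k.-1 <= n + n)%N by lia.
have dZ : degbound (decode_mx l.+2 Zl) (fun i : 'I_l.+2 => E i).
  move=> i j; rewrite eZ mul_Wmx; case: (unliftP ord0 i) => [i'|] ->; last first.
    rewrite next_mx0; case: eqP => [->|_]; last by rewrite mul0r size_poly0.
    rewrite mul0n expr0 mulr1; apply: leq_trans (size_poly_exp_leq _ _) _.
    by rewrite G_size /= mulnC.
  rewrite /E [step_bound _ _ _ _ _ _]/= /bump /= add0n rdeg_encode -/(delta i').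
  rewrite next_mxS mulrBl; apply: leq_trans (size_polyD _ _) _; rewrite size_polyN geq_max.
  apply/andP; split.
    case ej: (nat_of_ord j) => [|j']; first by rewrite mul0r size_poly0.
    have hj' : (j' < l.+1)%N by rewrite -ltnS -ej ltn_ord.
    rewrite -[j']/(nat_of_ord (Ordinal hj')) coef_bivar mxE.
    case: (sB i' (Ordinal hj')) => [h|->]; last by rewrite mul0r size_poly0.
    have [->|nz] := eqVneq (B i' (Ordinal hj')) 0; first by rewrite mul0r size_poly0.
    rewrite size_mulXn //; move: h; rewrite /= mulSn; move: (size _) (j' * _)%N; lia.
  case: (ltnP j l.+1) => hj; last first.
    by rewrite nth_default ?mulr0 ?mul0r ?size_poly0 // (leq_trans (size_bivar _)).
  rewrite -[nat_of_ord j]/(nat_of_ord (Ordinal hj)) coef_bivar mxE.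
  case: (sB i' (Ordinal hj)) => [h|->]; last by rewrite mulr0 mul0r size_poly0.
  rewrite -mulrA; apply: leq_trans (size_polyMleq _ _) _.
  have [->|nz] := eqVneq (B i' (Ordinal hj)) 0.
    by rewrite mul0r size_poly0 addn0; have := size_Poly_le sR; rewrite -/R; move: (size R); lia.
  rewrite size_mulXn //; have := size_Poly_le sR; rewrite -/R.
  by move: h; move: (size R) (size _) (_ * _)%N => /=; lia.
have nB := is_basis_det B_basis.
have dC := @det_next F s l G R B.
have nC : \det (next_mx s G R B) != 0 by rewrite dC mulf_neq0 ?expf_neq0.
have sC : size (\det (next_mx s G R B)) = (s.+1 * n + size (\det B))%N.
  rewrite dC size_mul ?expf_neq0 //; have := size_exp G s.+1; rewrite G_size /=.
  have : (0 < size (G ^+ s.+1)%R)%N by rewrite size_poly_gt0 expf_neq0.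
  by rewrite [(n * _)%N]mulnC; move: (size (G ^+ s.+1)%R) (s.+1 * n)%N (size (\det B)); lia.
have nZ : \det (decode_mx l.+2 Zl) != 0.
  by rewrite eZ -size_poly_gt0 size_det_W // addn_gt0 size_poly_gt0 nC orbT.
(* The row degrees of B W sum to the degree of its determinant, and (s + 1) n occurs on both sides;
   the excess is 2n (l + 1) minus the new weight (l + 1)(k - 1). *)
have sumE : (\sum_(i < l.+2) E i < (size (\det (decode_mx l.+2 Zl))).-1 + 2 ^ (lg ((n + n) * l.+1)).+1)%N.
  have hh : ((n + n) * l.+1 < 2 ^ (lg ((n + n) * l.+1)).+1)%N by apply: trunc_log_ltn.
  have := reduced_det redB; rewrite size_det_W // => eB.
  rewrite eZ size_det_W // sC big_ord_recl /=.
  have -> : (\sum_(i < l.+1) E (bump 0 i) = \sum_(i < l.+1) delta i + (n + n) * l.+1)%N.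
    rewrite (eq_bigr (fun i : 'I_l.+1 => delta i + (n + n))%N); last first.
      by move=> i _; rewrite /= rdeg_encode.
    by rewrite big_split /= sum_nat_const card_ord mulnC.
  rewrite (big_ord_recr l.+1) /=; move: eB hh.
  move: (\sum_(i < l.+1) delta i)%N (\sum_(i < l.+1) i * k.-1)%N (size (\det B)) => x y z.
  set Q := (2 ^ (lg ((n + n) * l.+1)).+1)%N; clearbody Q.
  by move: ((n + n) * l.+1)%N (s.+1 * n)%N (l.+1 * k.-1)%N; lia.
apply: tr_bind (tr_reduce r23 r_unit dZ sumE nZ) _ => z [_ [U [V [E1 [VU ez rz]]]]].
apply: tr_ret.
(* The reduced matrix is U times the weighted one, so column j is divisible by X^(j(k-1)) and
   unweighting is exact. *)
have eo : decode_mx l.+2 (mxfun l.+2 (fun i j => drop (j * k.-1) (ent z i j))) = U *m next_mx s G R B.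
  apply/matrixP=> i j; rewrite decode_ent ent_mxfun; apply: Poly_drop.
  by rewrite -decode_ent ez eZ mulmxA mul_Wmx mulrC.
split; first exact: well_shaped_mxfun.
  by rewrite eo; apply: is_basis_unimodular VU _; apply: next_basis.
rewrite eo -mulmxA -eZ -ez; exact: reduced_weak_popov rz.
Qed.

(** Keeps the lengths entering the last reduction in O(l n), by [basis_row_degree]. *)
Lemma step_bound_max :
  (\max_(i < l.+2) step_bound (encode_mx B) n k s l i <= s.+1 * n + (l * n + (n + n)))%N.
Proof.
(* The locator depends on the abscissas only; the values 0 are arbitrary. *)
pose pts := [seq (alpha i, 0 : F) | i <- enum 'I_n].
have G_size : size (locator pts) = n.+1 by rewrite size_locator size_map size_enum_ord.
have G_root i : root (locator pts) (alpha i).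
  apply/eqP; apply: (@locator_root F pts (alpha i, 0)); apply: map_f; by rewrite mem_enum.
apply/bigmax_leqP => i _; case: (unliftP ord0 i) => [i'|] ->; last exact: leq_addr.
rewrite [step_bound _ _ _ _ _ _]/= /bump /= rdeg_encode [X in (_ <= X)%N]addnA leq_add2r.
have h : (delta i' <= s * n + l * k.-1)%N.
  by apply: (basis_row_degree G_root G_size B_basis); exact: B_reduced.
apply: leq_trans h _; rewrite leq_add ?leq_mul //; lia.
Qed.

End StepTriple.

(** * Cost *)

(** A node makes five products, 5 * 76 = 380 units including its additions, against a gain of 2 *
    200. *)
Lemma ptree_cost_le d :
  (ptree_cost d <= 200 * (2000 * (d.+1 * (2 ^ d * logs (2 ^ d.+2)))))%N.
Proof.
elim: d => [|d IH].
  have l1 : (0 < logs (2 ^ 2))%N by [].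
  rewrite /= mul1n expn0 mul1n; move: (logs (2 ^ 2)) l1 => x; lia.
rewrite /= -/ptree_cost; move: IH.
set H := (2 ^ d)%N; set c := ptree_cost d.
have H0 : (0 < H)%N by rewrite expn_gt0.
have e1 : (2 ^ d.+1 = 2 * H)%N by rewrite expnS.
have e2 : (2 ^ d.+2 = 4 * H)%N by rewrite !expnS mulnA.
have e3 : (2 ^ d.+3 = 8 * H)%N by rewrite !expnS !mulnA.
rewrite e1 e2 e3 => IH.
have b2 : (pmul_cost (H.+1 + H.+1) + (4 * H) * 2 <= 19 * (2000 * (4 * H * logs (4 * H))))%N.
  by apply: pmul_cost_le; lia.
have lg8 : (logs (4 * H) <= logs (8 * H))%N by apply: leq_logs; lia.
have := leq_mul (leqnn H) lg8; have := leq_mul (leqnn (H * d.+1)) lg8.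
move: IH b2; move: (pmul_cost _) => p.
have -> : (d.+1 * (H * logs (4 * H)) = H * d.+1 * logs (4 * H))%N by ring.
have -> : (4 * H * logs (4 * H) = 4 * (H * logs (4 * H)))%N by ring.
have -> : (d.+2 * (2 * H * logs (8 * H)) = 2 * (H * d.+1 * logs (8 * H)) + 2 * (H * logs (8 * H)))%N by ring.
clearbody H c; clear e1 e2 e3.
move: (H * d.+1 * logs (4 * H))%N (H * d.+1 * logs (8 * H))%N
   (H * logs (4 * H))%N (H * logs (8 * H))%N => x1 x2 x3 x4.
by lia.
Qed.

Definition volume S := ((lg S).+1 * (S * logs S))%N.

Lemma volume_ge S : (S * logs S <= volume S)%N.
Proof. by rewrite leq_pmull. Qed.

Lemma volume_ge_id S : (S <= volume S)%N.
Proof. by apply: leq_trans (volume_ge S); rewrite leq_pmulr. Qed.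

Lemma lgP n : (0 < n)%N -> (2 ^ lg n <= n)%N.
Proof. by move=> n0; apply: trunc_logP. Qed.

(** 28 n covers 8 (2n + 1) + 2n + 2, the length required by the reduction. That reduction has size
    2, hence the factor 8; 1100 exceeds 200 + 800 + 19. *)
Lemma interpolate_cost_le n S : (0 < n)%N -> (28 * n <= S)%N ->
  (interpolate_cost n <= 1100 * (2000 * volume S))%N.
Proof.
move=> n0 hS; rewrite /interpolate_cost.
have l1 := lgP n0.
have b1 : (ptree_cost (lg n).+1 <= 200 * (2000 * volume S))%N.
  apply: leq_trans (ptree_cost_le _) _; rewrite leq_mul2l leq_mul2l /=.
  have h3 : (2 ^ (lg n).+3 <= S)%N by rewrite !expnS; lia.
  have h3' : ((lg n).+3 <= lg S)%N by apply: trunc_log_max.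
  rewrite /volume leq_mul //; first by lia.
  by rewrite leq_mul ?leq_logs //; rewrite expnS; lia.
have b2 : (reduce_cost 2 (lg (n + n.+1)).+1 (n + n.+1) <= 100 * (2000 * (8 * volume S)))%N.
  have l2 := lgP (ltac:(lia) : 0 < n + n.+1)%N.
  apply: leq_trans (@reduce_cost_le 2 _ _ S isT _) _; first by rewrite !expnS; lia.
  by rewrite leq_mul2l leq_mul2l /= -/(volume S); move: (volume S) => v; lia.
have b3 : (pmul_cost (n.+2 + n) + ((n + n).+1 * 2 + 0) <= 19 * (2000 * volume S))%N.
  apply: leq_trans (_ : pmul_cost (n.+2 + n) + S * 2 <= _)%N; first by rewrite leq_add2l; lia.
  apply: leq_trans (pmul_cost_le _) _; first by lia.
  by rewrite leq_mul2l leq_mul2l /= volume_ge.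
have v1 : (0 < volume S)%N by apply: leq_trans (volume_ge_id S); lia.
by move: b1 b2 b3 v1; move: (volume S); lia.
Qed.

(** 64 l n bounds every length involved. Only the reduction carries l^3, with constant 100 * 27 from
    l + 2 <= 3 l; the rest is at most quadratic in l and fits in the remaining 1300 units, 1100 of
    them for interpolation. *)
Lemma step_cost_le n k s l e : (0 < k)%N -> (k < n)%N -> (0 < s)%N -> (s <= l)%N ->
  (e <= s.+1 * n + (l * n + (n + n)))%N ->
  (step_cost n k s l e <= 4000 * (2000 * (l * (l * l) * volume (64 * (l * n)))))%N.
Proof.
move=> k0 kn s0 sl he; rewrite /step_cost.
set q := (l * n)%N; set S := (64 * q)%N.
have n0 : (0 < n)%N by lia.
have l0 : (0 < l)%N by lia.
have nq : (n <= q)%N by rewrite leq_pmull.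
have sq : (s * n <= q)%N by rewrite leq_mul2r sl orbT.
have kq : (l * k.-1 <= q)%N by rewrite leq_mul2l; apply/orP; right; lia.
set V := volume S.
have SV : (S <= V)%N := volume_ge_id S.
have pm a : (a <= S)%N -> (pmul_cost a <= 19 * (2000 * V))%N.
  move=> ha; apply: leq_trans (leq_addr (S * 2) _) _; apply: leq_trans (pmul_cost_le ha) _.
  by rewrite leq_mul2l leq_mul2l /= volume_ge.
have c1 : (interpolate_cost n <= 1100 * (2000 * V))%N.
  by apply: interpolate_cost_le => //; rewrite /S; lia.
have c2 : (s.+1 * pmul_cost (n.+1 + (s * n).+1) <= 2 * l * (19 * (2000 * V)))%N.
  by apply: leq_mul; [lia | apply: pm; rewrite /S; lia].
have c3 : (l.+1 * (l.+1 * pmul_cost ((n + n).+1 + (s * n + l * k.-1).+1))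
   <= 2 * l * (2 * l * (19 * (2000 * V))))%N.
  by apply: leq_mul; [lia | apply: leq_mul; [lia | apply: pm; rewrite /S; lia]].
have c4 : (l.+2 * (l.+2 * (((n + n).+1 + (s * n + l * k.-1).+1) * 2).+1)
   <= 3 * l * (3 * l * (2000 * V)))%N.
  apply: leq_mul; [lia | apply: leq_mul; [lia |]].
  have SV' : (64 * q <= V)%N := SV.
  by clear -SV' nq sq kq n0; clearbody V; lia.
have c5 : (reduce_cost l.+2 (lg ((n + n) * l.+1)).+1 e <=
    100 * (2000 * (3 * l * (3 * l * (3 * l * V)))))%N.
  have h1 : (0 < (n + n) * l.+1)%N by rewrite muln_gt0; lia.
  have l2 := lgP h1.
  have hq : ((n + n) * l.+1 <= 4 * q)%N.
    have -> : ((n + n) * l.+1 = 2 * q + 2 * n)%N by rewrite /q; ring.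
    by lia.
  apply: leq_trans (@reduce_cost_le l.+2 _ _ S isT _) _.
    rewrite !expnS; move: he; rewrite mulSn -/q /S; move: (2 ^ _)%N l2 hq sq nq.
    by move: ((n + n) * l.+1)%N (s * n)%N; lia.
  by rewrite leq_mul2l leq_mul2l /= !leq_mul //; lia.
have i1 : (V <= l * (l * l) * V)%N by rewrite leq_pmull // !muln_gt0 l0.
have i2 : (l * V <= l * (l * l) * V)%N by rewrite leq_mul2r leq_pmulr ?orbT // muln_gt0 l0.
have i3 : (l * l * V <= l * (l * l) * V)%N by rewrite leq_mul2r leq_pmull ?orbT.
have e2 : (2 * l * (19 * (2000 * V)) = 38 * (2000 * (l * V)))%N by ring.
have e3 : (2 * l * (2 * l * (19 * (2000 * V))) = 76 * (2000 * (l * l * V)))%N by ring.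
have e4 : (3 * l * (3 * l * (2000 * V)) = 9 * (2000 * (l * l * V)))%N by ring.
have e5 : (3 * l * (3 * l * (3 * l * V)) = 27 * (l * (l * l) * V))%N by ring.
rewrite e2 in c2; rewrite e3 in c3; rewrite e4 in c4; rewrite e5 in c5.
have n2 : (n * 2 + 2 <= V)%N by apply: leq_trans SV; rewrite /S; lia.
clear SV pm e2 e3 e4 e5; clearbody V; move: c1 c2 c3 c4 c5 i1 i2 i3 n2.
move: (interpolate_cost _) (s.+1 * _)%N (l.+1 * _)%N (l.+2 * _)%N (reduce_cost _ _ _)
  (l * (l * l) * V)%N (l * l * V)%N (l * V)%N.
by lia.
Qed.

(** For n >= 64 c + 4 one has 64 l n <= 64 c n^3 <= n^4, so passing from l n to n costs constant
    factors in the logarithms: 8, 8 and 5, and 64 * 8 * 8 * 5 = 40 * 512. As n >= 4, lg (lg n) >= 1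
    absorbs the additive constants. *)
Lemma volume_asymp c n l : (64 * c + 4 <= n)%N -> (0 < l)%N -> (l <= c * n ^ 2)%N ->
  (volume (64 * (l * n)) <= 40 * 512 * (l * n * (lg n * lg n * lg (lg n))))%N.
Proof.
move=> hn l0 hl; set S := (64 * (l * n))%N.
have n4 : (4 <= n)%N by lia.
have hS : (S <= n ^ 4)%N.
  apply: (@leq_trans (64 * (c * n ^ 2 * n))); first by rewrite leq_mul2l leq_mul2r hl !orbT.
  have -> : (64 * (c * n ^ 2 * n) = 64 * c * n ^ 3)%N by ring.
  by rewrite (expnS n 3) leq_mul2r; apply/orP; right; lia.
have g2 : (2 <= lg n)%N by apply: trunc_log_max.
have gg1 : (1 <= lg (lg n))%N by apply: trunc_log_max.
have S0 : (0 < S)%N by rewrite /S !muln_gt0 l0; lia.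
have lS : (lg S < 4 * (lg n).+1)%N.
  rewrite -(ltn_exp2l (m := 2)) //; apply: leq_ltn_trans (lgP S0) _.
  apply: leq_ltn_trans hS _; rewrite mulnC expnM ltn_exp2r //.
  exact: trunc_log_ltn.
have lS8 : ((lg S).+1 <= 8 * lg n)%N by lia.
have llS : ((lg (lg S)).+1 <= 5 * lg (lg n))%N.
  have h : (lg (lg S) < (lg (lg n)) + 4)%N.
    case: (posnP (lg S)) => [->|p0]; first by rewrite /lg trunc_log0 addn_gt0 orbT.
    rewrite -(ltn_exp2l (m := 2)) //; apply: leq_ltn_trans (lgP p0) _.
    have t : (lg n < 2 ^ (lg (lg n)).+1)%N by apply: trunc_log_ltn.
    have -> : (lg (lg n) + 4 = (lg (lg n)).+1 + 3)%N by lia.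
    by rewrite expnD; move: (2 ^ (lg (lg n)).+1)%N t => x; lia.
  by lia.
apply: leq_trans (leq_mul lS8 (leq_mul (leqnn S) (leq_mul lS8 llS))) _.
rewrite /S; apply: eq_leq; move: (lg n) (lg (lg n)) => a b; ring.
Qed.

Lemma combine_bounds A K P l n g h x v :
  (x <= A * (K * (l * (l * l) * v)))%N -> (v <= P * (l * n * (g * g * h)))%N ->
  (x <= A * (K * P) * l ^ 4 * n * g ^ 2 * h)%N.
Proof.
move=> hx hv; apply: leq_trans hx _.
apply: (@leq_trans (A * (K * (l * (l * l) * (P * (l * n * (g * g * h))))))).
  by rewrite !leq_mul.
by apply: eq_leq; ring.
Qed.

Theorem corollary3 :
  exists alg : algorithm,
    (* correctness *)
    (forall (F : finFieldType) (n k s l : nat) (alpha w r : 'I_n -> F)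
            (B : 'M[{poly F}]_l.+1),
       (1 <= k)%N -> (k < n)%N -> (n < #|F|)%N ->
       injective alpha -> (forall i, alpha i != 0) -> (forall i, w i != 0) ->
       (0 < s)%N -> (s <= l)%N ->
       is_basis s alpha w r B -> weak_popov (B *m Wmx F k l) ->
       let out := (run (alg F 0%R 1%R (AlgInput n k s l
                      [seq alpha i | i <- enum 'I_n] [seq w i | i <- enum 'I_n]
                      [seq r i | i <- enum 'I_n] (encode_mx B)))).1 in
       well_shaped l.+2 out /\
       is_basis s.+1 alpha w r (decode_mx l.+2 out) /\
       weak_popov (decode_mx l.+2 out *m Wmx F k l.+1))
    /\
    (* cost O(l^4 n log^2 n loglog n), under s, l in O(n^2) *)
    (forall c : nat, exists C N : nat,
     forall (F : finFieldType) (n k s l : nat) (alpha w r : 'I_n -> F)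
            (B : 'M[{poly F}]_l.+1),
       (1 <= k)%N -> (k < n)%N -> (n < #|F|)%N ->
       injective alpha -> (forall i, alpha i != 0) -> (forall i, w i != 0) ->
       (0 < s)%N -> (s <= l)%N ->
       is_basis s alpha w r B -> weak_popov (B *m Wmx F k l) ->
       (N <= n)%N -> (s <= c * n ^ 2)%N -> (l <= c * n ^ 2)%N ->
       ((run (alg F 0%R 1%R (AlgInput n k s l
                [seq alpha i | i <- enum 'I_n] [seq w i | i <- enum 'I_n]
                [seq r i | i <- enum 'I_n] (encode_mx B)))).2
        <= C * l ^ 4 * n * lg n ^ 2 * lg (lg n))%N).
Proof.
exists (fun F zero one inp => step_prog zero one inp); split.
  move=> F n k s l alpha w r B k0 kn _ ai _ _ _ _ bB pB out.
  by have [[h1 h2 h3] _] := tr_step k0 kn ai bB pB.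
move=> c; exists (4000 * (2000 * (40 * 512)))%N, (64 * c + 4)%N.
move=> F n k s l alpha w r B k0 kn _ ai _ _ s0 sl bB pB hN _ hl.
have [_ hc] := tr_step k0 kn ai bB pB.
apply: leq_trans hc _.
apply: combine_bounds (step_cost_le k0 kn s0 sl (step_bound_max k0 kn bB pB)) _.
by apply: volume_asymp hN _ hl; apply: leq_trans sl.
Qed.
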